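(* Let $T>0$, let $V\in C^1(\mathbb R)$ be real-valued and $T$-periodic, let $\varepsilon\ne0$ and $M\in\mathbb N$. Let $u_1,\dots,u_M$ be primary front solutions (as described in the context) of $$\partial_x^2u+\varepsilon V(x)u-\sin(u)=0\qquad(\ast)$$ with $T$-periodic end states $v_{j,\pm}(\varepsilon)$, and assume $v_{j,+}(\varepsilon)=v_{j+1,-}(\varepsilon)$ for $j=1,\dots,M-1$. Then there exists $N\in\mathbb N$ such that for any $n\in\mathbb N$ with $n\ge N$ there exists a nondegenerate solution $\tilde u_n$ of $(\ast)$ of the form $$\tilde u_n=a_n+\sum_{j=1}^M\chi_{j,n}\,u_j(\cdot-jnT),$$ where $\{a_n\}_n$ is a sequence in $H^2(\mathbb R)$ converging to $0$ as $n\to\infty$. If $u_j$ is strongly spectrally stable for all $j=1,\dots,M$, then so is $\tilde u_n$. Moreover, if there exists $j_0\in\{1,\dots,M\}$ such that $u_{j_0}$ is spectrally unstable, then so is $\tilde u_n$.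
   Context: Equation $(\ast)$ describes stationary solutions of $\partial_tu=\partial_x^2u+\varepsilon V(x)u-\sin(u)$, $u(x,t)\in\mathbb R$. For $\underline u\in L^\infty(\mathbb R)$, $L_\varepsilon(\underline u)=\partial_x^2+\varepsilon V-\cos(\underline u)$ on $L^2(\mathbb R)$ with domain $H^2(\mathbb R)$. $\underline u$ is nondegenerate if $L_\varepsilon(\underline u)$ is invertible; strongly spectrally stable if $\sigma(L_\varepsilon(\underline u))\subset\{\operatorname{Re}\lambda\le-\varrho\}$ for some $\varrho>0$; spectrally unstable if some $\lambda\in\sigma(L_\varepsilon(\underline u))$ has $\operatorname{Re}\lambda>0$. $\chi_\pm:\mathbb R\to[0,1]$ is a smooth partition of unity with $\chi_+$ supported on $(-1,\infty)$, $\chi_-$ on $(-\infty,1)$. $H^2_{\rm per}(0,T)$: $T$-periodic, locally $H^2$ functions. Primary fronts. For $k\in\mathbb Z$, $l\in\{\pm1\}$ let $u_{0,k,l}(x)=4\arctan(e^{lx})+2\pi\min\{k,k+l\}$, and let $\varsigma_0\in\mathbb R$ be a simple zero of $V_{\rm eff}(\varsigma)=\int_{\mathbb R}V(x+\varsigma)u_{0,k,l}(x)u_{0,k,l}'(x)\,dx$. Then there exist $C,\varepsilon_0,\varrho>0$ such that for all $\varepsilon\in(-\varepsilon_0,\varepsilon_0)\setminus\{0\}$ there is a nondegenerate solution $u(\varepsilon)$ of $(\ast)$ with $\|u(\varepsilon)-u_{0,k,l}(\cdot-\varsigma_0)\|_{L^\infty}\le C|\varepsilon|$ and $\chi_\pm(u(\varepsilon)-v_\pm(\varepsilon))\in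 H^2(\mathbb R)$, where the end states $v_\pm(\varepsilon)\in H^2_{\rm per}(0,T)$ solve $(\ast)$ and satisfy $\|v_-(\varepsilon)-2\pi k\|_{H^2_{\rm per}(0,T)},\|v_+(\varepsilon)-2\pi(k+l)\|_{H^2_{\rm per}(0,T)}\le C|\varepsilon|$; moreover $\sigma(L_\varepsilon(u(\varepsilon)))\subset(-\infty,-\varrho]\cup\{\lambda_0(\varepsilon)\}$ with $\lambda_0(\varepsilon)$ a real simple eigenvalue, $\lambda_0(\varepsilon)=-\varepsilon V_{\rm eff}'(\varsigma_0)/\|u_{0,k,l}'\|_{L^2}^2+\mathcal O(\varepsilon^2)$. A primary front (for the given $\varepsilon$) is such a $u(\varepsilon)$ with $|\varepsilon|<\varepsilon_0$; the parameters $(k,l,\varsigma_0)$ may depend on $j$. For $M\ge2$ and (sufficiently large) $n$, $\chi_{j,n}:\mathbb R\to[0,1]$, $j=1,\dots,M$, is a smooth partition of unity with $\|\chi_{j,n}\|_{W^{2,\infty}}$ bounded by an $n$-independent constant, $\chi_{1,n}$ supported on $(-\infty,\frac32nT+1)$, $\chi_{M,n}$ on $((M-\frac12)nT-1,\infty)$, and $\chi_{j,n}$ on $((j-\frac12)nT-1,(j+\frac12)nT+1)$ for $2\le j\le M-1$; for $M=1$, $\chi_{1,n}\equiv1$. *)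

(* Defs.v *)
From HB Require Import structures.
From mathcomp Require Import all_boot all_order all_algebra.
From mathcomp Require Import complex.
From mathcomp Require Import all_classical all_reals all_analysis.
Import Order.TTheory GRing.Theory Num.Theory.
Import numFieldNormedType.Exports.

Set Implicit Arguments.
Unset Strict Implicit.
Unset Printing Implicit Defensive.

Local Open Scope classical_set_scope.
Local Open Scope ring_scope.

Section Defs.
Variable R : realType.
Implicit Types (f g u v V phi : R -> R) (D : set R) (eps T rho : R).

Let mu := @lebesgue_measure R.

(* Elements of L^2 and H^2 are represented by functions; equality of elements is
   equality almost everywhere. *)

Definition C1 f := (forall x, derivable f x 1) /\ continuous (derive1 f).

Definition smooth f := forall (m : nat) x, derivable (derive1n m f) x 1.

Definition supp f : set R := closure [set x | f x != 0].

(* Test functions are of class C^1 with compact support, as in Brezis' treatment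
   of Sobolev spaces in dimension one. *)
Definition is_weak_derivative f g :=
  [/\ locally_integrable setT f, locally_integrable setT g &
      forall phi, C1 phi -> compact (supp phi) ->
        \int[mu]_x (f x * derive1 phi x) = - \int[mu]_x (g x * phi x)].

Definition weakly_derivable f := exists g, is_weak_derivative f g.

(* A chosen weak derivative, unique up to a null set; the value is arbitrary
   when f is not weakly derivable. *)
Definition weak_derivative f : R -> R := get [set g | is_weak_derivative f g].

Definition L2 D f := f \_ D \in Lfun mu 2%:E.

Definition L2norm D f : R := fine ('N[mu]_(2%:E)[EFin \o (f \_ D)])%E.

Definition H2 f :=
  [/\ weakly_derivable f, weakly_derivable (weak_derivative f),
      L2 setT f, L2 setT (weak_derivative f) &
      L2 setT (weak_derivative (weak_derivative f))].

Definition H2loc f :=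
  [/\ weakly_derivable f, weakly_derivable (weak_derivative f) &
      forall a b : R, [/\ L2 `[a, b] f, L2 `[a, b] (weak_derivative f) &
        L2 `[a, b] (weak_derivative (weak_derivative f))]].

Definition H2per T f := periodic f T /\ H2loc f.

Definition H2norm D f : R :=
  Num.sqrt (L2norm D f ^+ 2 + L2norm D (weak_derivative f) ^+ 2
            + L2norm D (weak_derivative (weak_derivative f)) ^+ 2).

Definition Linfty_norm f : \bar R := ('N[mu]_(+oo)[EFin \o f])%E.

Local Notation C := R[i].
Implicit Types (h w : R -> C) (A : (R -> C) -> R -> C).

Definition re h : R -> R := fun x => complex.Re (h x).
Definition im h : R -> R := fun x => complex.Im (h x).

Definition cL2 h := L2 setT (re h) /\ L2 setT (im h).

Definition cL2norm h : R :=
  Num.sqrt (L2norm setT (re h) ^+ 2 + L2norm setT (im h) ^+ 2).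

Definition cH2 h := H2 (re h) /\ H2 (im h).

Definition weak_second_derivative h : R -> C := fun x =>
  Complex (weak_derivative (weak_derivative (re h)) x)
          (weak_derivative (weak_derivative (im h)) x).

(* Operators A on L^2(R; C) have domain H^2(R; C); lam is in the resolvent set
   when A - lam maps the domain bijectively onto L^2, with bounded inverse. *)
Definition resolvent_set A : set C := [set lam |
  [/\ forall w, cL2 w -> exists h, cH2 h /\
        {ae mu, forall x, A h x - lam * h x = w x},
      forall h, cH2 h -> {ae mu, forall x, A h x - lam * h x = 0} ->
        {ae mu, forall x, h x = 0} &
      exists K : R, forall h, cH2 h ->
        cL2norm h <= K * cL2norm (fun x => A h x - lam * h x)]].

Definition spectrum A : set C := ~` resolvent_set A.

Definition invertible A := resolvent_set A 0.

(* Algebraic multiplicity one: the kernel of A - lam is a line, and a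
   generator of it is not in the range of A - lam. *)
Definition simple_eigenvalue A (lam : C) :=
  exists h, [/\ cH2 h, ~ {ae mu, forall x, h x = 0},
    {ae mu, forall x, A h x = lam * h x},
    forall w, cH2 w -> {ae mu, forall x, A w x = lam * w x} ->
      exists c : C, {ae mu, forall x, w x = c * h x} &
    ~ exists2 w, cH2 w & {ae mu, forall x, A w x - lam * w x = h x}].

(* Classical solutions: V is continuous, so these are the continuous
   representatives of the solutions in H^2_loc. *)
Definition stationary_solution V eps u := forall x,
  [/\ derivable u x 1, derivable (derive1 u) x 1 &
      derive1n 2 u x + eps * V x * u x - sin (u x) = 0].

Definition L_op V eps u : (R -> C) -> R -> C := fun h x =>
  weak_second_derivative h x + (eps * V x - cos (u x))%:C%C * h x.

Definition nondegenerate_state V eps u := invertible (L_op V eps u).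

Definition strongly_spectrally_stable V eps u :=
  exists2 rho, 0 < rho &
    spectrum (L_op V eps u) `<=` [set lam | complex.Re lam <= - rho].

Definition spectrally_unstable V eps u :=
  exists2 lam : C, spectrum (L_op V eps u) lam & 0 < complex.Re lam.

Definition u0 (k l : int) : R -> R := fun x =>
  4 * atan (expR (l%:~R * x)) + 2 * pi * (Num.min k (k + l))%:~R.

Definition Veff V (k l : int) : R -> R := fun s =>
  \int[mu]_x (V (x + s) * u0 k l x * derive1 (u0 k l) x).

Definition simple_zero f (s : R) := [/\ f s = 0, derivable f s 1 & derive1 f s != 0].

Definition end_cutoffs (chip chim : R -> R) :=
  [/\ smooth chip /\ smooth chim,
      forall x, 0 <= chip x <= 1 /\ 0 <= chim x <= 1,
      forall x, chip x + chim x = 1,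
      supp chip `<=` `]-1, +oo[ & supp chim `<=` `]-oo, 1[].

(* u is the member at parameter eps of a family U of fronts bifurcating from
   u0(. - s0), with end states vm at -oo and vp at +oo; k, l, s0, the constants
   and the family may differ from front to front. *)
Definition primary_front T V (chip chim : R -> R) eps u vm vp :=
  exists (k l : int) (s0 : R),
  [/\ l = 1 \/ l = -1, simple_zero (Veff V k l) s0 &
  exists (K eps0 rho : R) (U Um Up : R -> R -> R) (lam0 : R -> R),
  [/\ [/\ 0 < K, 0 < eps0 & 0 < rho],
      forall e : R, 0 < `|e| < eps0 ->
      [/\ stationary_solution V e (U e) /\ nondegenerate_state V e (U e),
          (Linfty_norm (fun x => U e x - u0 k l (x - s0))%R <= (K * `|e|)%:E)%E,
          H2 (fun x => chip x * (U e x - Up e x)) /\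
          H2 (fun x => chim x * (U e x - Um e x)),
          [/\ H2per T (Um e), stationary_solution V e (Um e),
              H2per T (Up e), stationary_solution V e (Up e) &
              H2norm `]0, T[ (fun x => Um e x - 2 * pi * k%:~R) <= K * `|e| /\
              H2norm `]0, T[ (fun x => Up e x - 2 * pi * (k + l)%:~R)
                <= K * `|e|] &
          spectrum (L_op V e (U e)) `<=`
            [set lam | exists2 r : R, lam = r%:C%C & r <= - rho \/ r = lam0 e]
          /\ simple_eigenvalue (L_op V e (U e)) (lam0 e)%:C%C],
      exists K2 : R, \forall e \near (0 : R)^',
        `|lam0 e + e * derive1 (Veff V k l) s0
                     / L2norm setT (derive1 (u0 k l)) ^+ 2| <= K2 * e ^+ 2 &
      [/\ 0 < `|eps| < eps0, u = U eps, vm = Um eps & vp = Up eps]]].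

(* Ordinals start at 0: the front of index j, j = 1, ..., M, corresponds to
   the ordinal of value j - 1. *)
Definition gluing_cutoffs T (K : R) (M n : nat) (chi : 'I_M -> R -> R) :=
  (M = 1%N -> forall j x, chi j x = 1) /\
  ((1 < M)%N ->
   [/\ forall j, smooth (chi j),
       forall j x, 0 <= chi j x <= 1,
       forall x, \sum_(j < M) chi j x = 1,
       forall j (m : nat), (m <= 2)%N ->
         (Linfty_norm (derive1n m (chi j)) <= K%:E)%E &
       forall j : 'I_M,
         [/\ j = 0%N :> nat -> supp (chi j) `<=` `]-oo, 3 / 2 * n%:R * T + 1[,
             j.+1 = M -> supp (chi j) `<=` `](M%:R - 1 / 2) * n%:R * T - 1, +oo[ &
             (0 < j)%N -> (j.+1 < M)%N -> supp (chi j) `<=`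
               `](j.+1%:R - 1 / 2) * n%:R * T - 1,
                 (j.+1%:R + 1 / 2) * n%:R * T + 1[]]).

Definition glued T (M n : nat) (chi u : 'I_M -> R -> R) : R -> R := fun x =>
  \sum_(j < M) chi j x * u j (x - (j.+1 * n)%:R * T).

End Defs.

(* Main.v *)
(* Let W be the glued profile.  Since consecutive fronts approach the same end state, W
   nearly coincides with one of the translated fronts on the support of each member of a
   partition of unity varying on the scale n T, and its residual W'' + eps V W - sin W tends
   to 0 in L^2.  If h_j inverts the linearization at the j-th front and (p_j) is the
   partition, then sum_j p_j h_j inverts the linearization at W up to a small error, uniformly
   in n; a Newton iteration then corrects W to an exact solution, and the same argument gives
   the nondegeneracy of this solution.

   Spectra are read off from quadratic forms.  The operators L are symmetric and bounded
   above, and the Cauchy-Schwarz inequality for the form of m - L shows that the optimal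
   upper bound m of the form of L belongs to the spectrum.  Hence stability of all the fronts
   bounds their forms by a negative constant, which makes L_j - m invertible uniformly in
   m >= -rho / 4; the partition of unity argument transfers the invertibility, and therefore
   the bound on the form, to the glued solution.  Conversely, a translated eigenfunction of
   an unstable front makes the form of the glued operator positive. *)
Require Import Defs.
From HB Require Import structures.
From mathcomp Require Import all_boot all_order all_algebra.
From mathcomp Require Import complex.
From mathcomp Require Import all_classical all_reals all_analysis.
From mathcomp Require Import measurable_realfun ess_sup_inf.
From mathcomp Require Import ring lra.
Import Order.TTheory GRing.Theory Num.Theory.
Import numFieldNormedType.Exports.

Set Implicit Arguments.
Unset Strict Implicit.
Unset Printing Implicit Defensive.

Local Open Scope classical_set_scope.
Local Open Scope ring_scope.

(** Two families of cutoffs occur. The given [chi] change over intervals of bounded length, and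
    their derivatives are only bounded by a constant. This suffices for the residual, since the
    overlaps have length O(1) and the fronts are uniformly close there. A parametrix built with them
    would have commutators that do not tend to 0, whence a second partition with derivatives O(1 /
    (n T)). Only solvability with a bound is transferred from the fronts to the glued state: a
    surjective symmetric operator is injective, so right inverses are enough. Form bounds control
    the real spectral parameters; the nonreal ones are reached by continuation from 0, where
    nondegeneracy gives invertibility. The weak derivatives chosen in [H2] are determined only up to
    null sets, so the analysis is done with explicit triples [W2 f f1 f2]. One abstract iteration
    serves the linear equation, the stationary equation and the complex resolvent. *)

Local Notation l2 := (L2 setT).
Local Notation nrm := (L2norm setT).
Local Notation wd := is_weak_derivative.

(** * Integrals and square-integrable functions *)

(* Inference does not find this instance through the sigma-algebra on which
   [lebesgue_measure] is defined. *)
#[global] Instance lebesgue_ae_filter (R : realType) :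
  Filter (almost_everywhere (@lebesgue_measure R)) :=
  ae_filter_ringOfSetsType (@lebesgue_measure R).

Section RealIntegrals.
Variable R : realType.
Local Notation mu := (@lebesgue_measure R).
Implicit Types (f g h w : R -> R).

Local Notation Igr f := (mu.-integrable setT (EFin \o f)).

Lemma Igr_meas f : Igr f -> measurable_fun setT f.
Proof. by move=> /integrableP[/measurable_EFinP]. Qed.

Lemma Igr_le f g : measurable_fun setT f -> Igr g ->
  (forall x, `|f x| <= g x) -> Igr f.
Proof.
move=> mf ig le; apply: le_integrable ig => //; first exact/measurable_EFinP.
by move=> x _ /=; rewrite lee_fin (le_trans (le x))// ler_norm.
Qed.

Lemma IgrD f g : Igr f -> Igr g -> Igr (fun x => f x + g x).
Proof. by move=> If Ig; have := integrableD measurableT If Ig. Qed.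

Lemma IgrN f : Igr f -> Igr (fun x => - f x).
Proof. by move=> If; have := integrableN If. Qed.

Lemma IgrB f g : Igr f -> Igr g -> Igr (fun x => f x - g x).
Proof. by move=> If Ig; apply: IgrD => //; exact: IgrN. Qed.

Lemma IgrZ c f : Igr f -> Igr (fun x => c * f x).
Proof. by move=> If; have := integrableZl measurableT c If. Qed.

Lemma Igr_bounded_mul (B : R) h f : measurable_fun setT h ->
  (forall x, `|h x| <= B) -> Igr f -> Igr (fun x => h x * f x).
Proof.
move=> mh hB If; apply: (@Igr_le _ (fun x => B * `|f x|)).
- by apply: measurable_funM => //; exact: Igr_meas.
- by apply: IgrZ; have := integrable_abse If.
- by move=> x; rewrite normrM ler_wpM2r.
Qed.

Lemma eq_RintegralT f g : f =1 g -> \int[mu]_x f x = \int[mu]_x g x.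
Proof. by move=> fg; apply: eq_Rintegral => x _. Qed.

Lemma Rint_ae_eq f g : measurable_fun setT f -> measurable_fun setT g ->
  {ae mu, forall x, f x = g x} -> \int[mu]_x f x = \int[mu]_x g x.
Proof.
move=> mf mg fg; congr fine; apply: ae_eq_integral => //;
  try exact/measurable_EFinP.
by apply: filterS fg => x -> _.
Qed.

Lemma Rint_ge0_ae f : measurable_fun setT f -> {ae mu, forall x, 0 <= f x} ->
  0 <= \int[mu]_x f x.
Proof.
move=> mf f0; rewrite (@Rint_ae_eq f (fun x => Num.max (f x) 0))//.
- by apply: Rintegral_ge0 => x _; rewrite le_max lexx orbT.
- by apply: measurable_maxr.
- by apply: filterS f0 => x fx; rewrite max_l.
Qed.

Lemma le_Rint_ae f g : Igr f -> Igr g -> {ae mu, forall x, f x <= g x} ->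
  \int[mu]_x f x <= \int[mu]_x g x.
Proof.
move=> If Ig fg; rewrite -subr_ge0 -RintegralB//; apply: Rint_ge0_ae.
  by apply: measurable_funB; exact: Igr_meas.
by apply: filterS fg => x; rewrite subr_ge0.
Qed.

Lemma Rint_eq0_ae f : Igr f -> (forall x, 0 <= f x) -> \int[mu]_x f x = 0 ->
  {ae mu, forall x, f x = 0}.
Proof.
move=> If f0 I0.
have /integrableP[mf _] := If.
have [+ _] := ae_eq_integral_abs mu measurableT mf.
have -> : (\int[mu]_(x in setT) `|(EFin \o f) x| = 0)%E.
  under eq_integral do rewrite /= ger0_norm ?f0//.
  by rewrite -(fineK (integrable_fin_num measurableT If)) [fine _]I0.
by move=> /(_ erefl); apply: filterS => x /(_ I) [].
Qed.

End RealIntegrals.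

Section SquareIntegrable.
Variable R : realType.
Local Notation mu := (@lebesgue_measure R).
Local Notation Igr f := (mu.-integrable setT (EFin \o f)).
Implicit Types (f g h w : R -> R).

Definition ip f g : R := \int[mu]_x (f x * g x).

Lemma L2_Lfun f : l2 f <-> f \in Lfun mu 2%:E.
Proof. by rewrite /L2 patch_setT. Qed.

Lemma L2_meas f : l2 f -> measurable_fun setT f.
Proof. by move/L2_Lfun; rewrite inE => /andP[]; rewrite inE. Qed.

Lemma L2norm_EFin f : ('N[mu]_(2%:E)[EFin \o f] = (\int[mu]_x (f x ^+ 2)%:E) `^ 2^-1)%E.
Proof.
rewrite unlock; congr (_ `^ _)%E; apply: eq_integral => x _.
by rewrite /= powR_mulrn// real_normK// num_real.
Qed.

Lemma L2_sqr f : l2 f <-> measurable_fun setT f /\ Igr (fun x => f x ^+ 2).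
Proof.
split=> [lf|[mf If]].
  by split; [exact: L2_meas | exact/Lfun2_integrable_sqr/L2_Lfun].
apply/L2_Lfun; rewrite inE; apply/andP; split; rewrite inE//= /finite_norm.
rewrite L2norm_EFin poweR_lty//.
move/integrableP: If => [_]; under eq_integral do rewrite /= ger0_norm ?sqr_ge0//.
by [].
Qed.

Lemma L2_le f g : measurable_fun setT f -> l2 g ->
  (forall x, `|f x| <= `|g x|) -> l2 f.
Proof.
move=> mf /L2_sqr[mg Ig] le; apply/L2_sqr; split => //.
apply: Igr_le Ig _; first exact: measurable_funX.
move=> x; rewrite normrX -(real_normK (num_real (g x))).
by rewrite lerXn2r// nnegrE.
Qed.

Lemma L2_mul f g : l2 f -> l2 g -> Igr (fun x => f x * g x).
Proof.
by move=> /L2_Lfun lf /L2_Lfun lg; apply/Lfun1_integrable/Lfun2_mul_Lfun1.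
Qed.

Lemma L2D f g : l2 f -> l2 g -> l2 (fun x => f x + g x).
Proof.
move=> lf lg; have [mf If] := (L2_sqr f).1 lf; have [mg Ig] := (L2_sqr g).1 lg.
apply/L2_sqr; split; first exact: measurable_funD.
have -> : (fun x => (f x + g x) ^+ 2) =
  (fun x => (f x ^+ 2 + g x ^+ 2) + 2 * (f x * g x)).
  by apply/funext => x; ring.
by apply: IgrD; [exact: IgrD|apply: IgrZ; exact: L2_mul].
Qed.

Lemma L2Z c f : l2 f -> l2 (fun x => c * f x).
Proof.
move=> /L2_sqr[mf If]; apply/L2_sqr; split; first exact: measurable_funM.
have -> : (fun x => (c * f x) ^+ 2) = (fun x => c ^+ 2 * f x ^+ 2).
  by apply/funext => x; rewrite exprMn.
exact: IgrZ.
Qed.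

Lemma L2N f : l2 f -> l2 (fun x => - f x).
Proof.
by move=> /(L2Z (-1)); congr (l2 _); apply/funext => x; rewrite mulN1r.
Qed.

Lemma L2B f g : l2 f -> l2 g -> l2 (fun x => f x - g x).
Proof. by move=> lf lg; apply: L2D => //; exact: L2N. Qed.

Lemma L2_zero : l2 (fun=> 0 : R).
Proof.
apply/L2_sqr; split => //; have -> : (fun x : R => (0 : R) ^+ 2) = cst 0.
  by apply/funext => x; rewrite expr0n.
exact: integrable0.
Qed.

Lemma L2_sum (I : finType) (F : I -> R -> R) : (forall i, l2 (F i)) ->
  l2 (fun x => \sum_i F i x).
Proof.
move=> lF.
have H (s : seq I) : l2 (fun x => \sum_(i <- s) F i x).
  elim: s => [|i s IH].
    by under eq_fun do rewrite big_nil; exact: L2_zero.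
  by under eq_fun do rewrite big_cons; exact: L2D.
exact: H.
Qed.

Lemma L2_bounded_mul (B : R) h f : measurable_fun setT h ->
  (forall x, `|h x| <= B) -> l2 f -> l2 (fun x => h x * f x).
Proof.
move=> mh hB lf; apply: (@L2_le _ (fun x => B * f x)).
- by apply: measurable_funM => //; exact: L2_meas.
- exact: L2Z.
- move=> x; rewrite !normrM ler_wpM2r// (le_trans (hB x))//.
  exact: ler_norm.
Qed.

Lemma nrm_ge0 f : 0 <= nrm f.
Proof. by rewrite fine_ge0// Lnorm_ge0. Qed.

Lemma ip_ge0 f : 0 <= ip f f.
Proof. by apply: Rintegral_ge0 => x _; rewrite -expr2 sqr_ge0. Qed.

Lemma nrm_sqr f : l2 f -> nrm f ^+ 2 = ip f f.
Proof.
move=> /L2_sqr[mf If].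
rewrite /L2norm patch_setT L2norm_EFin.
have fi : (\int[mu]_x (f x ^+ 2)%:E)%E \is a fin_num.
  exact: integrable_fin_num.
have -> : ip f f = fine (\int[mu]_x (f x ^+ 2)%:E)%E.
  by apply: eq_RintegralT => x; rewrite expr2.
rewrite -[X in (X `^ _)%E]fineK// poweR_EFin/=.
by rewrite powR12_sqrt ?sqr_sqrtr// fine_ge0// integral_ge0// => x _;
  rewrite lee_fin sqr_ge0.
Qed.

Lemma ipC f g : ip f g = ip g f.
Proof. by apply: eq_RintegralT => x; rewrite mulrC. Qed.

Lemma ipDl f g h : l2 f -> l2 g -> l2 h -> ip (fun x => f x + g x) h = ip f h + ip g h.
Proof.
move=> lf lg lh; rewrite /ip -RintegralD//; try exact: L2_mul.
by apply: eq_RintegralT => x; rewrite mulrDl.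
Qed.

Lemma ipZl c f h : l2 f -> l2 h -> ip (fun x => c * f x) h = c * ip f h.
Proof.
move=> lf lh; rewrite /ip -RintegralZl//; try exact: L2_mul.
by apply: eq_RintegralT => x; rewrite mulrA.
Qed.

Lemma ipBl f g h : l2 f -> l2 g -> l2 h -> ip (fun x => f x - g x) h = ip f h - ip g h.
Proof.
move=> lf lg lh; rewrite /ip -RintegralB//; try exact: L2_mul.
by apply: eq_RintegralT => x; rewrite mulrBl.
Qed.

Lemma nrm_ip f : l2 f -> nrm f = Num.sqrt (ip f f).
Proof. by move=> lf; rewrite -nrm_sqr// sqrtr_sqr ger0_norm// nrm_ge0. Qed.

Lemma ip_add_scale f g (t : R) : l2 f -> l2 g ->
  ip (fun x => f x + t * g x) (fun x => f x + t * g x) =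
  ip f f + 2 * t * ip f g + t ^+ 2 * ip g g.
Proof.
move=> lf lg; have lt := L2Z t lg; have lt2 := L2D lf lt.
rewrite ipDl// ipZl// (ipC f) (ipC g) !ipDl// !ipZl// (ipC g f); ring.
Qed.

(** All signs of c are covered, so that the same inequality gives Cauchy--Schwarz for the inner
    product and, in [form_le_gap], for a form that is merely nonnegative. *)
Lemma quadratic_ge0_discr (a b c : R) :
  (forall t, 0 <= a + 2 * t * b + t ^+ 2 * c) -> b ^+ 2 <= a * c.
Proof.
move=> H; have a0 : 0 <= a by have := H 0; rewrite mulr0 mul0r expr0n/= mul0r !addr0.
have [c0|c0|c0] := ltrgtP c 0.
- exfalso.
  (* The mean of the values at t and -t is a + c t^2. For t = 1 - a / c >= 1 one has c t = c - a <
     0, hence a + c t^2 <= c < 0. *)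
  have h1 := H (1 - a / c); have h2 := H (- (1 - a / c)).
  have d : c * (1 - a / c) = c - a by field; rewrite lt_eqF.
  have e : 1 <= 1 - a / c.
    by rewrite lerDl oppr_ge0 mulr_ge0_le0// invr_le0 ltW.
  move: h1 h2 d e; move: (1 - a / c) => t h1 h2 d e.
  nra.
- have := H (- b / c).
  have -> : a + 2 * (- b / c) * b + (- b / c) ^+ 2 * c = (a * c - b ^+ 2) / c.
    by field; rewrite gt_eqF.
  by rewrite pmulr_lge0 ?invr_gt0// subr_ge0.
- rewrite c0 mulr0.
  have [->|b0] := eqVneq b 0; first by rewrite expr0n.
  exfalso; have := H (- (a + 1) / (2 * b)); rewrite c0 mulr0 addr0.
  have -> : 2 * (- (a + 1) / (2 * b)) * b = - (a + 1) by field.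
  lra.
Qed.

Lemma cauchy_schwarz f g : l2 f -> l2 g -> `|ip f g| <= nrm f * nrm g.
Proof.
move=> lf lg; rewrite -ler_sqr ?nnegrE ?mulr_ge0 ?nrm_ge0//.
rewrite exprMn !nrm_sqr// real_normK ?num_real//.
by apply: quadratic_ge0_discr => t; rewrite -ip_add_scale// ip_ge0.
Qed.

Lemma nrmZ c f : l2 f -> nrm (fun x => c * f x) = `|c| * nrm f.
Proof.
move=> lf; have lc := L2Z c lf.
by rewrite !nrm_ip// ipZl// ipC ipZl// mulrA -expr2 sqrtrM ?sqr_ge0// sqrtr_sqr.
Qed.

Lemma nrmN f : l2 f -> nrm (fun x => - f x) = nrm f.
Proof.
move=> lf; rewrite -[RHS]mul1r -(normrN1 R) -nrmZ//.
by congr (L2norm _ _); apply/funext => x; rewrite mulN1r.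
Qed.

Lemma nrmD f g : l2 f -> l2 g -> nrm (fun x => f x + g x) <= nrm f + nrm g.
Proof.
move=> lf lg; rewrite -ler_sqr ?nnegrE ?addr_ge0 ?nrm_ge0//.
rewrite (nrm_sqr (L2D lf lg)).
have := ip_add_scale 1 lf lg; rewrite expr1n mulr1 mul1r.
have -> : (fun x => f x + 1 * g x) = (fun x => f x + g x).
  by apply/funext => x; rewrite mul1r.
have := le_trans (ler_norm _) (cauchy_schwarz lf lg).
by move=> ? ->; rewrite sqrrD !nrm_sqr//; lra.
Qed.

Lemma nrmB f g : l2 f -> l2 g -> nrm (fun x => f x - g x) <= nrm f + nrm g.
Proof. by move=> lf lg; rewrite -(nrmN lg); apply: nrmD => //; exact: L2N. Qed.

Lemma nrm_zero : nrm (fun=> 0 : R) = 0.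
Proof.
have := nrmZ 0 L2_zero; rewrite normr0 (mul0r (nrm _)) => H; rewrite -[RHS]H.
by congr (L2norm _ _); apply/funext => x; rewrite mul0r.
Qed.

Lemma nrm_sum (I : finType) (F : I -> R -> R) (c : I -> R) :
  (forall i, l2 (F i)) -> (forall i, nrm (F i) <= c i) ->
  nrm (fun x => \sum_i F i x) <= \sum_i c i.
Proof.
move=> lF Fc.
have H (s : seq I) : l2 (fun x => \sum_(i <- s) F i x) /\
    nrm (fun x => \sum_(i <- s) F i x) <= \sum_(i <- s) c i.
  elim: s => [|i s [IH1 IH2]].
    by under eq_fun do rewrite big_nil; rewrite big_nil nrm_zero; split => //; exact: L2_zero.
  under eq_fun do rewrite big_cons; rewrite big_cons; split; first exact: L2D.
  by rewrite (le_trans (nrmD (lF i) IH1))// lerD.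
exact: (H _).2.
Qed.

Lemma nrm_le_ae (B : R) f g : 0 <= B -> l2 f -> l2 g ->
  {ae mu, forall x, `|f x| <= B * `|g x|} -> nrm f <= B * nrm g.
Proof.
move=> B0 lf lg fg; rewrite -ler_sqr ?nnegrE ?mulr_ge0 ?nrm_ge0//.
rewrite exprMn !nrm_sqr// /ip -RintegralZl//; last exact: L2_mul.
apply: le_Rint_ae; [exact: L2_mul| by apply: IgrZ; exact: L2_mul|].
apply: filterS fg => x H.
rewrite -!expr2 -(real_normK (num_real (f x))) -(real_normK (num_real (g x))).
by rewrite -exprMn lerXn2r ?nnegrE ?mulr_ge0.
Qed.

Lemma nrm_ae f g : l2 f -> l2 g -> {ae mu, forall x, f x = g x} -> nrm f = nrm g.
Proof.
move=> lf lg fg; apply/eqP; rewrite eq_le -[X in _ <= X]mul1r -[X in _ && (_ <= X)]mul1r.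
by apply/andP; split; apply: nrm_le_ae => //; apply: filterS fg => x ->; rewrite mul1r.
Qed.

Lemma L2_ae f g : l2 f -> measurable_fun setT g ->
  {ae mu, forall x, f x = g x} -> l2 g.
Proof.
move=> /L2_sqr[mf If] mg fg; apply/L2_sqr; split => //.
have mg2 : measurable_fun setT (fun x => g x ^+ 2) by exact: measurable_funX.
apply/integrableP; split; first exact/measurable_EFinP.
move/integrableP: If => [/measurable_EFinP mf2].
have -> // : (\int[mu]_x `|(EFin \o (fun y : R => f y ^+ 2)%R) x| =
          \int[mu]_x `|(EFin \o (fun y : R => g y ^+ 2)%R) x|)%E.
apply: ae_eq_integral => //.
- by apply: measurableT_comp => //; exact/measurable_EFinP.
- by apply: measurableT_comp => //; exact/measurable_EFinP.
- by apply: filterS fg => x /= -> _.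
Qed.

Lemma ip_ae f f' g : l2 f -> l2 f' -> l2 g -> {ae mu, forall x, f x = f' x} ->
  ip f g = ip f' g.
Proof.
move=> lf lf' lg ff'; apply: Rint_ae_eq.
- exact: Igr_meas (L2_mul lf lg).
- exact: Igr_meas (L2_mul lf' lg).
- by apply: filterS ff' => x ->.
Qed.

Lemma nrm_eq0_ae f : l2 f -> nrm f = 0 -> {ae mu, forall x, f x = 0}.
Proof.
move=> lf n0; have : ip f f = 0 by rewrite -nrm_sqr// n0 expr0n.
move=> /Rint_eq0_ae -/(_ (L2_mul lf lf) (fun x => _)) H.
have {}H : {ae mu, forall x, f x * f x = 0} by apply: H => x; rewrite -expr2 sqr_ge0.
by apply: filterS H => x /eqP; rewrite mulf_eq0 orbb => /eqP.
Qed.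

(** Uniqueness of Lebesgue measure: the image measure under the translation gives ]a, b] its
    length. *)
Lemma lebesgue_measure_shift (c : R) (A : set R) : measurable A ->
  mu ((fun x => x + c) @^-1` A) = mu A.
Proof.
move=> mA.
rewrite -[LHS]/(pushforward mu ((fun x => x + c) : _ -> measurableTypeR R) A).
apply/esym/lebesgue_measure_unique => //=; first exact: measurable_funD.
move=> mph _ [[a b]] _ <-; rewrite /pushforward/=.
have -> : (fun x => x + c) @^-1` `]a, b] = `]a - c, b - c]%classic.
  by apply/seteqP; split=> x /=; rewrite !in_itv/= ltrBlDr lerBrDr.
rewrite !lebesgue_measure_itv/= !lte_fin ltrD2r.
by case: ifPn => // _; rewrite -!EFinD; congr (_%:E); ring.
Qed.

Let measurable_shift c : measurable_fun setT ((fun x : R => x + c) : R -> measurableTypeR R).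
Proof. exact: measurable_funD. Qed.

Lemma ge0_integral_shift (c : R) (F : R -> \bar R) : measurable_fun setT F ->
  (forall x, 0 <= F x)%E -> (\int[mu]_x F ((x : R) + c)%R = \int[mu]_x F x)%E.
Proof.
move=> mF F0.
have := @ge0_integral_pushforward _ _ (measurableTypeR R) (measurableTypeR R) R
  _ (measurable_shift c) mu setT F measurableT mF (fun x _ => F0 x).
rewrite preimage_setT => <-; apply: eq_measure_integral => [|? A mA _]; first exact: measurable_shift.
exact: lebesgue_measure_shift.
Qed.

Lemma integrable_shift c f : Igr f -> Igr (fun x => f (x + c)).
Proof.
move=> If; have mf := Igr_meas If.
have mfc : measurable_fun setT (fun x : R => f (x + c)).
  exact: (measurableT_comp mf (measurable_shift c)).
move/integrableP: If => [_ fin]; apply/integrableP; split; first exact/measurable_EFinP.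
apply: le_lt_trans fin.
rewrite -(@ge0_integral_shift c (fun x => `|(f x)%:E|%E))//.
by apply: measurableT_comp => //; exact/measurable_EFinP.
Qed.

Lemma Rintegral_shift c f : Igr f -> \int[mu]_x f (x + c) = \int[mu]_x f x.
Proof.
move=> If; have Ifc := integrable_shift c If.
have mf : measurable_fun setT (EFin \o f) by apply/measurable_EFinP; exact: Igr_meas.
have := @integral_pushforward _ _ (measurableTypeR R) (measurableTypeR R) R
  _ (measurable_shift c) mu setT (EFin \o f) mf.
rewrite preimage_setT => /(_ Ifc measurableT) H; congr fine.
rewrite -[LHS]H; apply: eq_measure_integral => [|? A mA _]; first exact: measurable_shift.
exact: lebesgue_measure_shift.
Qed.

Lemma L2_shift c f : l2 f -> l2 (fun x => f (x + c)).
Proof.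
move=> /L2_sqr[mf If]; apply/L2_sqr; split.
  exact: (measurableT_comp mf (measurable_shift c)).
exact: (integrable_shift c If).
Qed.

Lemma nrm_shift c f : l2 f -> nrm (fun x => f (x + c)) = nrm f.
Proof.
move=> lf; rewrite !nrm_ip//; last exact: L2_shift.
by congr Num.sqrt; exact: (Rintegral_shift c (L2_mul lf lf)).
Qed.

Lemma ae_shift c (P : R -> Prop) : {ae mu, forall x, P x} -> {ae mu, forall x, P (x + c)}.
Proof.
move=> [A [mA A0 PA]]; exists ((fun x => x + c) @^-1` A); split.
- by rewrite -[X in measurable X]setTI; exact: measurable_shift.
- by rewrite -[RHS]A0; exact: lebesgue_measure_shift.
- by move=> x /= nP; apply: PA.
Qed.

(** Dominated convergence for the squares of the truncations, with f^2 as dominating function. *)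
Lemma L2_tail f (d : R) : l2 f -> 0 < d ->
  exists X : R, nrm (f \_ [set x | X <= `|x|]) <= d.
Proof.
move=> lf d0; have [mf If] := (L2_sqr f).1 lf.
pose A (n : nat) : set R := [set x | n%:R <= `|x|].
have mA n : measurable (A n).
  have -> : A n = (fun x => `|x|) @^-1` `[n%:R, +oo[%classic.
    by apply/seteqP; split=> x /=; rewrite in_itv/= andbT.
  by rewrite -[X in measurable X]setTI; apply: measurableT_comp.
have mfA n : measurable_fun setT (f \_ (A n)).
  exact: (measurable_restrictT f (mA n)).1 (measurable_funS measurableT (@subsetT _ _) mf).
have lfA n : l2 (f \_ (A n)).
  apply: L2_le lf _ => // x; rewrite patchE; case: ifP => // _.
  by rewrite normr0.
have := @dominated_convergence _ _ R mu setT measurableT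
  (fun n x => ((f \_ (A n)) x ^+ 2)%:E) (cst 0%E) (fun x => (f x ^+ 2)%:E).
case.
- by move=> n; apply/measurable_EFinP; apply: measurable_funX; exact: mfA.
- by [].
- apply: nearW => x _; apply: cvg_near_cst.
  have [m hm] : exists m : nat, `|x| < m%:R.
    by exists (Num.bound `|x|); apply: archi_boundP.
  exists m => // n /= mn; rewrite patchE ifF ?expr0n//.
  apply/negP => /set_mem; rewrite /A/= leNgt => /negP; apply.
  by rewrite (lt_le_trans hm)// ler_nat.
- exact: If.
- apply: nearW => x n _; rewrite gee0_abs ?lee_fin ?sqr_ge0// patchE.
  by case: ifP => // _; rewrite expr0n sqr_ge0.
move=> _ _; rewrite integral_cst// mul0e => /fine_cvgP[fn].
move=> /cvgrPdist_le/(_ (d ^+ 2)); rewrite exprn_gt0// => /(_ isT)[m _ /(_ m (leqnn m))].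
rewrite /= sub0r normrN => H; exists m%:R.
rewrite -ler_sqr ?nnegrE ?nrm_ge0 ?(ltW d0)// nrm_sqr; last exact: lfA.
by apply: le_trans H; rewrite (le_trans _ (ler_norm _)).
Qed.

Lemma le_sqrt_of_sqr (a b : R) : 0 <= b -> a ^+ 2 <= b ^+ 2 -> a <= b.
Proof. by move=> b0 H; rewrite (le_trans (ler_norm a))// -ler_sqr ?nnegrE// real_normK ?num_real. Qed.

Lemma integrable_of_bound (C : R) f : measurable_fun setT f -> (forall x, 0 <= f x) ->
  (\int[mu]_x (f x)%:E <= C%:E)%E -> Igr f /\ \int[mu]_x f x <= C.
Proof.
move=> mf f0 H.
have If : Igr f.
  apply/integrableP; split; first exact/measurable_EFinP.
  under eq_integral do rewrite /= ger0_norm ?f0//.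
  by rewrite (le_lt_trans H)// ltry.
split => //; rewrite -lee_fin fineK//; exact: (integrable_fin_num measurableT If).
Qed.

(** The integral is extended-valued, so that square integrability is part of the conclusion; Fatou's
    lemma delivers its bound in this form. *)
Lemma nrm_le_of_integral (C : R) f : 0 <= C -> measurable_fun setT f ->
  (\int[mu]_x (f x ^+ 2)%:E <= (C ^+ 2)%:E)%E -> l2 f /\ nrm f <= C.
Proof.
move=> C0 mf H; have [||If le] := @integrable_of_bound (C ^+ 2) (fun x => f x ^+ 2) _ _ H.
- exact: measurable_funX.
- by move=> x; exact: sqr_ge0.
have lf : l2 f by apply/L2_sqr.
by split => //; apply: le_sqrt_of_sqr => //; rewrite nrm_sqr.
Qed.

Lemma integral_le_of_nrm (C : R) f : 0 <= C -> l2 f -> nrm f <= C ->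
  (\int[mu]_x (f x ^+ 2)%:E <= (C ^+ 2)%:E)%E.
Proof.
move=> C0 lf H; have [mf If] := (L2_sqr f).1 lf.
rewrite -(fineK (integrable_fin_num measurableT If)) lee_fin.
have -> : fine (\int[mu]_x (EFin \o (fun y => f y ^+ 2)%R) x)%E = nrm f ^+ 2.
  by rewrite nrm_sqr//; apply: eq_RintegralT => x; rewrite expr2.
by rewrite lerXn2r ?nnegrE ?nrm_ge0.
Qed.

Section Completeness.
Variables (f : nat -> R -> R) (C : R).
Hypothesis C0 : 0 <= C.
Hypothesis lf : forall k, l2 (f k).
Hypothesis fast : forall k, nrm (fun x => f k.+1 x - f k x) <= C * 2^-1 ^+ k.

Let h k x : R := `|f k.+1 x - f k x|.
Let S n x : R := \sum_(0 <= i < n) h i x.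

Let mf k : measurable_fun setT (f k). Proof. exact: L2_meas. Qed.

Let lh k : l2 (h k).
Proof.
have lfk := L2B (lf k.+1) (lf k).
apply: L2_le lfk _; last by move=> x; rewrite /h normr_id.
by apply: measurableT_comp => //; exact: L2_meas (L2B (lf k.+1) (lf k)).
Qed.

Let nh k : nrm (h k) <= C * 2^-1 ^+ k.
Proof.
apply: le_trans (fast k); have lfk := L2B (lf k.+1) (lf k).
rewrite -[leRHS]mul1r; apply: nrm_le_ae => //.
by apply: nearW => x; rewrite /h normr_id mul1r.
Qed.

Let S_succ n : S n.+1 = (fun x => S n x + h n x).
Proof. by apply/funext => x; rewrite /S big_nat_recr. Qed.

(** The bound is the exact geometric sum; the subtracted term makes the induction close. *)
Let lS n : l2 (S n) /\ nrm (S n) <= 2 * C - 2 * C * 2^-1 ^+ n.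
Proof.
elim: n => [|n [l1 b1]].
  have -> : S 0 = (fun=> 0) by apply/funext => x; rewrite /S big_nil.
  by split; [exact: L2_zero|rewrite nrm_zero expr0 mulr1 subrr].
rewrite S_succ; split; first exact: (L2D l1 (lh n)).
apply: le_trans (nrmD l1 (lh n)) _.
by have := nh n; move: b1; rewrite exprS; lra.
Qed.

Let S_bound n : nrm (S n) <= 2 * C.
Proof.
have [_ H] := lS n; apply: le_trans H _.
by rewrite gerBl mulr_ge0// ?mulr_ge0// exprn_ge0.
Qed.

Let S_homo x m n : (m <= n)%N -> S m x <= S n x.
Proof.
move=> mn; rewrite /S (@big_cat_nat _ _ _ m 0 n)//=.
by rewrite lerDl; apply: sumr_ge0 => i _; exact: normr_ge0.
Qed.

Let S_ge0 n x : 0 <= S n x.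
Proof. by rewrite sumr_ge0// => i _; exact: normr_ge0. Qed.

(** Monotone convergence for the squares of [S n]: their limit has integral at most (2 C)^2, so it
    is finite almost everywhere. *)
Let ae_bounded : {ae mu, forall x, exists B, forall n, S n x <= B}.
Proof.
have mS n : measurable_fun setT (fun x => (S n x ^+ 2)%:E).
  by apply/measurable_EFinP; apply: measurable_funX; exact: (L2_meas (lS n).1).
have S20 n x : setT x -> (0 <= (S n x ^+ 2)%:E)%E by rewrite lee_fin sqr_ge0.
have Sh x : setT x -> {homo (fun n => (S n x ^+ 2)%:E) : n m / (n <= m)%N >-> (n <= m)%E}.
  by move=> _ n m nm; rewrite lee_fin lerXn2r ?nnegrE ?S_ge0// S_homo.
pose L x := limn (fun n => (S n x ^+ 2)%:E).
have mL : measurable_fun setT L.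
  apply: (emeasurable_fun_cvg (fun n x => (S n x ^+ 2)%:E)) => // x _.
  by apply: ereal_nondecreasing_is_cvgn; exact: Sh.
have IL : mu.-integrable setT L.
  apply/integrableP; split => //.
  have L0 x : (0 <= L x)%E.
    apply: lime_ge; first by apply: ereal_nondecreasing_is_cvgn; exact: Sh.
    by apply: nearW => n; exact: S20.
  under eq_integral do rewrite gee0_abs ?L0//.
  rewrite (monotone_convergence mu measurableT mS S20 Sh).
  apply: (@le_lt_trans _ _ ((2 * C) ^+ 2)%:E); last exact: ltry.
  apply: lime_le.
    apply: ereal_nondecreasing_is_cvgn => n m nm.
    apply: (ge0_le_integral mu measurableT) => //.
    - exact: S20.
    - exact: mS.
    - exact: mS.
    - by move=> x _; exact: Sh.
  apply: nearW => n; apply: integral_le_of_nrm; rewrite ?mulr_ge0//.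
  exact: (lS n).1.
have := integrable_ae measurableT IL.
apply: filterS => x /(_ I) Lfin.
exists (Num.sqrt (fine (L x))) => n.
rewrite -[leLHS](ger0_norm (S_ge0 n x)) -sqrtr_sqr ler_wsqrtr//.
rewrite -lee_fin fineK//.
have -> : L x = ereal_sup (range (fun n => (S n x ^+ 2)%:E)).
  by apply/cvg_lim => //; apply: ereal_nondecreasing_cvgn; exact: Sh.
by apply: ereal_sup_ubound; exists n.
Qed.

Let f_cvg : {ae mu, forall x, cvgn (fun n => f n x)}.
Proof.
apply: filterS ae_bounded => x [B SB].
have c1 : cvgn [normed (series (fun i => f i.+1 x - f i x))].
  apply: (nondecreasing_is_cvgn (u_ := [normed (series (fun i => f i.+1 x - f i x))])).
    by move=> m n mn; exact: (S_homo x mn).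
  by exists B => _ [n _ <-]; exact: SB.
have c2 := normed_cvg c1.
have -> : (fun n => f n x) = (fun n => f 0 x + series (fun i => f i.+1 x - f i x) n).
  apply/funext => n; rewrite /series/= telescope_sumr//.
  by rewrite addrC subrK.
by apply: is_cvgD => //; exact: is_cvg_cst.
Qed.

(** Riesz--Fischer for sequences with geometrically decreasing increments. The increments are
    absolutely summable at almost every point, which gives a pointwise limit; Fatou's lemma then
    turns the bounds on [f n - f k] into a bound on [f k - g]. *)
Lemma L2_complete : exists g, l2 g /\
  forall k, nrm (fun x => f k x - g x) <= 2 * C * 2^-1 ^+ k.
Proof.
(* The limit superior is measurable on the whole line, whereas the limit exists only almost
   everywhere. *)
pose ge x := limn_esup (fun n => (f n x)%:E).
have mge : measurable_fun setT ge.
  by apply: measurable_fun_limn_esup => n; exact/measurable_EFinP.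
pose g x := fine (ge x).
have mg : measurable_fun setT g by exact: (measurableT_comp (@fine_measurable R setT measurableT) mge).
have fg : {ae mu, forall x, (fun n => f n x) @ \oo --> g x}.
  apply: filterS f_cvg => x cx; rewrite /g /ge.
  have ce : (fun n => (f n x)%:E) @ \oo --> (limn (fun n => f n x))%:E.
    by apply: cvg_EFin cx; exact: nearW.
  by rewrite (cvg_limn_einf_sup ce)/=.
have nfk k n : (k <= n)%N -> nrm (fun x => f n x - f k x) <= 2 * C * 2^-1 ^+ k - 2 * C * 2^-1 ^+ n.
  elim: n => [|n IH].
    by rewrite leqn0 => /eqP ->; under eq_fun do rewrite subrr; rewrite nrm_zero subrr.
  rewrite leq_eqVlt => /orP[/eqP ->|kn].
    by under eq_fun do rewrite subrr; rewrite nrm_zero subrr.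
  have {}IH := IH kn.
  have -> : (fun x => f n.+1 x - f k x) = (fun x => (f n.+1 x - f n x) + (f n x - f k x)).
    by apply/funext => x; ring.
  apply: le_trans (nrmD (L2B (lf n.+1) (lf n)) (L2B (lf n) (lf k))) _.
  by have := fast n; move: IH; rewrite (exprS _ n); lra.
have B0 k : 0 <= 2 * C * 2^-1 ^+ k by rewrite mulr_ge0 ?mulr_ge0 ?exprn_ge0.
have Hk k : l2 (fun x => f k x - g x) /\ nrm (fun x => f k x - g x) <= 2 * C * 2^-1 ^+ k.
  apply: nrm_le_of_integral => //; first exact: measurable_funB.
  pose F n x := ((f n x - f k x) ^+ 2)%:E.
  have mF n : measurable_fun setT (F n).
    by apply/measurable_EFinP; apply: measurable_funX; exact: measurable_funB.
  rewrite (@ae_eq_integral _ _ _ mu setT (fun x => limn_einf (F^~ x)))//.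
  - apply: le_trans (@fatou _ _ _ mu setT measurableT F mF _) _.
      by move=> n x _; rewrite lee_fin sqr_ge0.
    rewrite limn_einf_lim; apply: lime_le; first exact: is_cvg_einfs.
    apply: nearW => m; apply: (@le_trans _ _ (\int[mu]_x F (maxn m k) x)%E).
      by apply: ereal_inf_lbound; exists (maxn m k) => //=; exact: leq_maxl.
    apply: integral_le_of_nrm => //; first exact: L2B.
    by rewrite (le_trans (nfk _ _ (leq_maxr m k)))// gerBl.
  - by apply/measurable_EFinP; apply: measurable_funX; exact: (measurable_funB (mf k) mg).
  - have -> : (fun x => limn_einf (F^~ x)) = (fun x => - limn_esup (fun n => - F n x))%E.
      apply/funext => x; rewrite -limn_einfN; congr limn_einf.
      by apply/funext => n; exact: (esym (oppeK _)).
    apply: measurableT_comp => //; apply: measurable_fun_limn_esup => n.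
    by apply: measurableT_comp => //; exact: mF.
  - apply: filterS fg => x cx _.
    apply/esym; apply: (cvg_limn_einf_sup _).1; apply: cvg_EFin; first exact: nearW.
    rewrite (_ : (f k x - g x) ^+ 2 = (g x - f k x) ^+ 2); last by ring.
    by rewrite !expr2; apply: cvgM; apply: cvgB => //; exact: cvg_cst.
exists g; split; last by move=> k; exact: (Hk k).2.
have := L2B (lf 0) (Hk 0%N).1; congr l2; apply/funext => x; ring.
Qed.

End Completeness.

End SquareIntegrable.

(** * Weak derivatives *)

Section Calculus.
Variable R : realType.
Local Notation mu := (@lebesgue_measure R).
Local Notation Igr f := (mu.-integrable setT (EFin \o f)).
Implicit Types (f g phi : R -> R).

Lemma cfc (c : R) : continuous (fun _ : R => c).
Proof. by move=> x; exact: cvg_cst. Qed.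

Lemma cfD f g : continuous f -> continuous g -> continuous (fun x => f x + g x).
Proof. by move=> cf cg x; apply: cvgD; [exact: cf|exact: cg]. Qed.

Lemma cfB f g : continuous f -> continuous g -> continuous (fun x => f x - g x).
Proof. by move=> cf cg x; apply: cvgB; [exact: cf|exact: cg]. Qed.

Lemma cfM f g : continuous f -> continuous g -> continuous (fun x => f x * g x).
Proof. by move=> cf cg x; apply: cvgM; [exact: cf|exact: cg]. Qed.

Lemma cf_comp f g : continuous f -> continuous g -> continuous (fun x => f (g x)).
Proof. by move=> cf cg x; apply: (@continuous_comp _ _ _ g f); [exact: cg|exact: cf]. Qed.

Lemma cf_affine (a b : R) : continuous (fun x : R => a * x + b).
Proof. by apply: cfD; [apply: cfM; [exact: cfc|move=> x; exact: cvg_id]|exact: cfc]. Qed.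

Lemma cf_sum (I : finType) (F : I -> R -> R) : (forall i, continuous (F i)) ->
  continuous (fun x => \sum_i F i x).
Proof.
move=> H; have {}H (s : seq I) : continuous (fun x => \sum_(i <- s) F i x).
  elim: s => [|i s IH]; first by under eq_fun do rewrite big_nil; exact: cfc.
  by under eq_fun do rewrite big_cons; exact: cfD.
exact: H.
Qed.

(** An estimate of the remainder for all increments makes the knots of piecewise polynomials no
    different from other points: inequalities replace one-sided limits. *)
Lemma is_derive_quadratic (C : R) f (x d : R) :
  (forall h : R, `|f (x + h) - f x - h * d| <= C * h ^+ 2) -> is_derive x 1 f d.
Proof.
move=> H.
have C0 : 0 <= C by have := H 1; rewrite expr1n mulr1; exact: le_trans.
have c : (fun h : R => h^-1 *: (f (h *: (1 : R) + x) - f x)) @ 0^' --> d.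
  apply/cvgrPdist_le => e e0; near=> h.
  have h0 : h != 0 by near: h; exact: nbhs_dnbhs_neq.
  have -> : d - h^-1 *: (f (h *: (1 : R) + x) - f x) = - (h^-1 * (f (x + h) - f x - h * d)).
    by rewrite /GRing.scale/= mulr1 (addrC h) !mulrBr mulKf//; ring.
  rewrite normrN normrM normfV ler_pdivrMl ?normr_gt0//.
  apply: le_trans (H h) _; rewrite -(real_normK (num_real h)) expr2 mulrA mulrC ler_wpM2l//.
  have : `|h| <= e / (C + 1).
    near: h; apply/nbhs_dnbhs; exists (e / (C + 1)) => /=; first by rewrite divr_gt0// ltr_wpDl.
    by move=> y /=; rewrite sub0r normrN => /ltW.
  rewrite ler_pdivlMr ?ltr_wpDl// => h1; have := normr_ge0 h; nra.
have dr : derivable f x 1 by apply/cvg_ex; exists d.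
by split => //; apply/cvg_lim.
Unshelve. all: by end_near. Qed.

Lemma derive1_is_derive f f' : (forall x : R, is_derive x 1 f (f' x)) -> derive1 f = f'.
Proof. by move=> H; apply/funext => x; rewrite derive1E; exact: derive_val. Qed.

Lemma C1_is_derive f f' : (forall x : R, is_derive x 1 f (f' x)) -> continuous f' -> C1 f.
Proof. by move=> H c; split; [move=> x; exact: ex_derive|rewrite (derive1_is_derive H)]. Qed.

Lemma is_derive_C1 f (x : R) : C1 f -> is_derive x 1 f (derive1 f x).
Proof. by move=> [d _]; rewrite derive1E; exact: derivableP. Qed.

Lemma C1_continuous f : C1 f -> continuous f.
Proof. by move=> [d _] x; apply: differentiable_continuous; exact/derivable1_diffP. Qed.

Lemma is_derive_mul f g (x df dg : R) : is_derive x 1 f df -> is_derive x 1 g dg ->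
  is_derive x 1 (fun y => f y * g y) (df * g x + f x * dg).
Proof.
move=> Hf Hg; apply: (is_derive_eq (@is_deriveM _ _ f g x 1 df dg Hf Hg)).
by rewrite /GRing.scale/=; ring.
Qed.

Lemma is_derive_scale c f (x df : R) : is_derive x 1 f df ->
  is_derive x 1 (fun y => c * f y) (c * df).
Proof. by move=> Hf; exact: (is_deriveZ c Hf). Qed.

Lemma is_derive_add f g (x df dg : R) : is_derive x 1 f df -> is_derive x 1 g dg ->
  is_derive x 1 (fun y => f y + g y) (df + dg).
Proof. by move=> Hf Hg; exact: (is_deriveD Hf Hg). Qed.

Lemma is_derive_sub f g (x df dg : R) : is_derive x 1 f df -> is_derive x 1 g dg ->
  is_derive x 1 (fun y => f y - g y) (df - dg).
Proof. by move=> Hf Hg; exact: (is_deriveB Hf Hg). Qed.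

Lemma is_derive_affine f (a b x d : R) : is_derive (a * x + b) 1 f d ->
  is_derive x 1 (fun y => f (a * y + b)) (a * d).
Proof.
move=> H; have H2 : is_derive x 1 (fun y : R => a * y + b) a.
  apply: (@is_derive_quadratic 0) => h; rewrite mul0r.
  by rewrite (_ : _ - _ - _ = 0) ?normr0//; ring.
by rewrite mulrC; exact: (@is_derive1_comp _ f (fun y => a * y + b) x d a H H2).
Qed.

Lemma is_derive_shift f (c x d : R) : is_derive (x + c) 1 f d ->
  is_derive x 1 (fun y => f (y + c)) d.
Proof.
move=> H; have := @is_derive_affine f 1 c x d; rewrite !mul1r => /(_ H).
by under eq_fun do rewrite mul1r.
Qed.

Lemma is_derive_sum (I : finType) (F : I -> R -> R) (dF : I -> R) (x : R) :
  (forall i, is_derive x 1 (F i) (dF i)) ->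
  is_derive x 1 (fun y => \sum_i F i y) (\sum_i dF i).
Proof.
move=> H.
have {H} H (s : seq I) : is_derive x 1 (fun y => \sum_(i <- s) F i y) (\sum_(i <- s) dF i).
  elim: s => [|i s IH].
    by under eq_fun do rewrite big_nil; rewrite big_nil; exact: is_derive_cst.
  by under eq_fun do rewrite big_cons; rewrite big_cons; exact: is_derive_add.
exact: H.
Qed.

Let pos (x : R) := Num.max x 0.

Let pos_cases x : (pos x = x /\ 0 <= x) \/ (pos x = 0 /\ x <= 0).
Proof. by rewrite /pos; have [h|/ltW h] := leP x 0; [right|left]. Qed.

Let is_derive_pos2 (x : R) : is_derive x 1 (fun y : R => pos y ^+ 2) (2 * pos x).
Proof.
apply: (@is_derive_quadratic 1) => h; rewrite ler_norml.
by case: (pos_cases (x + h)) => -[-> h1]; case: (pos_cases x) => -[-> h2];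
  apply/andP; split; nra.
Qed.

Let is_derive_pos3 (x : R) : is_derive x 1 (fun y : R => pos y ^+ 3) (3 * pos x ^+ 2).
Proof.
have E : (fun y : R => pos y ^+ 3) = (fun y => y * pos y ^+ 2).
  by apply/funext => y; case: (pos_cases y) => -[-> _]; ring.
rewrite E; apply: is_derive_eq; first exact: (is_derive_mul (is_derive_id _ _) (is_derive_pos2 x)).
by rewrite /=; case: (pos_cases x) => -[-> _]; ring.
Qed.

(** Third backward difference with step 1/3. It kills quadratic polynomials and sends x^3 to the
    constant 3! / 3^3 = 2/9, whence the factor 9/2 in [step]. *)
Let spline (k : R -> R) (x : R) : R := k x - 3 * k (x + - 3^-1) + 3 * k (x + - (2 / 3)) - k (x + - 1).

Let is_derive_spline (k k' : R -> R) (x : R) : (forall y : R, is_derive y 1 k (k' y)) ->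
  is_derive x 1 (spline k) (spline k' x).
Proof.
move=> H; apply: is_derive_sub; last exact: is_derive_shift.
apply: is_derive_add; last by apply: is_derive_scale; exact: is_derive_shift.
apply: is_derive_sub => //; by apply: is_derive_scale; exact: is_derive_shift.
Qed.

(* Cubic spline with knots 0, 1/3, 2/3, 1, equal to 0 on the left and to 1 on the right. *)
Definition step (x : R) : R := 9 / 2 * spline (fun y => pos y ^+ 3) x.
Definition dstep (x : R) : R := 9 / 2 * spline (fun y => 3 * pos y ^+ 2) x.
Definition ddstep (x : R) : R := 9 / 2 * spline (fun y => 6 * pos y) x.

Lemma is_derive_step (x : R) : is_derive x 1 step (dstep x).
Proof. by apply: is_derive_scale; apply: is_derive_spline => y; exact: is_derive_pos3. Qed.

Lemma is_derive_dstep (x : R) : is_derive x 1 dstep (ddstep x).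
Proof.
apply: is_derive_scale; apply: is_derive_spline => y.
by rewrite (_ : 6 * pos y = 3 * (2 * pos y)); [exact: is_derive_scale|ring].
Qed.

Let pos_continuous : continuous pos.
Proof.
move=> x; have -> : pos = (fun y => (y + `|y|) / 2).
  apply/funext => y; rewrite /pos; have [h|/ltW h] := leP y 0.
    by rewrite ler0_norm// subrr mul0r.
  by rewrite ger0_norm//; field.
apply: cvgM; last exact: cvg_cst.
by apply: cvgD; [exact: cvg_id|apply: cvg_norm; exact: cvg_id].
Qed.

Lemma ddstep_continuous : continuous ddstep.
Proof.
have sh (c : R) : continuous (fun y => pos (y + c)).
  move=> x; apply: (@continuous_comp _ _ _ (fun y : R => y + c) pos); last exact: pos_continuous.
  by apply: cvgD; [exact: cvg_id|exact: cvg_cst].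
have c := pos_continuous.
rewrite /ddstep/spline; apply: cfM; first exact: cfc.
apply: cfB; last by apply: cfM; [exact: cfc|exact: sh].
apply: cfD; last by apply: cfM; [exact: cfc|apply: cfM; [exact: cfc|exact: sh]].
apply: cfB; first by apply: cfM; [exact: cfc|].
by apply: cfM; [exact: cfc|apply: cfM; [exact: cfc|exact: sh]].
Qed.

Let pos0 y : y <= 0 -> pos y = 0. Proof. by move=> y0; rewrite /pos max_r. Qed.
Let pos1 y : 0 <= y -> pos y = y. Proof. by move=> y0; rewrite /pos max_l. Qed.

Lemma step_le0 x : x <= 0 -> [/\ step x = 0, dstep x = 0 & ddstep x = 0].
Proof.
move=> x0; rewrite /step /dstep /ddstep /spline.
rewrite (pos0 x0) !pos0; try lra.
by split; ring.
Qed.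

Lemma step_ge1 x : 1 <= x -> [/\ step x = 1, dstep x = 0 & ddstep x = 0].
Proof.
move=> x1; rewrite /step /dstep /ddstep /spline.
rewrite !pos1; try lra.
by split; field.
Qed.

(** The coefficients of [spline] have absolute sum 8, and the second derivative gives the largest of
    the three crude bounds, 9/2 * 6 * 8 = 216. *)
Lemma step_bound x : [/\ `|step x| <= 216, `|dstep x| <= 216 & `|ddstep x| <= 216].
Proof.
have [/step_le0[-> -> ->]|x0] := leP x 0; first by rewrite normr0; split; lra.
have [/step_ge1[-> -> ->]|x1] := leP 1 x; first by rewrite normr0 normr1; split; lra.
have P c : 0 <= c -> 0 <= pos (x + - c) <= 1.
  move=> c0; case: (pos_cases (x + - c)) => -[-> h]; lra.
have p0 : 0 <= pos x <= 1 by have := P 0; rewrite oppr0 addr0; apply.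
have /P p1 : 0 <= 3^-1 :> R by lra.
have /P p2 : 0 <= 2 / 3 :> R by lra.
have /P p3 : 0 <= 1 :> R by lra.
have X n y : 0 <= y <= 1 -> 0 <= (y : R) ^+ n <= 1.
  by move=> /andP[a b]; rewrite exprn_ge0//= exprn_ile1.
have := X 2 _ p0; have := X 2 _ p1; have := X 2 _ p2; have := X 2 _ p3.
have := X 3 _ p0; have := X 3 _ p1; have := X 3 _ p2; have := X 3 _ p3.
rewrite /step /dstep /ddstep /spline !ler_norml.
by split; apply/andP; split; lra.
Qed.

End Calculus.

Section WeakDerivatives.
Variable R : realType.
Local Notation mu := (@lebesgue_measure R).
Local Notation Igr f := (mu.-integrable setT (EFin \o f)).
Implicit Types (f g phi : R -> R).

Lemma compact_supp_vanish phi (r : R) : (forall x, r < `|x| -> phi x = 0) -> compact (supp phi).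
Proof.
move=> H; apply: (@subclosed_compact _ _ `[- r, r]%classic).
- exact: closed_closure.
- exact: segment_compact.
- have cl : closed (`[- r, r]%classic : set R).
    by apply: compact_closed; [exact: Rhausdorff|exact: segment_compact].
  have E := (closure_id _).1 cl; rewrite /supp E; apply: closure_subset => x /= px.
  rewrite in_itv/= -ler_norml leNgt; apply/negP => /H h.
  by rewrite h eqxx in px.
Qed.

Lemma vanish_compact_supp phi : compact (supp phi) ->
  exists2 r : R, 0 < r & forall x, r < `|x| -> phi x = 0.
Proof.
move=> /compact_bounded[M [_ HM]].
exists (`|M| + 1); first by rewrite ltr_wpDl.
move=> x hx; apply/eqP; apply: contraTT isT => px; exfalso.
have : supp phi x by apply: subset_closure.
move=> /(HM (`|M| + 1)); rewrite (le_lt_trans (ler_norm M)) ?ltrDl// => /(_ isT).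
by rewrite /= leNgt hx.
Qed.

Definition vanish_outside (r : R) phi := forall x, r < `|x| -> phi x = 0.

Lemma vanish_outside_restrict r phi : vanish_outside r phi ->
  phi = phi \_ `[- r, r].
Proof.
move=> H; apply/funext => x; rewrite patchE; case: ifPn => //.
rewrite notin_setE/= in_itv/= -ler_norml => /negP; rewrite -ltNge; exact: H.
Qed.

Lemma Igr_patch f (A : set R) : measurable A -> mu.-integrable A (EFin \o f) -> Igr (f \_ A).
Proof. by move=> mA If; rewrite -restrict_EFin; exact: (integrable_mkcond (mu := mu) (EFin \o f) mA).1. Qed.

Lemma Igr_unpatch f (A : set R) : measurable A -> Igr (f \_ A) -> mu.-integrable A (EFin \o f).
Proof. by move=> mA If; apply: (integrable_mkcond (mu := mu) (EFin \o f) mA).2; rewrite restrict_EFin. Qed.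

Lemma Rint_vanish r phi : vanish_outside r phi ->
  \int[mu]_x phi x = \int[mu]_(x in `[- r, r]) phi x.
Proof. by move=> H; rewrite [RHS]Rintegral_mkcond -vanish_outside_restrict. Qed.

Lemma Igr_vanish r phi : vanish_outside r phi ->
  mu.-integrable `[- r, r] (EFin \o phi) -> Igr phi.
Proof. by move=> /vanish_outside_restrict H /(Igr_patch (measurable_itv _)); rewrite -H. Qed.

Lemma Igr_continuous r phi : continuous phi -> vanish_outside r phi -> Igr phi.
Proof.
move=> c /Igr_vanish; apply; apply: continuous_compact_integrable.
  exact: segment_compact.
by apply: continuous_subspaceT => x; exact: c.
Qed.

Lemma continuous_bounded_on (r : R) f : continuous f -> exists2 B : R, 0 < B & forall x, `|x| <= r -> `|f x| <= B.
Proof.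
move=> c; have : compact (f @` `[- r, r]).
  apply: continuous_compact; last exact: segment_compact.
  by apply: continuous_subspaceT => x; exact: c.
move=> /compact_bounded[M [_ HM]]; exists (`|M| + 1); first by rewrite ltr_wpDl.
move=> x hx; apply: (HM (`|M| + 1)); first by rewrite (le_lt_trans (ler_norm M)) ?ltrDl.
by exists x => //=; rewrite in_itv/= -ler_norml.
Qed.

Lemma loc_Igr_seg f (a b : R) : locally_integrable setT f -> mu.-integrable `[a, b] (EFin \o f).
Proof.
move=> [mf _ H]; apply/integrableP; split.
  by apply/measurable_EFinP; exact: (measurable_funS measurableT (@subsetT _ _) mf).
by apply: H => //; exact: segment_compact.
Qed.

Lemma seg_loc_Igr f : measurable_fun setT f ->
  (forall r : R, mu.-integrable `[- r, r] (EFin \o f)) -> locally_integrable setT f.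
Proof.
move=> mf H; split => //; first exact: openT.
move=> K _ cK; have [M [_ HM]] := compact_bounded cK.
have /integrableP[_] := H (`|M| + 1); apply: le_lt_trans.
apply: ge0_subset_integral => //.
- exact: compact_measurable.
- apply/measurable_EFinP; apply: measurableT_comp => //.
  exact: (measurable_funS measurableT (@subsetT _ _) mf).
- move=> x Kx /=; rewrite in_itv/= -ler_norml.
  by apply: (HM (`|M| + 1)) => //; rewrite (le_lt_trans (ler_norm M)) ?ltrDl.
Qed.

Lemma L2_loc f : l2 f -> locally_integrable setT f.
Proof.
move=> /L2_sqr[mf If]; apply: seg_loc_Igr => // r; apply: Igr_unpatch => //.
have I1 : Igr ((cst 1 : R -> R) \_ `[- r, r]).
  apply: Igr_patch => //; apply: continuous_compact_integrable.
    exact: segment_compact.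
  by apply: continuous_subspaceT => x; exact: cvg_cst.
apply: Igr_le (IgrD I1 If) _.
  apply: (measurable_restrictT f _).1 => //.
  exact: (measurable_funS measurableT (@subsetT _ _) mf).
move=> x; rewrite !patchE; case: ifP => _.
  rewrite ler_norml /=; apply/andP; split; have := sqr_ge0 (f x + 1); have := sqr_ge0 (f x - 1); nra.
by rewrite normr0 add0r sqr_ge0.
Qed.

Lemma loc_mul_Igr r f phi : locally_integrable setT f -> continuous phi ->
  vanish_outside r phi -> Igr (fun x => f x * phi x).
Proof.
move=> lf cphi v.
have [B B0 HB] := continuous_bounded_on r cphi.
have v' : vanish_outside r (fun x => f x * phi x) by move=> x /v ->; rewrite mulr0.
have fr : Igr (f \_ `[- r, r]) by apply: Igr_patch => //; exact: loc_Igr_seg.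
have -> : (fun x => f x * phi x) = (fun x => phi x * (f \_ `[- r, r]) x).
  apply/funext => x; rewrite patchE mulrC; case: ifPn => //.
  rewrite notin_setE/= in_itv/= -ler_norml => /negP; rewrite -ltNge => /v ->.
  by rewrite !mul0r.
apply: (@Igr_bounded_mul _ B) => //; first exact: continuous_measurable_fun.
move=> x; have [/v ->|/HB//] := ltP r `|x|.
by rewrite normr0 ltW.
Qed.

Lemma loc_mul_continuous f phi : locally_integrable setT f -> continuous phi ->
  locally_integrable setT (fun x => f x * phi x).
Proof.
move=> lf c; have [mf _ _] := lf.
have mphi := continuous_measurable_fun c.
apply: seg_loc_Igr; first exact: measurable_funM.
move=> r; have [B B0 HB] := continuous_bounded_on r c.
have If := integrableZl (mu := mu) (measurable_itv _) B (integrable_abse (loc_Igr_seg (- r) r lf)).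
apply: le_integrable If => //.
  apply/measurable_EFinP; apply: (measurable_funS measurableT (@subsetT _ _)).
  exact: measurable_funM.
move=> x /=; rewrite in_itv/= -ler_norml => /HB h.
by rewrite lee_fin !normrM normr_id (gtr0_norm B0) mulrC ler_wpM2r.
Qed.

Lemma loc_continuous f : continuous f -> locally_integrable setT f.
Proof.
move=> c; apply: seg_loc_Igr; first exact: continuous_measurable_fun.
move=> r; apply: continuous_compact_integrable; first exact: segment_compact.
by apply: continuous_subspaceT => x; exact: c.
Qed.

Lemma locZ c f : locally_integrable setT f -> locally_integrable setT (fun x => c * f x).
Proof.
move=> lf; under eq_fun do rewrite mulrC.
by apply: loc_mul_continuous => //; exact: cfc.
Qed.

Lemma derive1_vanish r phi : C1 phi -> vanish_outside r phi -> vanish_outside r (derive1 phi).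
Proof.
move=> C v x hx; rewrite derive1E; have := @is_derive_cst R R R 0 x 1.
move=> H; have : is_derive x 1 phi 0.
  apply: near_eq_is_derive H; near=> y; apply/esym/v.
  near: y; apply: (@cvgr_gt _ _ (nbhs x) _ (fun y : R => `|y|) `|x|) => //.
  by apply: cvg_norm; exact: cvg_id.
by move=> ?; rewrite derive_val.
Unshelve. all: by end_near. Qed.

Lemma FTC_C1 (a b : R) phi : a < b -> C1 phi ->
  \int[mu]_(x in `[a, b]) derive1 phi x = phi b - phi a.
Proof.
move=> ab C; rewrite /Rintegral (@continuous_FTC2 _ (derive1 phi) phi)//.
- by apply: continuous_subspaceT; case: C.
- split; first by move=> x _; exact: C.1.
  + by apply: cvg_at_right_filter; exact: (C1_continuous C).
  + by apply: cvg_at_left_filter; exact: (C1_continuous C).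
Qed.

Lemma Rint_derive1_vanish r phi : 0 < r -> C1 phi -> vanish_outside r phi ->
  \int[mu]_x derive1 phi x = 0.
Proof.
(* On the larger interval [phi] vanishes at both end points, where [vanish_outside r] makes no claim
   if |x| = r. *)
move=> r0 C v; have v2 : vanish_outside (r + 1) phi.
  by move=> x hx; apply: v; rewrite (lt_trans _ hx)// ltrDl.
rewrite (Rint_vanish (derive1_vanish C v2)) FTC_C1//; last by lra.
rewrite !v ?subrr//; last by rewrite gtr0_norm; lra.
by rewrite normrN gtr0_norm; lra.
Qed.

Lemma C1_mul f g : C1 f -> C1 g -> C1 (fun x => f x * g x) /\
  derive1 (fun x => f x * g x) = (fun x => derive1 f x * g x + f x * derive1 g x).
Proof.
move=> Cf Cg.
have H (x : R) : is_derive x 1 (fun x : R => f x * g x) (derive1 f x * g x + f x * derive1 g x).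
  by apply: is_derive_mul; exact: is_derive_C1.
split; last exact: derive1_is_derive.
have cf := C1_continuous Cf; have cg := C1_continuous Cg.
case: Cf Cg => [_ cdf] [_ cdg].
by apply: (C1_is_derive H); apply: cfD; apply: cfM.
Qed.

Lemma wdE f g r phi : wd f g -> C1 phi -> vanish_outside r phi ->
  \int[mu]_x (f x * derive1 phi x) = - \int[mu]_x (g x * phi x).
Proof. by move=> [_ _ H] C v; apply: H => //; exact: compact_supp_vanish v. Qed.

Lemma wdI f g : locally_integrable setT f -> locally_integrable setT g ->
  (forall phi r, 0 < r -> C1 phi -> vanish_outside r phi ->
    \int[mu]_x (f x * derive1 phi x) = - \int[mu]_x (g x * phi x)) -> wd f g.
Proof.
move=> lf lg H; split => // phi C cs; have [r r0 v] := vanish_compact_supp cs.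
exact: (H phi r).
Qed.

Lemma wd_C1 f : C1 f -> wd f (derive1 f).
Proof.
move=> C; have cf := C1_continuous C; have cdf : continuous (derive1 f) by case: C.
apply: wdI; try exact: loc_continuous.
move=> phi r r0 Cphi v; apply/eqP; rewrite -addr_eq0; apply/eqP.
have cphi := C1_continuous Cphi; have cdphi : continuous (derive1 phi) by case: Cphi.
have vd := derive1_vanish Cphi v.
rewrite -RintegralD//; first last.
- exact: loc_mul_Igr (loc_continuous cdf) cphi v.
- exact: loc_mul_Igr (loc_continuous cf) cdphi vd.
have [CM dM] := C1_mul C Cphi.
under eq_RintegralT do rewrite addrC.
have := @Rint_derive1_vanish r _ r0 CM; rewrite dM; apply.
by move=> x /v ->; rewrite mulr0.
Qed.

Lemma wdD f f1 g g1 : wd f f1 -> wd g g1 -> wd (fun x => f x + g x) (fun x => f1 x + g1 x).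
Proof.
move=> wf wg; have [lf lf1 _] := wf; have [lg lg1 _] := wg.
apply: wdI; try exact: locally_integrableD.
move=> phi r r0 C v.
have c := C1_continuous C; have cd : continuous (derive1 phi) by case: C.
have vd := derive1_vanish C v.
under eq_RintegralT do rewrite mulrDl.
under [in RHS]eq_RintegralT do rewrite mulrDl.
by rewrite !RintegralD ?(wdE wf C v) ?(wdE wg C v) ?opprD//;
  by [exact: loc_mul_Igr c v | exact: loc_mul_Igr cd vd].
Qed.

Lemma wdZ c f f1 : wd f f1 -> wd (fun x => c * f x) (fun x => c * f1 x).
Proof.
move=> wf; have [lf lf1 _] := wf.
apply: wdI; try exact: locZ.
move=> phi r r0 C v.
have ct := C1_continuous C; have cd : continuous (derive1 phi) by case: C.
have vd := derive1_vanish C v.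
under eq_RintegralT do rewrite -mulrA.
under [in RHS]eq_RintegralT do rewrite -mulrA.
rewrite !RintegralZl ?(wdE wf C v) ?mulrN//.
- exact: loc_mul_Igr ct v.
- exact: loc_mul_Igr cd vd.
Qed.

Lemma wdB f f1 g g1 : wd f f1 -> wd g g1 -> wd (fun x => f x - g x) (fun x => f1 x - g1 x).
Proof.
move=> wf wg; have := wdD wf (wdZ (-1) wg).
by under eq_fun do rewrite mulN1r; under [X in wd _ X]eq_fun do rewrite mulN1r.
Qed.

(** Leibniz rule: the product of [p] with a C^1 test function is again a test function, so the
    identity for [f] may be tested with p phi. *)
Lemma wd_mul_C1 f f1 p : wd f f1 -> C1 p ->
  wd (fun x => p x * f x) (fun x => derive1 p x * f x + p x * f1 x).
Proof.
move=> wf Cp; have [lf lf1 _] := wf.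
have cp := C1_continuous Cp; have cdp : continuous (derive1 p) by case: Cp.
have l1 : locally_integrable setT (fun x => p x * f x).
  by under eq_fun do rewrite mulrC; exact: loc_mul_continuous.
have l2 : locally_integrable setT (fun x => derive1 p x * f x).
  by under eq_fun do rewrite mulrC; exact: loc_mul_continuous.
have l3 : locally_integrable setT (fun x => p x * f1 x).
  by under eq_fun do rewrite mulrC; exact: loc_mul_continuous.
apply: wdI => //; first exact: locally_integrableD.
move=> phi r r0 C v.
have ct := C1_continuous C; have cd : continuous (derive1 phi) by case: C.
have vd := derive1_vanish C v.
have [CM dM] := C1_mul Cp C.
have vM : vanish_outside r (fun x => p x * phi x) by move=> x /v ->; rewrite mulr0.
have E := wdE wf CM vM; rewrite dM in E.
have I1 : Igr (fun x => derive1 p x * f x * phi x) by exact: loc_mul_Igr ct v.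
have I2 : Igr (fun x => p x * f1 x * phi x) by exact: loc_mul_Igr ct v.
have I3 : Igr (fun x => p x * f x * derive1 phi x) by exact: loc_mul_Igr cd vd.
have E1 : \int[mu]_x (f x * (derive1 p x * phi x + p x * derive1 phi x)) =
  \int[mu]_x (derive1 p x * f x * phi x) + \int[mu]_x (p x * f x * derive1 phi x).
  by rewrite -RintegralD//; apply: eq_RintegralT => x; ring.
have E2 : \int[mu]_x (f1 x * (p x * phi x)) = \int[mu]_x (p x * f1 x * phi x).
  by apply: eq_RintegralT => x; ring.
under [in RHS]eq_RintegralT do rewrite mulrDl.
rewrite RintegralD//; move: E; rewrite E1 E2; lra.
Qed.

Lemma loc_ae f g : locally_integrable setT f -> measurable_fun setT g ->
  {ae mu, forall x, f x = g x} -> locally_integrable setT g.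
Proof.
move=> [mf _ lf] mg fg; split => //; first exact: openT.
move=> K KT cK; have mK := compact_measurable cK.
have -> // : (\int[mu]_(x in K) `|g x|%:E = \int[mu]_(x in K) `|f x|%:E)%E.
  apply: ae_eq_integral => //.
  - apply/measurable_EFinP; apply: measurableT_comp => //.
    exact: (measurable_funS measurableT (@subsetT _ _) mg).
  - apply/measurable_EFinP; apply: measurableT_comp => //.
    exact: (measurable_funS measurableT (@subsetT _ _) mf).
  - by apply: filterS fg => x ->.
exact: lf.
Qed.

Lemma wd_ae f f' g g' : wd f g -> measurable_fun setT f' -> measurable_fun setT g' ->
  {ae mu, forall x, f x = f' x} -> {ae mu, forall x, g x = g' x} -> wd f' g'.
Proof.
move=> wf mf' mg' ff' gg'; have [lf lg _] := wf.
have lf' := loc_ae lf mf' ff'; have lg' := loc_ae lg mg' gg'.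
apply: wdI => // phi r r0 C v.
have ct := C1_continuous C; have cd : continuous (derive1 phi) by case: C.
have vd := derive1_vanish C v.
have := wdE wf C v.
rewrite (@Rint_ae_eq _ _ (fun x => f' x * derive1 phi x)).
- rewrite (@Rint_ae_eq _ (fun x => g x * phi x) (fun x => g' x * phi x))//.
  + exact: Igr_meas (loc_mul_Igr lg ct v).
  + exact: Igr_meas (loc_mul_Igr lg' ct v).
  + by apply: filterS gg' => x ->.
- exact: Igr_meas (loc_mul_Igr lf cd vd).
- exact: Igr_meas (loc_mul_Igr lf' cd vd).
- by apply: filterS ff' => x ->.
Qed.

Lemma L2_continuous r phi : continuous phi -> vanish_outside r phi -> l2 phi.
Proof.
move=> c v; apply/L2_sqr; split; first exact: continuous_measurable_fun.
apply: (@Igr_continuous r); last by move=> x /v ->; rewrite expr0n.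
by under eq_fun do rewrite expr2; exact: cfM.
Qed.

(** Both sides of the defining identity are inner products with [phi] or its derivative, which lie
    in L2, hence they are continuous for the L2 norm. *)
Lemma wd_limit (f g : nat -> R -> R) f' g' : (forall k, wd (f k) (g k)) ->
  (forall k, l2 (f k)) -> (forall k, l2 (g k)) -> l2 f' -> l2 g' ->
  (fun k => nrm (fun x => f k x - f' x)) @ \oo --> (0 : R) ->
  (fun k => nrm (fun x => g k x - g' x)) @ \oo --> (0 : R) -> wd f' g'.
Proof.
move=> w lf lg lf' lg' cf cg.
apply: wdI; try exact: L2_loc.
move=> phi r r0 C v.
have ct := C1_continuous C; have cd : continuous (derive1 phi) by case: C.
have lp := L2_continuous ct v; have ld := L2_continuous cd (derive1_vanish C v).
have H (F : nat -> R -> R) F' p : (forall k, l2 (F k)) -> l2 F' -> l2 p ->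
   (fun k => nrm (fun x => F k x - F' x)) @ \oo --> (0 : R) ->
   (fun k => ip (F k) p) @ \oo --> ip F' p.
  move=> lF lF' lpp cF.
  have cF2 : (fun k => nrm (fun x => F k x - F' x) * nrm p) @ \oo --> (0 : R).
    by rewrite -(mul0r (nrm p)); apply: cvgM => //; exact: cvg_cst.
  apply/cvgrPdist_le => e e0.
  move/cvgrPdist_le : cF2 => /(_ e e0); apply: filterS => k.
  rewrite sub0r normrN distrC -ipBl//; apply: le_trans.
  by apply: le_trans (cauchy_schwarz (L2B (lF k) lF') lpp) _; exact: ler_norm.
have c1 := H _ _ _ lf lf' ld cf.
have c2 := H _ _ _ lg lg' lp cg.
have c3 : (fun k => ip (f k) (derive1 phi)) @ \oo --> - ip g' phi.
  have -> : (fun k => ip (f k) (derive1 phi)) = (fun k => - ip (g k) phi).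
    by apply/funext => k; exact: (wdE (w k) C v).
  exact: cvgN.
exact: (cvg_unique _ c1 c3).
Qed.

Lemma C1_shift c phi : C1 phi -> C1 (fun x => phi (x + c)) /\
  derive1 (fun x => phi (x + c)) = (fun x => derive1 phi (x + c)).
Proof.
move=> C.
have H (x : R) : is_derive x 1 (fun x => phi (x + c)) (derive1 phi (x + c)).
  by apply: is_derive_shift; exact: is_derive_C1.
split; last exact: derive1_is_derive.
apply: (C1_is_derive H); apply: cf_comp; first by case: C.
by apply: cfD; [move=> x; exact: cvg_id|exact: cfc].
Qed.

Lemma wd_shift c f g : wd f g -> l2 f -> l2 g ->
  wd (fun x => f (x + c)) (fun x => g (x + c)).
Proof.
move=> w lf lg; apply: wdI; try (by apply: L2_loc; exact: L2_shift).
move=> phi r r0 C v.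
have [Cs ds] := C1_shift (- c) C.
have vs : vanish_outside (r + `|c|) (fun x => phi (x - c)).
  move=> x hx; apply: v; have := ler_normD (x - c) c; rewrite subrK; lra.
have := wdE w Cs vs; rewrite ds.
have cs := C1_continuous Cs; have cds : continuous (derive1 (fun x => phi (x - c))) by case: Cs.
have I1 := loc_mul_Igr (L2_loc lg) cs vs.
have I2 := loc_mul_Igr (L2_loc lf) cds (derive1_vanish Cs vs).
rewrite -(Rintegral_shift c I1); rewrite ds in I2; rewrite -(Rintegral_shift c I2).
under eq_RintegralT do rewrite addrK.
by under [X in _ = - X -> _]eq_RintegralT do rewrite addrK.
Qed.

End WeakDerivatives.

(** * Lebesgue points, continuous representatives and Sobolev bounds *)

Section Representatives.
Variable R : realType.
Local Notation mu := (@lebesgue_measure R).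
Local Notation Igr f := (mu.-integrable setT (EFin \o f)).
Implicit Types (f g phi : R -> R).

(** The transition from 0 to 1 takes place on [a, a + 1/m]. Large [m] makes [dramp] an approximate
    identity at [a]; small [m] gives the slowly varying cutoffs. *)
Definition ramp (m a : R) (x : R) : R := step (m * x + - (m * a)).
Definition dramp (m a : R) (x : R) : R := m * dstep (m * x + - (m * a)).
Definition ddramp (m a : R) (x : R) : R := m * (m * ddstep (m * x + - (m * a))).

Lemma is_derive_ramp m a (x : R) : is_derive x 1 (ramp m a) (dramp m a x).
Proof. by apply: is_derive_affine; exact: is_derive_step. Qed.

Lemma is_derive_dramp m a (x : R) : is_derive x 1 (dramp m a) (ddramp m a x).
Proof. by apply: is_derive_scale; apply: is_derive_affine; exact: is_derive_dstep. Qed.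

Lemma ddramp_continuous m a : continuous (ddramp m a).
Proof.
do 2 (apply: cfM; first exact: cfc); apply: cf_comp; first exact: ddstep_continuous.
exact: cf_affine.
Qed.

Lemma is_derive_continuous f (f' : R -> R) : (forall x : R, is_derive x 1 f (f' x)) -> continuous f.
Proof.
move=> H x; apply: differentiable_continuous; apply/derivable1_diffP.
exact: (@ex_derive _ _ _ _ _ _ _ (H x)).
Qed.

Lemma dramp_continuous m a : continuous (dramp m a).
Proof. exact: (is_derive_continuous (is_derive_dramp m a)). Qed.

Lemma C1_ramp m a : C1 (ramp m a) /\ derive1 (ramp m a) = dramp m a.
Proof.
split; last exact: (derive1_is_derive (is_derive_ramp m a)).
exact: (C1_is_derive (is_derive_ramp m a) (@dramp_continuous m a)).
Qed.

Lemma ramp_le m a x : 0 < m -> x <= a -> [/\ ramp m a x = 0, dramp m a x = 0 & ddramp m a x = 0].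
Proof.
move=> m0 xa; have : m * x + - (m * a) <= 0 by rewrite -mulrBr; nra.
by move=> /step_le0; rewrite /ramp /dramp /ddramp => -[-> -> ->]; rewrite !mulr0.
Qed.

Lemma ramp_ge m a x : 0 < m -> a + m^-1 <= x -> [/\ ramp m a x = 1, dramp m a x = 0 & ddramp m a x = 0].
Proof.
move=> m0 xa; have : 1 <= m * x + - (m * a).
  have e : m * m^-1 = 1 by rewrite mulfV ?gt_eqF.
  have : m * (a + m^-1) <= m * x by rewrite ler_pM2l.
  lra.
by move=> /step_ge1; rewrite /ramp /dramp /ddramp => -[-> -> ->]; rewrite !mulr0.
Qed.

Lemma ramp_bound : exists2 C : R, 1 <= C & forall m a x, 0 < m ->
  [/\ `|ramp m a x| <= C, `|dramp m a x| <= C * m & `|ddramp m a x| <= C * m ^+ 2].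
Proof.
have [C C1 HC] : exists2 C : R, 1 <= C &
    forall x, [/\ `|step x| <= C, `|dstep x| <= C & `|ddstep x| <= C].
  by exists 216; [rewrite ler1n|exact: step_bound].
exists C => // m a x m0; have [s0 s1 s2] := HC (m * x + - (m * a)).
rewrite /ramp /dramp /ddramp; split => //.
  by rewrite (normrM m (dstep _)) (gtr0_norm m0) mulrC ler_wpM2r// ltW.
rewrite (normrM m (m * ddstep _)) (normrM m (ddstep _)) (gtr0_norm m0).
by rewrite expr2 mulrA mulrC ler_wpM2r// mulr_ge0// ltW.
Qed.

Lemma dramp_vanish m a : 0 < m -> vanish_outside (`|a| + m^-1) (dramp m a).
Proof.
move=> m0 x; have mi : 0 < m^-1 by rewrite invr_gt0.
have [xa _|ax] := leP x a; first by have [] := ramp_le m0 xa.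
move=> h; have [] // := @ramp_ge m a x m0.
have := ler_norm a; have := ler_norm (- a); rewrite normrN.
by case: (ger0P x) h => [x0|x0] h; lra.
Qed.

Lemma Rint_dramp m a : 0 < m -> \int[mu]_x dramp m a x = 1.
Proof.
move=> m0; have [C dC] := C1_ramp m a; have mi : 0 < m^-1 by rewrite invr_gt0.
have na := normr_ge0 a; have a1 := ler_norm a; have a2 := ler_norm (- a); rewrite normrN in a2.
rewrite (Rint_vanish (@dramp_vanish m a m0)) -dC FTC_C1//; last by lra.
have [-> _ _] := @ramp_ge m a (`|a| + m^-1) m0 ltac:(lra).
have [-> _ _] := @ramp_le m a (- (`|a| + m^-1)) m0 ltac:(lra).
by rewrite subr0.
Qed.

Lemma lebesgue_pt_near f a (e : R) : lebesgue_pt f a -> 0 < e ->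
  \forall r \near (0 : R)^'+, (\int[mu]_(y in ball a r) `|(f y - f a)%:E| <= (e * r)%:E)%E.
Proof.
move=> lp e0; have e20 : 0 < e / 2 by lra.
move: lp; rewrite /lebesgue_pt => /fine_cvgP[fn /cvgrPdist_le/(_ _ e20) H].
near=> r.
have r0 : 0 < r by near: r; exact: nbhs_right_gt.
have : davg f a r \is a fin_num by near: r.
have : `|0 - (fine \o davg f a) r| <= e / 2 by near: r.
rewrite /= /davg /iavg /=.
rewrite (lebesgue_measure_ball _ (ltW r0)).
rewrite inver.
have -> : (r *+ 2 == 0) = false by apply/negbTE; rewrite mulrn_eq0/= gt_eqF.
set I := (\int[mu]_(y in ball a r) _)%E.
have I0 : (0 <= I)%E by apply: integral_ge0.
move=> h fi.
have fI : I \is a fin_num.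
  move: fi; rewrite ge0_fin_numE; last by rewrite mule_ge0// lee_fin invr_ge0; lra.
  case: I I0 {h} => [s|//|//] _; rewrite ?ltry//.
  by rewrite gt0_muley// lte_fin invr_gt0; lra.
have : (I <= (e * r)%:E)%E.
  rewrite -(fineK fI) lee_fin; move: h; rewrite -(fineK fI)/= sub0r normrN.
  have I1 : 0 <= fine I by apply: fine_ge0.
  rewrite ger0_norm; last by rewrite mulr_ge0// invr_ge0; lra.
  rewrite ler_pdivrMl; last by lra.
  by move=> h; apply: le_trans h _; lra.
by [].
Unshelve. all: by end_near. Qed.

(** [dramp m a] has mass 1, vanishes at distance 2/m from [a] and is at most C m in size. The
    deviation from f(a) is therefore at most C m times the integral of |f - f(a)| over the ball of
    radius 2/m, and a Lebesgue point makes this small; the tolerance e / (2 C) yields exactly e. *)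
Lemma dramp_cvg f a : locally_integrable setT f -> lebesgue_pt f a ->
  (fun n : nat => \int[mu]_x (f x * dramp n.+1%:R a x)) @ \oo --> f a.
Proof.
move=> lf lp; apply/cvgrPdist_le => e e0.
have [C C1 HC] := ramp_bound; have C0 : 0 < C by lra.
have e1 : 0 < e / (2 * C) by rewrite divr_gt0// mulr_gt0.
have [d /= d0 Hd] := lebesgue_pt_near lp e1.
have [N N0] : exists N : nat, 2 / d < N%:R.
  by exists (Num.bound (2 / d)); apply: archi_boundP; rewrite divr_ge0// ltW.
exists N => // n /= Nn; set m : R := n.+1%:R.
have m0 : 0 < m by rewrite /m ltr0n.
have dm : 2 * m^-1 < d.
  have : 2 / d < m by rewrite (lt_trans N0)// ltr_nat.
  by rewrite !ltr_pdivrMr// mulrC.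
have r0 : 0 < 2 * m^-1 by rewrite mulr_gt0// invr_gt0.
have HI : (\int[mu]_(y in ball a (2 * m^-1)) `|(f y - f a)%:E| <= (e / (2 * C) * (2 * m^-1))%:E)%E.
  by apply: Hd => //=; rewrite sub0r normrN gtr0_norm.
have vd := @dramp_vanish m a m0; have cd := @dramp_continuous m a.
have I1 := loc_mul_Igr lf cd vd.
have I2 : Igr (dramp m a) := Igr_continuous cd vd.
have mf : measurable_fun setT f by case: lf.
have mk : measurable_fun setT (dramp m a) by exact: continuous_measurable_fun.
have Ih : Igr (fun x => (f a - f x) * dramp m a x).
  have := IgrB (IgrZ (f a) I2) I1; congr (_.-integrable _ _).
  by apply/funext => x /=; rewrite mulrBl.
have -> : f a - \int[mu]_x (f x * dramp m a x) = \int[mu]_x ((f a - f x) * dramp m a x).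
  rewrite [X in X - _](_ : f a = \int[mu]_x (f a * dramp m a x)); last first.
    by rewrite RintegralZl// Rint_dramp// mulr1.
  rewrite -RintegralB//.
    by apply: eq_RintegralT => x; rewrite mulrBl.
  exact: IgrZ.
rewrite -lee_fin EFin_normr_Rintegral//.
apply: le_trans (le_abse_integral _ measurableT _) _; first by case/integrableP: Ih.
have mi : 0 < m^-1 by rewrite invr_gt0.
move: (m) m0 dm r0 HI vd cd I1 I2 mk Ih mi => {Nn n}m m0 dm r0 HI vd cd I1 I2 mk Ih mi.
have K (x : R) : 2 * m^-1 <= `|a - x| -> dramp m a x = 0.
  have [xa _|ax] := leP x a; first by have [] := ramp_le m0 xa.
  rewrite distrC gtr0_norm ?subr_gt0// => h.
  by have [] // := @ramp_ge m a x m0 ltac:(lra).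
have mball : measurable (ball a (2 * m^-1)) by exact: measurable_ball.
have mG : measurable_fun setT (fun y => `|f y - f a|).
  by apply: measurableT_comp => //; exact: measurable_funB.
have E : (\int[mu]_(y in ball a (2 * m^-1)) ((C * m) * `|f y - f a|)%:E <= e%:E)%E.
  under eq_integral do rewrite EFinM.
  rewrite ge0_integralZl//; last 2 first.
  - by apply/measurable_EFinP; exact: (measurable_funS measurableT (@subsetT _ _) mG).
  - by rewrite lee_fin mulr_ge0// ltW.
  apply: le_trans (lee_wpmul2l _ HI) _; first by rewrite lee_fin mulr_ge0// ltW.
  by rewrite -EFinM lee_fin le_eqVlt; apply/orP; left; apply/eqP; field; rewrite !gt_eqF.
apply: le_trans E; rewrite [leRHS]integral_mkcond.
apply: ge0_le_integral => //.
- by apply: measurableT_comp => //; case/integrableP: Ih.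
- rewrite restrict_EFin; apply/measurable_EFinP.
  apply: (measurable_restrictT _ _).1 => //.
  apply: (measurable_funS measurableT (@subsetT _ _)); exact: measurable_funM.
- move=> x _; rewrite restrict_EFin /= lee_fin patchE.
  case: ifPn => [_|].
    rewrite normrM distrC mulrC ler_wpM2r//.
    by have [_ b _] := HC m a x m0.
  rewrite notin_setE/= /ball/= => /negP; rewrite -leNgt => h.
  by rewrite K// mulr0 normr0.
Qed.

(* Test with [ramp m a - ramp m b], which tends to the indicator of [a, b]; its derivative
   averages [f] near [a] and near [b], so that the Lebesgue points give the limit. *)
Lemma weak_derivative_lebesgue_pt f g a b : wd f g -> a < b ->
  lebesgue_pt f a -> lebesgue_pt f b -> f b - f a = \int[mu]_(x in `[a, b]) g x.
Proof.
move=> w ab pa pb; have [lf lg _] := w.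
pose phi (n : nat) x := ramp n.+1%:R a x - ramp n.+1%:R b x.
have m0 n : (0 : R) < n.+1%:R by rewrite ltr0n.
have Cphi n : C1 (phi n) /\ derive1 (phi n) = (fun x => dramp n.+1%:R a x - dramp n.+1%:R b x).
  have H (x : R) : is_derive x 1 (phi n) (dramp n.+1%:R a x - dramp n.+1%:R b x).
    by apply: is_derive_sub; exact: is_derive_ramp.
  split; last exact: derive1_is_derive.
  by apply: (C1_is_derive H); apply: cfB; exact: dramp_continuous.
have i1 n : (n.+1%:R : R)^-1 <= 1 by rewrite invf_le1 ?ler1n.
have v n : vanish_outside (`|a| + `|b| + 1) (phi n).
  move=> x h; rewrite /phi.
  have := ler_norm a; have := ler_norm (- a); rewrite normrN.
  have := ler_norm b; have := ler_norm (- b); rewrite normrN.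
  have := i1 n; have := normr_ge0 a; have := normr_ge0 b; move=> h1 h2 h3 h4 h5 h6 h7.
  have [x0|x0] := leP x 0.
    rewrite (ler0_norm x0) in h.
    have [-> _ _] := @ramp_le n.+1%:R a x (m0 n) ltac:(lra).
    by have [-> _ _] := @ramp_le n.+1%:R b x (m0 n) ltac:(lra); rewrite subrr.
  rewrite (gtr0_norm x0) in h.
  have le (c : R) : c + 1 <= x -> c + n.+1%:R^-1 <= x by apply: le_trans; rewrite lerD2l.
  have [-> _ _] := @ramp_ge n.+1%:R a x (m0 n) (le a ltac:(lra)).
  by have [-> _ _] := @ramp_ge n.+1%:R b x (m0 n) (le b ltac:(lra)); rewrite subrr.
have c1 : (fun n => \int[mu]_x (f x * derive1 (phi n) x)) @ \oo --> f a - f b.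
  have -> : (fun n => \int[mu]_x (f x * derive1 (phi n) x)) =
    (fun n => \int[mu]_x (f x * dramp n.+1%:R a x) - \int[mu]_x (f x * dramp n.+1%:R b x)).
    apply/funext => n; rewrite (Cphi n).2 -RintegralB//.
    - by apply: eq_RintegralT => x; rewrite mulrBr.
    - exact: loc_mul_Igr lf (@dramp_continuous _ _) (@dramp_vanish _ a (m0 n)).
    - exact: loc_mul_Igr lf (@dramp_continuous _ _) (@dramp_vanish _ b (m0 n)).
  by apply: cvgB; exact: dramp_cvg.
have [C C1 HC] := ramp_bound.
have [c c0 cb] : exists2 c : R, 0 <= c & C + C <= c by exists (C + C); lra.
(* The pointwise limit is the indicator of the half-open interval: a ramp vanishes at its own left
   end point and equals 1 eventually at every point to the right of it. All transitions stay below b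
   + 1, which gives the dominating function. *)
pose J := `]a, b]%classic : set R.
have c2 : (fun n => \int[mu]_x (g x * phi n x)) @ \oo --> \int[mu]_(x in `[a, b]) g x.
  have Iab : mu.-integrable `[a, b + 1] (EFin \o g) by exact: loc_Igr_seg.
  have Iab2 : mu.-integrable `]a, b] (EFin \o g).
    by apply: integrableS Iab => //; apply: subset_itv; rewrite bnd_simp ?lerDl.
  have mg : measurable_fun setT g by case: lg.
  have H0 (x : R) : 0 <= c * `|(g \_ `[a, b + 1]) x| by exact: mulr_ge0.
  have := @dominated_convergence _ _ R mu setT measurableT
    (fun n x => (g x * phi n x)%:E) (fun x => ((g \_ J) x)%:E)
    (fun x => (c * `|(g \_ `[a, b + 1]) x|)%:E).
  case.
  - move=> n; apply/measurable_EFinP; apply: measurable_funM => //.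
    by apply: continuous_measurable_fun; exact: (C1_continuous (Cphi n).1).
  - by apply/measurable_EFinP; apply: Igr_meas; exact: (Igr_patch (measurable_itv _) Iab2).
  - apply: nearW => x _; apply: cvg_near_cst; rewrite patchE.
    have far y : y < x -> \forall n \near \oo, ramp n.+1%:R y x = 1.
      move=> yx; have d0 : 0 < x - y by rewrite subr_gt0.
      near=> n; have [] // := @ramp_ge n.+1%:R y x (m0 n).
      rewrite -lerBrDl invf_ple ?posrE//.
      have /ltW le : (x - y)^-1 < n%:R by near: n; exact: nbhs_infty_gtr.
      by rewrite (le_trans le)// ler_nat.
    case: ifPn.
      move=> /set_mem; rewrite /J/= in_itv/= => /andP[ax xb].
      apply: filterS (far _ ax) => n h; rewrite /phi h.
      by have [-> _ _] := ramp_le (m0 n) xb; rewrite subr0 mulr1.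
    rewrite notin_setE /J/= in_itv/= => /negP; rewrite negb_and -leNgt -ltNge => /orP[xa|bx].
      apply: nearW => n; rewrite /phi; have [-> _ _] := ramp_le (m0 n) xa.
      by have [-> _ _] := ramp_le (m0 n) (ltW (le_lt_trans xa ab)); rewrite subrr mulr0.
    apply: filterS2 (far _ bx) (far _ (lt_trans ab bx)) => n h1 h2.
    by rewrite /phi h1 h2 subrr mulr0.
  - have /Igr_patch := Iab; move=> /(_ (measurable_itv _)) I.
    exact: (IgrZ c (integrable_abse I)).
  - apply: nearW => x n _; rewrite abse_EFin lee_fin; move: (H0 x); rewrite patchE.
    case: ifPn => [_ _|].
      rewrite normrM mulrC ler_wpM2r//; apply: le_trans (ler_normB _ _) _.
      have [h1 _ _] := HC n.+1%:R a x (m0 n).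
      have [h2 _ _] := HC n.+1%:R b x (m0 n); lra.
    rewrite notin_setE/= in_itv/= => /negP; rewrite negb_and -!ltNge => /orP[xa|bx] h0.
      rewrite /phi; have [-> _ _] := ramp_le (m0 n) (ltW xa).
      have [-> _ _] := ramp_le (m0 n) (ltW (lt_trans xa ab)).
      by rewrite subrr mulr0 [X in X <= _]normr0; exact: h0.
    have ib := i1 n; rewrite /phi.
    have le (d : R) : d <= b -> d + n.+1%:R^-1 <= x.
      by move=> db; apply: le_trans (ltW bx); exact: lerD.
    have [-> _ _] := @ramp_ge n.+1%:R a x (m0 n) (le a (ltW ab)).
    have [-> _ _] := @ramp_ge n.+1%:R b x (m0 n) (le b (lexx b)).
    by rewrite subrr mulr0 [X in X <= _]normr0; exact: h0.
  move=> IJ _; rewrite -[in X in X -> _](fineK (integrable_fin_num measurableT IJ)).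
  move=> /fine_cvgP[_]; rewrite /comp/= => H.
  have -> : \int[mu]_(x in `[a, b]) g x = \int[mu]_(x in `]a, b]) g x.
    by rewrite Rintegral_itv_obnd_cbnd.
  by rewrite [X in _ --> X]Rintegral_mkcond; exact: H.
have c3 : (fun n => \int[mu]_x (f x * derive1 (phi n) x)) @ \oo --> - \int[mu]_(x in `[a, b]) g x.
  have -> : (fun n => \int[mu]_x (f x * derive1 (phi n) x)) = (fun n => - \int[mu]_x (g x * phi n x)).
    by apply/funext => n; exact: (wdE w (Cphi n).1 (v n)).
  exact: cvgN.
have : f a - f b = - \int[mu]_(x in `[a, b]) g x by exact: (cvg_unique _ c1 c3).
lra.
Unshelve. all: by end_near. Qed.

(** At a Lebesgue point, g is the derivative of its own primitive, and that primitive is locally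
    constant. *)
Lemma ae_eq0_of_integrals g : locally_integrable setT g ->
  (forall a b, a < b -> \int[mu]_(x in `[a, b]) g x = 0) -> {ae mu, forall x, g x = 0}.
Proof.
move=> lg H; have := lebesgue_differentiation lg; apply: filterS; move=> /= x lp.
move: (x : R) lp => {}x lp.
have [||d <-] := @FTC1_lebesgue_pt R g (BLeft (x - 1)) x (x + 1) _ (loc_Igr_seg _ _ lg) _ lp.
- by rewrite ltrDl.
- by rewrite lte_fin gtrBl.
rewrite derive1E; have z := @is_derive_cst R R R 0 x 1.
have : is_derive x 1 (fun y => \int[mu]_(t in [set` `[x - 1, y]]) g t) 0.
  apply: near_eq_is_derive z; near=> y; apply/esym/H.
  by near: y; apply: (@cvgr_gt _ _ (nbhs x) _ (fun y : R => y) x); [exact: cvg_id|lra].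
by move=> ?; rewrite derive_val.
Unshelve. all: by end_near. Qed.

(** g1 - g2 is a weak derivative of 0, for which every point is a Lebesgue point; so its integrals
    over all intervals vanish. *)
Lemma weak_derivative_unique f g1 g2 : wd f g1 -> wd f g2 -> {ae mu, forall x, g1 x = g2 x}.
Proof.
move=> w1 w2; have := wdB w1 w2; under eq_fun do rewrite subrr.
move=> w; have [_ lg _] := w.
have lp x : lebesgue_pt (fun _ : R => 0 : R) x.
  apply: (@continuous_lebesgue_pt _ _ x setT) => //; last exact: cvg_cst.
  by split => //; exact: openT.
have : {ae mu, forall x, g1 x - g2 x = 0}.
  apply: ae_eq0_of_integrals => // a b ab.
  by rewrite -(weak_derivative_lebesgue_pt w ab)// subrr.
by apply: filterS => x /eqP; rewrite subr_eq0 => /eqP.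
Qed.

Lemma ae_ex (P : R -> Prop) : {ae mu, forall x, P x} -> exists x, P x.
Proof.
move=> [A [mA A0 PA]]; apply: contrapT => nP.
have AT : A = setT.
  by apply/seteqP; split => // x _; apply: PA => px; apply: nP; exists x.
have : (mu (`[0%R, 1%R]%classic : set R) <= mu A)%E.
  by apply: le_measure; rewrite ?inE// AT.
by rewrite A0 lebesgue_measure_itv/= lte_fin ltr01 oppr0 adde0 lee_fin ler10.
Qed.

(* Oriented indicator of ]a, b], equal to minus the indicator of ]b, a] when [b < a]. *)
Definition osc (a b x : R) : R := (x <= b)%R%:R - (x <= a)%R%:R.

Lemma oscN a b : osc a b = (fun x => - osc b a x).
Proof. by apply/funext => x; rewrite /osc opprB. Qed.

Lemma osc_indic a b : a <= b -> osc a b = \1_(`]a, b]%classic : set R).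
Proof.
move=> ab; apply/funext => x; rewrite /osc indicE.
have -> : (x \in `]a, b]%classic) = (a < x) && (x <= b).
  by apply/idP/idP => [/set_mem/=|h]; rewrite ?in_itv//; apply/mem_set; rewrite /= in_itv.
have [xa|ax] := leP x a; first by rewrite (le_trans xa ab) subrr.
by case: (x <= b); rewrite subr0.
Qed.

Lemma osc_patch a b : a <= b -> osc a b = (cst 1 : R -> R) \_ (`]a, b]%classic : set R).
Proof. by move=> ab; rewrite osc_indic//; apply/funext => x; rewrite patchE indicE; case: ifP. Qed.

Lemma osc_sqr a b : a <= b -> (fun x => osc a b x ^+ 2) = osc a b.
Proof.
move=> ab; apply/funext => x; rewrite osc_indic// indicE.
by case: (_ \in _); rewrite ?expr1n ?expr0n.
Qed.

Lemma measurable_osc a b : measurable_fun setT (osc a b).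
Proof.
have H c d : c <= d -> measurable_fun setT (osc c d).
  by move=> cd; rewrite osc_indic//; exact: measurable_indic.
have [/H//|/ltW/H h] := leP a b.
by rewrite oscN; apply: measurableT_comp.
Qed.

Lemma Igr_osc a b : a <= b -> Igr (osc a b) /\ \int[mu]_x osc a b x = b - a.
Proof.
move=> ab; rewrite osc_indic//; have := lebesgue_measure_itv `]a, b].
rewrite /= lte_fin => E.
have I : Igr (\1_(`]a, b]%classic : set R)).
  apply/integrableP; split; first by apply/measurable_EFinP; exact: measurable_indic.
  under eq_integral do rewrite /= ger0_norm//.
  by rewrite integral_indic// setIT [X in (X < _)%E]E; case: ifP => _; exact: ltry.
split => //; rewrite /Rintegral integral_indic// setIT [X in fine X]E.
have := ab; rewrite le_eqVlt => /orP[/eqP ->|->]; last by rewrite -EFinD.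
by rewrite ltxx subrr.
Qed.

Lemma L2_osc a b : l2 (osc a b).
Proof.
have H c d : c <= d -> l2 (osc c d).
  move=> cd; apply/L2_sqr; split; first exact: measurable_osc.
  by rewrite osc_sqr//; exact: (Igr_osc cd).1.
have [/H//|/ltW/H h] := leP a b.
by rewrite oscN; exact: L2N.
Qed.

Lemma nrm_osc a b : nrm (osc a b) = Num.sqrt `|b - a|.
Proof.
have H c d : c <= d -> nrm (osc c d) = Num.sqrt `|d - c|.
  move=> cd; rewrite nrm_ip; last exact: L2_osc.
  congr Num.sqrt; rewrite ger0_norm ?subr_ge0// -(Igr_osc cd).2.
  by apply: eq_RintegralT => x; rewrite -expr2 -[in RHS](osc_sqr cd).
have [/H//|/ltW h] := leP a b.
by rewrite (oscN a b) (nrmN (L2_osc b a)) (H _ _ h) distrC.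
Qed.

Lemma ip_osc g a b : l2 g -> a <= b -> ip g (osc a b) = \int[mu]_(x in `[a, b]) g x.
Proof.
move=> lg ab; have I := loc_Igr_seg a b (L2_loc lg).
rewrite -Rintegral_itv_obnd_cbnd; last first.
  by apply: integrableS I => //; apply: subset_itv; rewrite bnd_simp.
rewrite Rintegral_mkcond; apply: eq_RintegralT => x.
by rewrite osc_patch// !patchE; case: ifP => _; rewrite ?mulr1 ?mulr0.
Qed.

Lemma ip_osc_split g a b c : l2 g -> ip g (osc a c) = ip g (osc a b) + ip g (osc b c).
Proof.
move=> lg; have l1 := L2_osc a b; have l2 := L2_osc b c.
rewrite !(ipC g) -ipDl//; congr (ip _ _); apply/funext => x; rewrite /osc; ring.
Qed.

Lemma ip_oscN g a b : l2 g -> ip g (osc a b) = - ip g (osc b a).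
Proof.
move=> lg; apply/eqP; rewrite -addr_eq0 -ip_osc_split//; apply/eqP.
have E : osc a a = (fun x => 0 * osc a a x) by apply/funext => x; rewrite /osc subrr mul0r.
by rewrite E ipC (ipZl 0 (L2_osc a a) lg) mul0r.
Qed.

Lemma ip_osc_bound g a b : l2 g -> `|ip g (osc a b)| <= nrm g * Num.sqrt `|b - a|.
Proof. by move=> lg; rewrite -nrm_osc; apply: cauchy_schwarz => //; exact: L2_osc. Qed.

(** The increment is written as an inner product, in either orientation, so that Cauchy--Schwarz
    bounds it by the norm of g times the square root of |b - a|. *)
Definition primitive_of F g := forall a b, F b - F a = ip g (osc a b).

Lemma primitive_continuous F g : l2 g -> primitive_of F g -> continuous F.
Proof.
move=> lg H x; apply/cvgrPdist_le => e e0.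
have N0 := nrm_ge0 g; set N := nrm g in N0 *.
pose d := (e / (N + 1)) ^+ 2.
have q0 : 0 < e / (N + 1) by rewrite divr_gt0// ltr_wpDl.
have d0 : 0 < d by rewrite exprn_gt0.
exists d => //= y; rewrite /ball/= => xy.
rewrite H; apply: le_trans (ip_osc_bound _ _ lg) _.
have : Num.sqrt `|x - y| <= e / (N + 1).
  by have := ler_wsqrtr (ltW xy); rewrite /d sqrtr_sqr (gtr0_norm q0).
rewrite ler_pdivlMr ?ltr_wpDl// => h; apply: le_trans h.
by rewrite mulrC ler_wpM2l ?sqrtr_ge0// lerDl.
Qed.

(** Almost every point is a Lebesgue point of f. Integrating g from one of them reproduces f at all
    the others. *)
Lemma wd_primitive f g : wd f g -> l2 g -> exists F,
  primitive_of F g /\ {ae mu, forall x, F x = f x}.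
Proof.
move=> w lg; have [lf _ _] := w.
have ld := lebesgue_differentiation lf.
have [a0 p0] := ae_ex ld.
exists (fun x => f a0 + ip g (osc a0 x)); split.
  move=> a b; rewrite (ip_osc_split a0 a b lg); ring.
apply: filterS ld; move=> /= x px; move: (x : R) px => {}x px.
have [xa|ax|->] := ltrgtP x a0.
- rewrite ip_oscN// ip_osc ?(ltW xa)// -(weak_derivative_lebesgue_pt w xa)//; ring.
- rewrite ip_osc ?(ltW ax)// -(weak_derivative_lebesgue_pt w ax)//; ring.
- rewrite ip_osc// set_itv1 Rintegral_set1 addr0//.
Qed.

Lemma L2_patch f (A : set R) : measurable A -> l2 f -> l2 (f \_ A).
Proof.
move=> mA lf; apply: (L2_le _ lf).
  apply: (measurable_restrictT f mA).1.
  exact: (measurable_funS measurableT (@subsetT _ _) (L2_meas lf)).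
by move=> x; rewrite patchE; case: ifP => // _; rewrite normr0.
Qed.

Lemma nrm_patch f (A B : set R) : measurable A -> measurable B -> A `<=` B -> l2 f ->
  nrm (f \_ A) <= nrm (f \_ B).
Proof.
move=> mA mB AB lf; rewrite -[leRHS]mul1r; apply: nrm_le_ae => //; try exact: L2_patch.
apply: nearW => x; rewrite mul1r !patchE; case: ifPn => [/set_mem/AB/mem_set ->//|_].
by rewrite normr0.
Qed.

Lemma nrm_patch_le f (A : set R) : measurable A -> l2 f -> nrm (f \_ A) <= nrm f.
Proof.
by move=> mA lf; have := nrm_patch mA measurableT (@subsetT _ _) lf; rewrite patch_setT.
Qed.

(** On an interval of length 1, F varies by at most the local norm of g. Hence |F(x)| minus this
    norm is a lower bound of |F| there, and it does not exceed the local norm of F. *)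
Lemma local_sup_bound F g x : l2 F -> l2 g -> primitive_of F g ->
  `|F x| <= nrm (F \_ `[x, x + 1]) + nrm (g \_ `[x, x + 1]).
Proof.
move=> lF lg H; set I := `[x, x + 1]%classic.
have mI : measurable I by exact: measurable_itv.
have lFI := L2_patch mI lF; have lgI := L2_patch mI lg.
have b y : I y -> `|F x| - nrm (g \_ I) <= `|F y|.
  rewrite /I/= in_itv/= => /andP[xy yx].
  have E : F y - F x = ip (g \_ I) (osc x y).
    rewrite H; apply: eq_RintegralT => t; rewrite patchE; case: ifPn => //.
    rewrite notin_setE /I/= in_itv/= => /negP h.
    rewrite osc_patch// patchE ifF ?mulr0 ?mul0r//.
    apply/negP => /set_mem/=; rewrite in_itv/= => /andP[t1 t2]; apply: (negP h).
    by rewrite (ltW t1) (le_trans t2).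
  have := ip_osc_bound x y lgI; rewrite -E => h.
  have s1 : Num.sqrt `|y - x| <= 1.
    by rewrite -sqrtr1 ler_wsqrtr// ger0_norm ?subr_ge0// lerBlDl.
  have : nrm (g \_ I) * Num.sqrt `|y - x| <= nrm (g \_ I).
    by rewrite -[leRHS]mulr1 ler_wpM2l// nrm_ge0.
  have := ler_normB (F y) (F y - F x); rewrite opprB addrC subrK; lra.
rewrite -lerBlDr; have [c0|c0] := leP (`|F x| - nrm (g \_ I)) 0.
  by rewrite (le_trans c0)// nrm_ge0.
have n1 : nrm (osc x (x + 1)) = 1.
  by rewrite nrm_osc addrAC subrr add0r normr1 sqrtr1.
have lo := L2_osc x (x + 1).
set c := `|F x| - _ in b c0 *.
have -> : c = nrm (fun y => c * osc x (x + 1) y) by rewrite nrmZ// n1 mulr1 gtr0_norm.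
rewrite -[leRHS]mul1r; apply: nrm_le_ae => //; first exact: L2Z.
apply: nearW => y; rewrite mul1r osc_patch ?lerDl// !patchE.
case: ifPn => [/set_mem/=|_]; last by rewrite mulr0 normr0.
rewrite in_itv/= => /andP[y1 y2].
have Iy : I y by rewrite /I/= in_itv/= (ltW y1).
by rewrite (mem_set Iy) mulr1 gtr0_norm// b.
Qed.

Lemma sup_bound F g x : l2 F -> l2 g -> primitive_of F g -> `|F x| <= nrm F + nrm g.
Proof.
move=> lF lg H; apply: le_trans (local_sup_bound x lF lg H) _.
by apply: lerD; apply: nrm_patch_le.
Qed.

(** The local bound involves only [x, x + 1], which for large |x| lies in the region where the tails
    of F and g are small. *)
Lemma primitive_decay F g (e : R) : l2 F -> l2 g -> primitive_of F g -> 0 < e ->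
  exists X, forall x, X <= `|x| -> `|F x| <= e.
Proof.
move=> lF lg H e0; have e2 : 0 < e / 2 by lra.
have [X1 h1] := L2_tail lF e2; have [X2 h2] := L2_tail lg e2.
have mA (X : R) : measurable [set x : R | X <= `|x|].
  have -> : [set x : R | X <= `|x|] = (fun x => `|x|) @^-1` `[X, +oo[%classic.
    by apply/seteqP; split=> x /=; rewrite in_itv/= andbT.
  by rewrite -[X in measurable X]setTI; apply: measurableT_comp.
exists (`|X1| + `|X2| + 1) => x hx.
apply: le_trans (local_sup_bound x lF lg H) _.
have S (X : R) : `|X| <= `|X1| + `|X2| -> `[x, x + 1]%classic `<=` [set x : R | X <= `|x|].
  move=> hX t /=; rewrite in_itv/= => /andP[t1 t2].
  have := ler_norm X; have := ler_normB t (t - x); rewrite opprB addrC subrK.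
  have : `|t - x| <= 1 by rewrite ger0_norm; lra.
  lra.
have -> : e = e / 2 + e / 2 by lra.
have := normr_ge0 X1; have := normr_ge0 X2; move=> p2 p1.
apply: lerD; [apply: le_trans h1|apply: le_trans h2]; apply: nrm_patch => //; apply: S; lra.
Qed.

Lemma primitive_ae F g g' : l2 g -> l2 g' -> {ae mu, forall x, g x = g' x} ->
  primitive_of F g -> primitive_of F g'.
Proof. by move=> lg lg' gg H a b; rewrite H; apply: ip_ae => //; exact: L2_osc. Qed.

Lemma primitive_derive F G : l2 G -> continuous G -> primitive_of F G ->
  forall x : R, is_derive x 1 F (G x).
Proof.
move=> lG cG H x.
have lp : lebesgue_pt G x.
  apply: (@continuous_lebesgue_pt _ _ x setT) => //; first by split => //; exact: openT.
  - exact: continuous_measurable_fun.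
  - exact: cG.
have [||d dE] := @FTC1_lebesgue_pt R G (BLeft (x - 1)) x (x + 1) _ (loc_Igr_seg _ _ (L2_loc lG)) _ lp.
- by rewrite ltrDl.
- by rewrite lte_fin gtrBl.
have D : is_derive x 1 (fun y => \int[mu]_(t in [set` `[x - 1, y]]) G t) (G x).
  by rewrite -dE derive1E; exact: derivableP.
have := is_derive_add (@is_derive_cst R R R (F (x - 1)) x 1) D; rewrite add0r.
apply: near_eq_is_derive; near=> y; rewrite -ip_osc//.
  by rewrite -H /=; ring.
by near: y; apply: (@cvgr_ge _ _ (nbhs x) _ (fun y : R => y) x); [exact: cvg_id|rewrite gtrBl].
Unshelve. all: by end_near. Qed.

(** The derivatives are carried explicitly: sums, products and translates of triples are again
    triples, while the chosen [weak_derivative] commutes with these operations only up to null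
    sets. *)
Definition W2 f f1 f2 := [/\ wd f f1, wd f1 f2, l2 f, l2 f1 & l2 f2].

Lemma W2_rep f f1 f2 : W2 f f1 f2 -> exists F F1,
  [/\ forall x : R, is_derive x 1 F (F1 x), W2 F F1 f2, primitive_of F F1, primitive_of F1 f2 &
    {ae mu, forall x, F x = f x} /\ {ae mu, forall x, F1 x = f1 x}].
Proof.
move=> [w0 w1 l0 l1 l2].
have [F [P0 E0]] := wd_primitive w0 l1; have [F1 [P1 E1]] := wd_primitive w1 l2.
have c1 := primitive_continuous l2 P1; have c0 := primitive_continuous l1 P0.
have E0' : {ae mu, forall x, f x = F x} by apply: filterS E0.
have E1' : {ae mu, forall x, f1 x = F1 x} by apply: filterS E1.
have m0 := continuous_measurable_fun c0; have m1 := continuous_measurable_fun c1.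
have lF := L2_ae l0 m0 E0'; have lF1 := L2_ae l1 m1 E1'.
have P0' := primitive_ae l1 lF1 E1' P0.
exists F, F1; split => //; first exact: primitive_derive.
split => //.
- exact: wd_ae w0 m0 m1 E0' E1'.
- by apply: wd_ae w1 m1 (L2_meas l2) E1' _; apply: nearW.
Qed.

End Representatives.

(** * Functions with two weak derivatives in L2 *)

Section Sobolev.
Variable R : realType.
Local Notation mu := (@lebesgue_measure R).
Local Notation Igr f := (mu.-integrable setT (EFin \o f)).
Implicit Types (f g phi : R -> R).

Lemma W2D f f1 f2 g g1 g2 : W2 f f1 f2 -> W2 g g1 g2 ->
  W2 (fun x => f x + g x) (fun x => f1 x + g1 x) (fun x => f2 x + g2 x).
Proof.
move=> [? ? ? ? ?] [? ? ? ? ?].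
by split; [exact: wdD|exact: wdD|exact: L2D|exact: L2D|exact: L2D].
Qed.

Lemma W2Z c f f1 f2 : W2 f f1 f2 ->
  W2 (fun x => c * f x) (fun x => c * f1 x) (fun x => c * f2 x).
Proof.
move=> [? ? ? ? ?].
by split; [exact: wdZ|exact: wdZ|exact: L2Z|exact: L2Z|exact: L2Z].
Qed.

Lemma W2B f f1 f2 g g1 g2 : W2 f f1 f2 -> W2 g g1 g2 ->
  W2 (fun x => f x - g x) (fun x => f1 x - g1 x) (fun x => f2 x - g2 x).
Proof.
move=> [? ? ? ? ?] [? ? ? ? ?].
by split; [exact: wdB|exact: wdB|exact: L2B|exact: L2B|exact: L2B].
Qed.

Lemma W2_zero : W2 (fun=> 0 : R) (fun=> 0 : R) (fun=> 0 : R).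
Proof.
have w : wd (fun=> 0 : R) (fun=> 0 : R).
  have := @wd_C1 R (fun=> 0); rewrite (derive1_is_derive (fun x : R => is_derive_cst (0 : R) x (1 : R))).
  by apply; apply: (C1_is_derive (fun x : R => is_derive_cst (0 : R) x (1 : R))); exact: cfc.
by split => //; exact: L2_zero.
Qed.

Lemma W2_sum (I : finType) (F F1 F2 : I -> R -> R) : (forall i, W2 (F i) (F1 i) (F2 i)) ->
  W2 (fun x => \sum_i F i x) (fun x => \sum_i F1 i x) (fun x => \sum_i F2 i x).
Proof.
move=> H.
have {}H (s : seq I) : W2 (fun x => \sum_(i <- s) F i x) (fun x => \sum_(i <- s) F1 i x)
    (fun x => \sum_(i <- s) F2 i x).
  elim: s => [|i s IH].
    have E (G : I -> R -> R) : (fun x => \sum_(i <- [::]) G i x) = (fun=> 0).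
      by apply/funext => x; rewrite big_nil.
    by rewrite !E; exact: W2_zero.
  have E (G : I -> R -> R) : (fun x => \sum_(j <- i :: s) G j x) = (fun x => G i x + \sum_(j <- s) G j x).
    by apply/funext => x; rewrite big_cons.
  by rewrite !E; exact: W2D.
exact: H.
Qed.

Lemma W2_shift c f f1 f2 : W2 f f1 f2 ->
  W2 (fun x => f (x + c)) (fun x => f1 (x + c)) (fun x => f2 (x + c)).
Proof.
move=> [? ? ? ? ?].
by split; [exact: wd_shift|exact: wd_shift|exact: L2_shift|exact: L2_shift|exact: L2_shift].
Qed.

Lemma W2_mul (p p1 p2 : R -> R) (B : R) f f1 f2 :
  (forall x : R, is_derive x 1 p (p1 x)) -> (forall x : R, is_derive x 1 p1 (p2 x)) ->
  continuous p2 -> (forall x, [/\ `|p x| <= B, `|p1 x| <= B & `|p2 x| <= B]) ->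
  W2 f f1 f2 ->
  W2 (fun x => p x * f x) (fun x => p1 x * f x + p x * f1 x)
     (fun x => (p2 x * f x + p1 x * f1 x) + (p1 x * f1 x + p x * f2 x)).
Proof.
move=> d0 d1 c2 bd [w0 w1 l0 l1 lf2].
have c1 := is_derive_continuous d1; have c0 := is_derive_continuous d0.
have C0 := C1_is_derive d0 c1; have C1' := C1_is_derive d1 c2.
have D0 := derive1_is_derive d0; have D1 := derive1_is_derive d1.
have L (h h' : R -> R) : continuous h -> (forall x, `|h x| <= B) -> l2 h' -> l2 (fun x => h x * h' x).
  by move=> ch bh; apply: L2_bounded_mul bh; exact: continuous_measurable_fun.
have b0 x : `|p x| <= B by have [] := bd x.
have b1 x : `|p1 x| <= B by have [] := bd x.
have b2 x : `|p2 x| <= B by have [] := bd x.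
have W0 := wd_mul_C1 w0 C0; rewrite D0 in W0.
have W1 := wd_mul_C1 w0 C1'; rewrite D1 in W1.
have W1' := wd_mul_C1 w1 C0; rewrite D0 in W1'.
split => //.
- exact: wdD.
- exact: L.
- by apply: L2D; exact: L.
- by apply: L2D; apply: L2D; exact: L.
Qed.

Lemma H2_W2 f : H2 f -> W2 f (weak_derivative f) (weak_derivative (weak_derivative f)).
Proof. by move=> [h1 h2 l0 l1 l2]; split => //; exact: getPex. Qed.

(** The way back from triples to [H2]: uniqueness identifies the chosen weak derivatives with [f1]
    and [f2]. *)
Lemma W2_weak_derivative f f1 f2 : W2 f f1 f2 ->
  [/\ H2 f, {ae mu, forall x, weak_derivative f x = f1 x} &
    {ae mu, forall x, weak_derivative (weak_derivative f) x = f2 x}].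
Proof.
move=> [w0 w1 l0 l1 l2].
have h1 : weakly_derivable f by exists f1.
have v1 : wd f (weak_derivative f) := getPex h1.
have e1 := weak_derivative_unique v1 w0.
have e1' := weak_derivative_unique w0 v1.
have m1 : measurable_fun setT (weak_derivative f) by case: v1 => _ [].
have w1' : wd (weak_derivative f) f2.
  by apply: wd_ae w1 m1 (L2_meas l2) e1' _; exact: nearW.
have h2 : weakly_derivable (weak_derivative f) by exists f2.
have v2 : wd _ (weak_derivative (weak_derivative f)) := getPex h2.
have e2 := weak_derivative_unique v2 w1'.
have e2' := weak_derivative_unique w1' v2.
split => //; split => //.
- exact: L2_ae l1 m1 e1'.
- by apply: (L2_ae l2 _ e2'); case: v2 => _ [].
Qed.

Lemma H2norm_W2 f f1 f2 : W2 f f1 f2 ->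
  H2norm setT f = Num.sqrt (nrm f ^+ 2 + nrm f1 ^+ 2 + nrm f2 ^+ 2).
Proof.
move=> W; have [H e1 e2] := W2_weak_derivative W; have [_ _ l0 l1 l2] := W.
have [_ _ _ m1 m2] := H2_W2 H.
by rewrite /H2norm (nrm_ae m1 l1 e1) (nrm_ae m2 l2 e2).
Qed.

(** Equal to 1 on [-N, N] and to 0 outside [-2N, 2N], with a derivative of size O(1/N). *)
Let eta (N x : R) : R := ramp N^-1 (- (2 * N)) x - ramp N^-1 N x.
Let deta (N x : R) : R := dramp N^-1 (- (2 * N)) x - dramp N^-1 N x.

Let is_derive_eta (N x : R) : is_derive x 1 (eta N) (deta N x).
Proof. by apply: is_derive_sub; exact: is_derive_ramp. Qed.

Let C1_eta (N : R) : C1 (eta N).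
Proof. by apply: (C1_is_derive (is_derive_eta N)); apply: cfB; exact: dramp_continuous. Qed.

Let eta_vanish (N : R) : 0 < N -> vanish_outside (2 * N) (eta N).
Proof.
move=> N0 x; have i0 : 0 < N^-1 by rewrite invr_gt0.
rewrite /eta; have [x0|x0] := leP x 0.
  rewrite (ler0_norm x0) => h.
  have [-> _ _] := @ramp_le _ N^-1 (- (2 * N)) x i0 ltac:(lra).
  by have [-> _ _] := @ramp_le _ N^-1 N x i0 ltac:(lra); rewrite subrr.
rewrite (gtr0_norm x0) => h.
have [-> _ _] := @ramp_ge _ N^-1 (- (2 * N)) x i0 ltac:(rewrite invrK; lra).
by have [-> _ _] := @ramp_ge _ N^-1 N x i0 ltac:(rewrite invrK; lra); rewrite subrr.
Qed.

Let eta_one (N x : R) : 0 < N -> `|x| <= N -> eta N x = 1.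
Proof.
move=> N0; have i0 : 0 < N^-1 by rewrite invr_gt0.
rewrite ler_norml => /andP[h1 h2]; rewrite /eta.
have [-> _ _] := @ramp_ge _ N^-1 (- (2 * N)) x i0 ltac:(rewrite invrK; lra).
by have [-> _ _] := @ramp_le _ N^-1 N x i0 ltac:(lra); rewrite subr0.
Qed.

Let eta_bound : exists2 c : R, 0 <= c & forall N x, 0 < N -> `|eta N x| <= c /\ `|deta N x| <= c * N^-1.
Proof.
have [C C1 HC] := @ramp_bound R; exists (C + C); first lra.
move=> N x N0; have i0 : 0 < N^-1 by rewrite invr_gt0.
have [a1 a2 _] := HC N^-1 (- (2 * N)) x i0.
have [b1 b2 _] := HC N^-1 N x i0.
split; apply: le_trans (ler_normB _ _) _; first exact: lerD.
by rewrite [leRHS]mulrDl; exact: lerD.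
Qed.

Let cutoff_cvg h : Igr h -> (fun n : nat => \int[mu]_x (h x * eta n.+1%:R x)) @ \oo --> \int[mu]_x h x.
Proof.
move=> Ih; have mh := Igr_meas Ih; have [c c0 cb] := eta_bound.
have n0 n : (0 : R) < n.+1%:R by rewrite ltr0n.
have := @dominated_convergence _ _ R mu setT measurableT
    (fun n x => (h x * eta n.+1%:R x)%:E) (fun x => (h x)%:E) (fun x => (c * `|h x|)%:E).
case.
- move=> n; apply/measurable_EFinP; apply: measurable_funM => //.
  by apply: continuous_measurable_fun; exact: C1_continuous (C1_eta _).
- exact/measurable_EFinP.
- apply: nearW; move=> /= x _; move: (x : R) => {}x; apply: cvg_near_cst; near=> n.
  rewrite eta_one ?mulr1//.
  have /ltW le : `|x| < n%:R by near: n; exact: nbhs_infty_gtr.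
  by rewrite (le_trans le)// ler_nat.
- exact: (IgrZ c (integrable_abse Ih)).
- apply: nearW; move=> /= x n _; rewrite lee_fin normrM mulrC ler_wpM2r//.
  exact: (cb _ _ (n0 n)).1.
move=> _ _; rewrite -(fineK (integrable_fin_num measurableT Ih)).
by move=> /fine_cvgP[_].
Unshelve. all: by end_near. Qed.

(** The representative of g is of class C^1, so its product with the cutoff [eta N] is an admissible
    test function. The term with the derivative of the cutoff is O(1/N), because f1 g is
    integrable. *)
Lemma integration_by_parts_L2 f1 f2 g g1 g2 : wd f1 f2 -> l2 f1 -> l2 f2 ->
  W2 g g1 g2 -> ip f2 g = - ip f1 g1.
Proof.
move=> w lf1 lf2 Wg; have [G [G1 [dG WG PG PG1 [eG eG1]]]] := W2_rep Wg.
have [_ _ lG lG1 _] := WG; have [_ _ lg lg1 lg2] := Wg.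
have -> : ip f2 g = ip f2 G by rewrite !(ipC f2); apply: ip_ae => //; apply: filterS eG.
have -> : ip f1 g1 = ip f1 G1 by rewrite !(ipC f1); apply: ip_ae => //; apply: filterS eG1.
have cG1 : continuous G1 by exact: primitive_continuous PG1.
have CG := C1_is_derive dG cG1; have DG := derive1_is_derive dG.
have n0 n : (0 : R) < n.+1%:R by rewrite ltr0n.
have [c c0 cb] := eta_bound.
have I1 := L2_mul lf1 lG1; have I2 := L2_mul lf2 lG; have I3 := L2_mul lf1 lG.
have E n : \int[mu]_x (f2 x * G x * eta n.+1%:R x) =
   - (\int[mu]_x (f1 x * G1 x * eta n.+1%:R x) + \int[mu]_x (f1 x * G x * deta n.+1%:R x)).
  set N : R := n.+1%:R; have N0 : 0 < N := n0 n.
  have [CM dM] := C1_mul CG (C1_eta N).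
  have vM : vanish_outside (2 * N) (fun x => G x * eta N x).
    by move=> x /(eta_vanish N0) ->; rewrite mulr0.
  have := wdE w CM vM; rewrite dM DG (derive1_is_derive (is_derive_eta N)) => H.
  have meta : measurable_fun setT (eta N).
    by apply: continuous_measurable_fun; exact: C1_continuous (C1_eta _).
  have cdeta : continuous (deta N) by apply: cfB; exact: dramp_continuous.
  have mdeta := continuous_measurable_fun cdeta.
  have J1 : Igr (fun x => f1 x * G1 x * eta N x).
    under [X in _ (EFin \o X)]eq_fun do rewrite mulrC.
    by apply: (@Igr_bounded_mul _ c) => // x; exact: (cb _ _ N0).1.
  have J2 : Igr (fun x => f1 x * G x * deta N x).
    under [X in _ (EFin \o X)]eq_fun do rewrite mulrC.
    by apply: (@Igr_bounded_mul _ (c * N^-1)) => // x; exact: (cb _ _ N0).2.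
  rewrite -RintegralD//.
  have -> : \int[mu]_x (f2 x * G x * eta N x) = \int[mu]_x (f2 x * (G x * eta N x)).
    by apply: eq_RintegralT => x; rewrite mulrA.
  rewrite -[LHS]opprK -H; congr (- _); apply: eq_RintegralT => x; ring.
have c1 := cutoff_cvg I2; have c2 := cutoff_cvg I1.
have c3 : (fun n : nat => \int[mu]_x (f1 x * G x * deta n.+1%:R x)) @ \oo --> (0 : R).
  pose I := \int[mu]_x `|f1 x * G x|.
  have I0 : 0 <= I by apply: Rintegral_ge0.
  have bd n : `|\int[mu]_x (f1 x * G x * deta n.+1%:R x)| <= c * I * n.+1%:R^-1.
    have cdeta : continuous (deta n.+1%:R) by apply: cfB; exact: dramp_continuous.
    have mdeta := continuous_measurable_fun cdeta.
    have J2 : Igr (fun x => f1 x * G x * deta n.+1%:R x).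
      under [X in _ (EFin \o X)]eq_fun do rewrite mulrC.
      by apply: (@Igr_bounded_mul _ (c * n.+1%:R^-1)) => // x; exact: (cb _ _ (n0 n)).2.
    apply: le_trans (le_normr_Rintegral measurableT J2) _.
    have Ia : Igr (fun x => `|f1 x * G x|) := integrable_abse I3.
    rewrite mulrAC /I -RintegralZl//; apply: le_Rint_ae.
    - exact: (integrable_abse J2).
    - exact: IgrZ.
    - apply: nearW; move=> /= x; rewrite normrM mulrC ler_wpM2r//.
      exact: (cb _ _ (n0 n)).2.
  apply/cvgrPdist_le => e e0; near=> n; rewrite sub0r normrN.
  apply: le_trans (bd n) _; rewrite ler_pdivrMr//.
  have /ltW le : c * I / e < n%:R by near: n; exact: nbhs_infty_gtr.
  rewrite (ler_pdivrMr _ _ e0) in le; apply: (le_trans le); rewrite mulrC.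
  by rewrite ler_wpM2l ?(ltW e0)// ler_nat.
have c4 : (fun n : nat => \int[mu]_x (f2 x * G x * eta n.+1%:R x)) @ \oo --> - (ip f1 G1 + 0).
  under eq_fun do rewrite E.
  by apply: cvgN; apply: cvgD.
have := cvg_unique _ c1 c4; rewrite addr0; exact.
Unshelve. all: by end_near. Qed.

Lemma ip_second_derivative f f1 f2 : W2 f f1 f2 -> ip f2 f = - nrm f1 ^+ 2.
Proof. by move=> W; have [w0 w1 l0 l1 l2] := W; rewrite (integration_by_parts_L2 w1 l1 l2 W) nrm_sqr. Qed.

Lemma ip_symmetric f f1 f2 g g1 g2 : W2 f f1 f2 -> W2 g g1 g2 -> ip f2 g = ip f g2.
Proof.
move=> Wf Wg; have [w0 w1 l0 l1 l2] := Wf; have [v0 v1 m0 m1 m2] := Wg.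
rewrite (integration_by_parts_L2 w1 l1 l2 Wg) (ipC f) (integration_by_parts_L2 v1 m1 m2 Wf).
by rewrite ipC.
Qed.

Lemma nrm_derivative f f1 f2 : W2 f f1 f2 -> nrm f1 ^+ 2 <= nrm f * nrm f2.
Proof.
move=> W; have := ip_second_derivative W; have [w0 w1 l0 l1 l2] := W.
have := cauchy_schwarz l2 l0; rewrite mulrC => h E.
by rewrite -[leLHS]opprK -E (le_trans _ h)// -normrN ler_norm.
Qed.

Definition Wnorm f f1 f2 : R := nrm f + nrm f1 + nrm f2.

Lemma Wnorm_ge0 f f1 f2 : 0 <= Wnorm f f1 f2.
Proof. by rewrite !addr_ge0 ?nrm_ge0. Qed.

Lemma W2_sup f f1 f2 : W2 f f1 f2 -> {ae mu, forall x, `|f x| <= Wnorm f f1 f2}.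
Proof.
move=> W; have [F [F1 [_ WF P _ [e0 e1]]]] := W2_rep W.
have [_ _ l0 l1 _] := W; have [_ _ m0 m1 _] := WF.
have E0 := nrm_ae m0 l0 e0; have E1 := nrm_ae m1 l1 e1.
apply: filterS e0; move=> /= x <-; move: (x : R) => {}x.
apply: le_trans (sup_bound x m0 m1 P) _.
by rewrite E0 E1 /Wnorm lerDl nrm_ge0.
Qed.

(** The three components converge separately in L2, each with constant 2 C, and [wd_limit] relates
    their limits. *)
Lemma W2_complete (f f1 f2 : nat -> R -> R) (C : R) : 0 <= C ->
  (forall k, W2 (f k) (f1 k) (f2 k)) ->
  (forall k, Wnorm (fun x => f k.+1 x - f k x) (fun x => f1 k.+1 x - f1 k x)
    (fun x => f2 k.+1 x - f2 k x) <= C * 2^-1 ^+ k) ->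
  exists g g1 g2, W2 g g1 g2 /\ forall k,
    Wnorm (fun x => f k x - g x) (fun x => f1 k x - g1 x) (fun x => f2 k x - g2 x)
      <= 6 * C * 2^-1 ^+ k.
Proof.
move=> C0 W H.
have n0 (h : R -> R) := nrm_ge0 h.
have l0 k : l2 (f k) by case: (W k).
have l1 k : l2 (f1 k) by case: (W k).
have L2' k : l2 (f2 k) by case: (W k).
have [k|g [lg G]] := @L2_complete R f C C0 l0.
  by apply: le_trans (H k); rewrite /Wnorm -addrA lerDl addr_ge0.
have [k|g1 [lg1 G1]] := @L2_complete R f1 C C0 l1.
  by apply: le_trans (H k); rewrite /Wnorm addrAC lerDr addr_ge0.
have [k|g2 [lg2 G2]] := @L2_complete R f2 C C0 L2'.
  by apply: le_trans (H k); rewrite /Wnorm lerDr addr_ge0.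
have cv (h : nat -> R -> R) h' : (forall k, nrm (fun x => h k x - h' x) <= 2 * C * 2^-1 ^+ k) ->
   (fun k => nrm (fun x => h k x - h' x)) @ \oo --> (0 : R).
  move=> hh; apply: (@squeeze_cvgr _ _ _ _ (fun=> 0) (fun k => 2 * C * 2^-1 ^+ k)).
  - by apply: nearW => k; rewrite nrm_ge0 hh.
  - exact: cvg_cst.
  - rewrite -(mulr0 (2 * C)); apply: cvgM; first exact: cvg_cst.
    by apply: cvg_expr; rewrite ger0_norm; lra.
exists g, g1, g2; split.
  split => //.
  - by apply: (@wd_limit _ f f1) => //; [move=> k; case: (W k)|exact: cv|exact: cv].
  - by apply: (@wd_limit _ f1 f2) => //; [move=> k; case: (W k)|exact: cv|exact: cv].
by move=> k; have := G k; have := G1 k; have := G2 k; rewrite /Wnorm; lra.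
Qed.

End Sobolev.

(** * Newton iteration and approximate inverses *)

Section NewtonIteration.
Variable R : realType.
Variables (X : Type) (x0 : X) (good : X -> Prop) (dist : X -> X -> R) (res : X -> R).
Variables (K L c : R).
Hypotheses (K0 : 0 <= K) (L0 : 0 <= L) (c0 : 0 <= c) (good0 : good x0).
Hypothesis dist_refl : forall x, dist x x = 0.
Hypothesis dist_triangle : forall x y z, good x -> good y -> good z -> dist x z <= dist x y + dist y z.
Hypothesis res_ge0 : forall x, 0 <= res x.
Hypothesis complete : forall (s : nat -> X) (C : R), 0 <= C -> (forall k, good (s k)) ->
  (forall k, dist (s k) (s k.+1) <= C * 2^-1 ^+ k) ->
  exists x, good x /\ forall k, dist (s k) x <= c * C * 2^-1 ^+ k.
Hypothesis lipschitz : forall x y, good x -> good y -> res y <= res x + L * dist x y.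
Hypothesis improve : forall x, good x -> dist x0 x <= 2 * K * res x0 -> res x <= res x0 ->
  exists y, [/\ good y, dist x y <= K * res x & res y <= res x / 2].

(** A correction costs at most K times the residual and halves it, so the total displacement stays
    below 2 K times the initial residual: this is exactly the region in which [improve] is assumed.
    Lipschitz continuity of the residual makes it vanish at the limit. *)
Lemma newton_iteration : exists x, [/\ good x, res x = 0 & dist x0 x <= c * K * res x0].
Proof.
have [F HF] : exists F : X -> X, forall x, good x -> dist x0 x <= 2 * K * res x0 ->
    res x <= res x0 -> [/\ good (F x), dist x (F x) <= K * res x & res (F x) <= res x / 2].
  have H x : exists y, good x -> dist x0 x <= 2 * K * res x0 -> res x <= res x0 ->
      [/\ good y, dist x y <= K * res x & res y <= res x / 2].
    (* Outside the region of [improve] the point itself is the default value, which makes [F]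
       total. *)
    have [[g [d r]]|n] := pselect (good x /\ dist x0 x <= 2 * K * res x0 /\ res x <= res x0).
      by have [y Hy] := improve g d r; exists y.
    by exists x => g d r; exfalso; apply: n.
  by have [F HF] := choice H; exists F.
pose s k := iter k F x0.
have r0 := res_ge0 x0.
(* The factor 1 - 2^-k is the exact sum of the first k steps. *)
have S k : [/\ good (s k), dist x0 (s k) <= 2 * K * res x0 * (1 - 2^-1 ^+ k) &
    res (s k) <= res x0 * 2^-1 ^+ k].
  elim: k => [|k [g d r]].
    by split => //; rewrite expr0 ?subrr ?mulr0 ?mulr1// dist_refl.
  have p0 : 0 <= 2^-1 ^+ k :> R by rewrite exprn_ge0.
  have p1 : 2^-1 ^+ k <= 1 :> R by rewrite exprn_ile1// invf_le1// ler1n.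
  have kr0 : 0 <= K * res x0 by exact: mulr_ge0.
  have d' : dist x0 (s k) <= 2 * K * res x0.
    by apply: le_trans d _; rewrite -[leRHS]mulr1 -mulrA -[in leRHS]mulrA; nra.
  have r' : res (s k) <= res x0 by apply: le_trans r _; rewrite ler_piMr.
  have [g2 d2 r2] := HF _ g d' r'.
  rewrite /s iterS -/(s k); split => //.
    apply: le_trans (dist_triangle good0 g g2) _.
    have : K * res (s k) <= K * (res x0 * 2^-1 ^+ k) by rewrite ler_wpM2l.
    by rewrite exprS; move: d d2; lra.
  by apply: le_trans r2 _; rewrite exprS; move: r; lra.
have [|||x [gx dx]] := @complete s (K * res x0).
- exact: mulr_ge0.
- by move=> k; have [] := S k.
- move=> k; have [g d r] := S k.
  have p1 : 2^-1 ^+ k <= 1 :> R by rewrite exprn_ile1// invf_le1// ler1n.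
  have p0 : 0 <= 2^-1 ^+ k :> R by rewrite exprn_ge0.
  have kr0 : 0 <= K * res x0 by exact: mulr_ge0.
  have d' : dist x0 (s k) <= 2 * K * res x0 by nra.
  have r' : res (s k) <= res x0 by apply: le_trans r _; rewrite ler_piMr.
  have [g2 d2 r2] := HF _ g d' r'.
  by apply: le_trans d2 _; rewrite -mulrA ler_wpM2l.
exists x; split => //; last by have := dx 0%N; rewrite expr0 mulr1 mulrA.
apply/eqP; rewrite eq_le res_ge0 andbT.
have B k : res x <= (res x0 + L * (c * (K * res x0))) * 2^-1 ^+ k.
  have [g d r] := S k; apply: le_trans (lipschitz g gx) _.
  rewrite mulrDl; apply: lerD; first exact: r.
  by rewrite -[leRHS]mulrA; apply: ler_wpM2l; [exact: L0|exact: dx].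
have cv : (fun k => (res x0 + L * (c * (K * res x0))) * 2^-1 ^+ k) @ \oo --> (0 : R).
  rewrite -(mulr0 (res x0 + L * (c * (K * res x0)))); apply: cvgM; first exact: cvg_cst.
  by apply: cvg_expr; rewrite ger0_norm; lra.
exact: (cvgr_to_ge cv (nearW _ B)).
Qed.

End NewtonIteration.

Section Operators.
Variable R : realType.
Local Notation mu := (@lebesgue_measure R).
Local Notation Igr f := (mu.-integrable setT (EFin \o f)).
Implicit Types (f g Q : R -> R).

(** A defect of 1/4 leaves another 1/4 for the nonlinear remainder, so that one Newton step halves
    the residual. *)
Definition approx_inverse Q (K : R) := forall w, l2 w -> exists f f1 f2,
  [/\ W2 f f1 f2, Wnorm f f1 f2 <= K * nrm w &
    nrm (fun x => f2 x - Q x * f x - w x) <= nrm w / 4].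

(** Uniqueness of the solution comes from symmetry, in [right_inverse_bound], and bounds for its
    derivatives from the equation, in [Wnorm_solution]. *)
Definition right_inverse Q (K : R) := forall w, l2 w -> exists f f1 f2,
  [/\ W2 f f1 f2, {ae mu, forall x, f2 x - Q x * f x = w x} & nrm f <= K * nrm w].

Definition potential (B : R) Q := measurable_fun setT Q /\ forall x, `|Q x| <= B.

Lemma potential_ge0 B Q : potential B Q -> 0 <= B.
Proof. by move=> [_ /(_ 0)]; exact: le_trans. Qed.

Lemma L2_potential_mul B Q f : potential B Q -> l2 f ->
  l2 (fun x => Q x * f x) /\ nrm (fun x => Q x * f x) <= B * nrm f.
Proof.
move=> P lf; have B0 := potential_ge0 P; have [mQ bQ] := P.
have l : l2 (fun x => Q x * f x) by exact: L2_bounded_mul bQ lf.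
split => //; apply: nrm_le_ae => //; apply: nearW => x.
by rewrite normrM ler_wpM2r.
Qed.

(** The equation bounds [f2]; the interpolation inequality [nrm_derivative] then bounds [f1]. *)
Lemma Wnorm_solution B Q (K : R) f f1 f2 w : potential B Q -> W2 f f1 f2 -> l2 w ->
  {ae mu, forall x, f2 x - Q x * f x = w x} -> nrm f <= K * nrm w ->
  Wnorm f f1 f2 <= 2 * (K + B * K + 1) * nrm w.
Proof.
move=> P W lw e h; have [_ _ l0 l1 lf2] := W; have [lQ nQ] := L2_potential_mul P l0.
have B0 := potential_ge0 P.
have n2 : nrm f2 <= nrm w + B * nrm f.
  have -> : nrm f2 = nrm (fun x => w x + Q x * f x).
    by apply: nrm_ae => //; [exact: L2D|apply: filterS e => x <-; rewrite subrK].
  by apply: le_trans (nrmD lw lQ) _; rewrite lerD2l.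
have n1 : nrm f1 <= nrm f + nrm f2.
  apply: le_sqrt_of_sqr; first by rewrite addr_ge0 ?nrm_ge0.
  by have := nrm_derivative W; have := nrm_ge0 f; have := nrm_ge0 f2; nra.
have : B * nrm f <= B * (K * nrm w) by rewrite ler_wpM2l.
rewrite /Wnorm; lra.
Qed.

Lemma WnormD f f1 f2 g g1 g2 : W2 f f1 f2 -> W2 g g1 g2 ->
  Wnorm (fun x => f x + g x) (fun x => f1 x + g1 x) (fun x => f2 x + g2 x) <=
  Wnorm f f1 f2 + Wnorm g g1 g2.
Proof.
move=> [_ _ a0 a1 a2] [_ _ b0 b1 b2]; rewrite /Wnorm.
by have := nrmD a0 b0; have := nrmD a1 b1; have := nrmD a2 b2; lra.
Qed.

Definition trip := ((R -> R) * (R -> R) * (R -> R))%type.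
Definition tW (t : trip) := W2 t.1.1 t.1.2 t.2.
Definition tdist (s t : trip) : R := Wnorm (fun x => t.1.1 x - s.1.1 x)
  (fun x => t.1.2 x - s.1.2 x) (fun x => t.2 x - s.2 x).

Lemma tdist_refl t : tdist t t = 0.
Proof.
have E (f : R -> R) : (fun x => f x - f x) = (fun=> 0) by apply/funext => x; rewrite subrr.
by rewrite /tdist /Wnorm !E !nrm_zero !addr0.
Qed.

Lemma tdist_triangle x y z : tW x -> tW y -> tW z -> tdist x z <= tdist x y + tdist y z.
Proof.
move=> Wx Wy Wz; have := WnormD (W2B Wy Wx) (W2B Wz Wy); rewrite /tdist.
have E (f g h : R -> R) : (fun x => (f x - g x) + (h x - f x)) = (fun x => h x - g x).
  by apply/funext => t; ring.
by rewrite !E.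
Qed.

Lemma tdist_complete (s : nat -> trip) (C : R) : 0 <= C -> (forall k, tW (s k)) ->
  (forall k, tdist (s k) (s k.+1) <= C * 2^-1 ^+ k) ->
  exists x, tW x /\ forall k, tdist (s k) x <= 6 * C * 2^-1 ^+ k.
Proof.
move=> C0 W H.
have [g [g1 [g2 [Wg Hg]]]] := @W2_complete R (fun k => (s k).1.1) (fun k => (s k).1.2)
  (fun k => (s k).2) C C0 W H.
exists (g, g1, g2); split => // k; apply: le_trans (Hg k).
have [_ _ a0 a1 a2] := W k; have [_ _ b0 b1 b2] := Wg.
rewrite /tdist /Wnorm /=.
have E (f h : R -> R) : l2 f -> l2 h -> nrm (fun x => h x - f x) = nrm (fun x => f x - h x).
  move=> lf lh; rewrite -(nrmN (L2B lf lh)); congr (L2norm _ _).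
  by apply/funext => x; rewrite opprB.
by rewrite (E _ _ a0 b0) (E _ _ a1 b1) (E _ _ a2 b2).
Qed.

(* The linear equation is the case [D = 0], the stationary equation the case [D = 1]. *)
Lemma semilinear_solve (N : R -> R -> R) Q w (B D K : R) :
  0 <= K -> 0 <= D -> potential B Q -> l2 w ->
  (forall a : R -> R, measurable_fun setT a -> measurable_fun setT (fun x => N x (a x))) ->
  (forall x, N x 0 = 0) -> (forall x a b, `|N x b - N x a| <= B * `|b - a|) ->
  (forall x a p, `|N x (a + p) - N x a - Q x * p| <= D * ((`|a| + `|p|) * `|p|)) ->
  approx_inverse Q K -> D * (12 * K ^+ 2 * nrm w) <= 1 ->
  exists a a1 a2, [/\ W2 a a1 a2, {ae mu, forall x, a2 x - N x (a x) = w x} &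
    Wnorm a a1 a2 <= 6 * K * nrm w].
Proof.
move=> K0 D0 P lw mN N0 lipN quadN app small.
have B0 := potential_ge0 P.
have lN a : l2 a -> l2 (fun x => N x (a x)).
  move=> la; apply: (@L2_le R _ (fun x => B * a x)); first exact: mN (L2_meas la).
    exact: L2Z.
  by move=> x; have := lipN x 0 (a x); rewrite N0 !subr0 normrM (ger0_norm B0).
pose rf (t : trip) x := t.2 x - N x (t.1.1 x) - w x.
have lrf t : tW t -> l2 (rf t).
  by move=> [_ _ l0 l1 lt2]; apply: L2B => //; apply: L2B => //; exact: lN.
pose res t := nrm (rf t).
pose z : trip := ((fun=> 0), (fun=> 0), (fun=> 0)).
have Wz : tW z by exact: W2_zero.
have resz : res z = nrm w.
  rewrite /res -[RHS](nrmN lw); congr (L2norm _ _); apply/funext => x.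
  by rewrite /rf /= N0 subrr sub0r.
have dz t : tdist z t = Wnorm t.1.1 t.1.2 t.2.
  by rewrite /tdist /=; congr Wnorm; apply/funext => x; rewrite subr0.
have [t [Wt rt dt]] : exists t, [/\ tW t, res t = 0 & tdist z t <= 6 * K * res z].
  apply: (@newton_iteration R trip z tW tdist res K (1 + B) 6) => //.
  - by rewrite addr_ge0.
  - exact: tdist_refl.
  - exact: tdist_triangle.
  - by move=> x; exact: nrm_ge0.
  - exact: tdist_complete.
  - move=> x y Wx Wy; have [_ _ x0 x1 x2] := Wx; have [_ _ y0 y1 y2] := Wy.
    have l02 := L2B y2 x2; have l00 := L2B y0 x0.
    have lNd := L2B (lN _ y0) (lN _ x0).
    have -> : res y = nrm (fun s => rf x s + ((y.2 s - x.2 s) - (N s (y.1.1 s) - N s (x.1.1 s)))).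
      by congr (L2norm _ _); apply/funext => s; rewrite /rf; ring.
    apply: le_trans (nrmD (lrf _ Wx) (L2B l02 lNd)) _; rewrite lerD2l.
    apply: le_trans (nrmB l02 lNd) _.
    have : nrm (fun s => N s (y.1.1 s) - N s (x.1.1 s)) <= B * nrm (fun s => y.1.1 s - x.1.1 s).
      by apply: nrm_le_ae => //; apply: nearW => s; exact: lipN.
    rewrite /tdist /Wnorm; have := nrm_ge0 (fun s => y.1.1 s - x.1.1 s).
    have := nrm_ge0 (fun s => y.1.2 s - x.1.2 s); have := nrm_ge0 (fun s => y.2 s - x.2 s).
    move=> p q r h; have : 0 <= B * nrm (fun s => y.2 s - x.2 s) by exact: mulr_ge0.
    by have : 0 <= B * nrm (fun s => y.1.2 s - x.1.2 s); [exact: mulr_ge0|lra].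
  - move=> x Wx dx rx.
    have [p [p1 [p2 [Wp np rp]]]] := app _ (L2N (lrf _ Wx)).
    rewrite (nrmN (lrf _ Wx)) -/(res x) in np rp.
    pose y : trip := ((fun s => x.1.1 s + p s), (fun s => x.1.2 s + p1 s), (fun s => x.2 s + p2 s)).
    have Wy : tW y by exact: W2D.
    exists y; split => //.
      rewrite /tdist /y /= (_ : (fun s => x.1.1 s + p s - x.1.1 s) = p); last first.
        by apply/funext => s; ring.
      rewrite (_ : (fun s => x.1.2 s + p1 s - x.1.2 s) = p1); last by apply/funext => s; ring.
      by rewrite (_ : (fun s => x.2 s + p2 s - x.2 s) = p2)//; apply/funext => s; ring.
    have [_ _ l0 l1 lp2] := Wp; have [_ _ x0 x1 x2] := Wx.
    have [lQ _] := L2_potential_mul P l0.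
    pose e s := N s (x.1.1 s + p s) - N s (x.1.1 s) - Q s * p s.
    have le2 : l2 e by apply: L2B => //; apply: L2B; apply: lN => //; exact: L2D.
    have lr := L2B (L2B lp2 lQ) (L2N (lrf _ Wx)).
    have -> : res y = nrm (fun s => (p2 s - Q s * p s - - rf x s) - e s).
      by congr (L2norm _ _); apply/funext => s; rewrite /rf /e /y /=; ring.
    apply: le_trans (nrmB lr le2) _.
    have r0 : 0 <= res x by exact: nrm_ge0.
    rewrite resz in dx rx; have w0 := nrm_ge0 w.
    have kx : K * res x <= K * nrm w by rewrite ler_wpM2l.
    have c0 : 0 <= 3 * (K * nrm w) by rewrite !mulr_ge0.
    (* The iterate is at most 2 K ||w|| in sup norm and the correction at most K ||w||, which
       explains the 3. With 12 = 4 * 3 in the smallness hypothesis, the remainder is at most a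
       quarter of the residual. *)
    have he : nrm e <= D * (3 * (K * nrm w)) * nrm p.
      apply: nrm_le_ae => //; first exact: mulr_ge0.
      apply: filterS2 (W2_sup Wx) (W2_sup Wp) => s; rewrite -dz => h1 h2.
      apply: le_trans (quadN _ _ _) _; rewrite -mulrA ler_wpM2l// ler_wpM2r//; lra.
    have hp : nrm p <= K * res x.
      by apply: le_trans np; rewrite /Wnorm -addrA lerDl addr_ge0 ?nrm_ge0.
    have c1 : 0 <= D * (3 * (K * nrm w)) by exact: mulr_ge0.
    have h3 : nrm e <= D * (3 * (K * nrm w)) * (K * res x) by apply: le_trans he _; rewrite ler_wpM2l.
    have h4 : D * (12 * K ^+ 2 * nrm w) * res x <= res x by rewrite ler_piMl.
    have E4 : D * (12 * K ^+ 2 * nrm w) * res x = 4 * (D * (3 * (K * nrm w)) * (K * res x)) by ring.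
    by rewrite E4 in h4; lra.
exists t.1.1, t.1.2, t.2; split => //; last by rewrite -dz -resz.
have := nrm_eq0_ae (lrf _ Wt) rt.
by apply: filterS => x /eqP; rewrite /rf subr_eq0 => /eqP.
Qed.

Lemma linear_solve Q (B K : R) : 0 <= K -> potential B Q -> approx_inverse Q K ->
  forall w, l2 w -> exists f f1 f2, [/\ W2 f f1 f2,
    {ae mu, forall x, f2 x - Q x * f x = w x} & Wnorm f f1 f2 <= 6 * K * nrm w].
Proof.
move=> K0 P app w lw; have [mQ bQ] := P.
apply: (@semilinear_solve (fun x a => Q x * a) Q w B 0 K) => //.
- by move=> a ma; exact: measurable_funM.
- by move=> x; rewrite mulr0.
- by move=> x a b; rewrite -mulrBr normrM ler_wpM2r.
- by move=> x a p; rewrite mul0r mulrDr (addrC (Q x * a)) addrK subrr normr0.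
- by rewrite mul0r.
Qed.

Lemma right_inverse_of_approx Q (B K : R) : 0 <= K -> potential B Q -> approx_inverse Q K ->
  right_inverse Q (6 * K).
Proof.
move=> K0 P app w lw; have [f [f1 [f2 [W e h]]]] := linear_solve K0 P app lw.
exists f, f1, f2; split => //; apply: le_trans h.
by rewrite /Wnorm -addrA lerDl addr_ge0 ?nrm_ge0.
Qed.

(* Partition of unity parametrix: if [h_j] solves the [j]-th equation with right-hand
   side [w], then [\sum_j p_j h_j] solves the glued one up to a small error. *)
Lemma parametrix (M : nat) (Q : R -> R) (Qj p p1 p2 : 'I_M -> R -> R) (B C K d : R) :
  0 <= K -> 0 <= d -> d <= 1 -> 1 <= C -> potential B Q -> (forall j, potential B (Qj j)) ->
  (forall j, right_inverse (Qj j) K) ->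
  (forall j (x : R), is_derive x 1 (p j) (p1 j x)) ->
  (forall j (x : R), is_derive x 1 (p1 j) (p2 j x)) ->
  (forall j, continuous (p2 j)) ->
  (forall j x, [/\ `|p j x| <= C, `|p1 j x| <= d & `|p2 j x| <= d]) ->
  (forall x, \sum_j p j x = 1) ->
  (forall j x, p j x != 0 -> `|Q x - Qj j x| <= d) ->
  4 * (M%:R * (d * (3 + C) * (2 * (K + B * K + 1)))) <= 1 ->
  approx_inverse Q (M%:R * (7 * C * (2 * (K + B * K + 1)))).
Proof.
move=> K0 d0 d1 C1 P Pj inv dp dp1 cp2 bd sum1 close small w lw.
pose K' := 2 * (K + B * K + 1); rewrite -/K' in small *.
have B0 := potential_ge0 P; have w0 := nrm_ge0 w.
have K'0 : 0 <= K' by rewrite /K'; have := mulr_ge0 B0 K0; lra.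
have H j : exists h : (R -> R) * (R -> R) * (R -> R),
    [/\ W2 h.1.1 h.1.2 h.2, {ae mu, forall x, h.2 x - Qj j x * h.1.1 x = w x} &
      Wnorm h.1.1 h.1.2 h.2 <= K' * nrm w].
  have [f [f1 [f2 [W e n]]]] := inv j w lw.
  by exists (f, f1, f2); split => //; exact: (Wnorm_solution (Pj j) W lw e n).
have [h Hh] := choice H.
pose f j x := p j x * (h j).1.1 x.
pose f1 j x := p1 j x * (h j).1.1 x + p j x * (h j).1.2 x.
pose f2 j x := (p2 j x * (h j).1.1 x + p1 j x * (h j).1.2 x) + (p1 j x * (h j).1.2 x + p j x * (h j).2 x).
have W j : W2 (f j) (f1 j) (f2 j).
  apply: (@W2_mul R (p j) (p1 j) (p2 j) C) => //; last by have [] := Hh j.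
  by move=> x; have [b0 b1 b2] := bd j x; split => //; lra.
have L j : [/\ l2 (h j).1.1, l2 (h j).1.2 & l2 (h j).2] by have [[]] := Hh j.
have nh j : [/\ nrm (h j).1.1 <= K' * nrm w, nrm (h j).1.2 <= K' * nrm w & nrm (h j).2 <= K' * nrm w].
  have [_ _ n] := Hh j; have := nrm_ge0 (h j).1.1; have := nrm_ge0 (h j).1.2; have := nrm_ge0 (h j).2.
  by rewrite /Wnorm in n; clear -n; split; lra.
have WM := W2_sum W.
have nM (c : R) g g' : 0 <= c -> continuous g -> (forall x, `|g x| <= c) -> l2 g' ->
    l2 (fun x => g x * g' x) /\ nrm (fun x => g x * g' x) <= c * nrm g'.
  by move=> c0 cg bg lg'; apply: L2_potential_mul => //; split => //; exact: continuous_measurable_fun.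
have cp1 j := is_derive_continuous (dp1 j); have cp j := is_derive_continuous (dp j).
have b0 j x : `|p j x| <= C by have [] := bd j x.
have b1 j x : `|p1 j x| <= d by have [] := bd j x.
have b2 j x : `|p2 j x| <= d by have [] := bd j x.
have C0 : 0 <= C by lra.
have s0 : 0 <= K' * nrm w by exact: mulr_ge0.
exists (fun x => \sum_j f j x), (fun x => \sum_j f1 j x), (fun x => \sum_j f2 j x); split => //.
- have LW j := W j.
  rewrite /Wnorm.
  (* Since d <= 1 <= C, a function and its first two derivatives contribute C, 2 C and 4 C per
     index, in total 7 C. *)
  have N0 : nrm (fun x => \sum_j f j x) <= \sum_(j < M) C * (K' * nrm w).
    apply: nrm_sum => j; first by case: (W j).
    have [l0 l1 l2'] := L j; have [n0 n1 n2] := nh j.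
    by apply: le_trans (nM C _ _ C0 (cp j) (b0 j) l0).2 _; rewrite ler_wpM2l.
  have dC : d * (K' * nrm w) <= C * (K' * nrm w) by rewrite ler_wpM2r//; lra.
  have T (c : R) g g' : 0 <= c -> continuous g -> (forall x, `|g x| <= c) -> c <= C -> l2 g' -> nrm g' <= K' * nrm w ->
      nrm (fun x => g x * g' x) <= C * (K' * nrm w).
    move=> c0 cg bg cC lg ng; apply: le_trans (nM c _ _ c0 cg bg lg).2 _.
    by apply: ler_pM => //; exact: nrm_ge0.
  have dC1 : d <= C by lra.
  have N1 : nrm (fun x => \sum_j f1 j x) <= \sum_(j < M) 2 * C * (K' * nrm w).
    apply: nrm_sum => j; first by case: (W j).
    have [l0 l1 l2'] := L j; have [n0 n1 n2] := nh j.
    have t1 := T d _ _ d0 (cp1 j) (b1 j) dC1 l0 n0; have t2 := T C _ _ C0 (cp j) (b0 j) (lexx _) l1 n1.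
    apply: le_trans (nrmD (nM d _ _ d0 (cp1 j) (b1 j) l0).1 (nM C _ _ C0 (cp j) (b0 j) l1).1) _.
    lra.
  have N2 : nrm (fun x => \sum_j f2 j x) <= \sum_(j < M) 4 * C * (K' * nrm w).
    apply: nrm_sum => j; first by case: (W j).
    have [l0 l1 l2'] := L j; have [n0 n1 n2] := nh j.
    have t1 := T d _ _ d0 (cp2 j) (b2 j) dC1 l0 n0; have t2 := T d _ _ d0 (cp1 j) (b1 j) dC1 l1 n1.
    have t3 := T C _ _ C0 (cp j) (b0 j) (lexx _) l2' n2.
    have m1 := (nM d _ _ d0 (cp2 j) (b2 j) l0).1; have m2 := (nM d _ _ d0 (cp1 j) (b1 j) l1).1.
    have m3 := (nM C _ _ C0 (cp j) (b0 j) l2').1.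
    apply: le_trans (nrmD (L2D m1 m2) (L2D m2 m3)) _.
    by have := nrmD m1 m2; have := nrmD m2 m3; clear -t1 t2 t3; lra.
  have S (c : R) : \sum_(j < M) c = M%:R * c by rewrite sumr_const card_ord mulr_natl.
  by rewrite !S in N0 N1 N2; clear -N0 N1 N2; lra.
(* The commutator p'' h + 2 p' h' accounts for 3 d. The other term accounts for C d, because p_j
   vanishes wherever the potentials are not known to be close. *)
- pose e j x := (p2 j x * (h j).1.1 x + 2 * (p1 j x * (h j).1.2 x)) + (p j x * (Qj j x - Q x)) * (h j).1.1 x.
  have mQ : measurable_fun setT Q by case: P.
  have le3 j : l2 (e j) /\ nrm (e j) <= d * (3 + C) * (K' * nrm w).
    have [l0 l1 l2'] := L j; have [n0 n1 n2] := nh j.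
    have [m1 t1] := nM d _ _ d0 (cp2 j) (b2 j) l0; have [m2 t2] := nM d _ _ d0 (cp1 j) (b1 j) l1.
    have PQ : potential (C * d) (fun x => p j x * (Qj j x - Q x)).
      split; first by apply: measurable_funM; [exact: continuous_measurable_fun|apply: measurable_funB => //; case: (Pj j)].
      move=> x; have [->|px] := eqVneq (p j x) 0; first by rewrite mul0r normr0 mulr_ge0.
      by rewrite normrM distrC; apply: ler_pM => //; exact: close.
    have [m3 t3] := L2_potential_mul PQ l0.
    have m4 := L2Z 2 m2; have lD := L2D m1 m4.
    split; first exact: L2D.
    apply: le_trans (nrmD lD m3) _; have := nrmD m1 m4; rewrite (nrmZ 2 m2) ger0_norm//.
    have q1 : d * nrm (h j).1.1 <= d * (K' * nrm w) by rewrite ler_wpM2l.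
    have q2 : d * nrm (h j).1.2 <= d * (K' * nrm w) by rewrite ler_wpM2l.
    have q3 : C * d * nrm (h j).1.1 <= C * d * (K' * nrm w) by rewrite ler_wpM2l// mulr_ge0.
    lra.
  have lE : l2 (fun x => \sum_j e j x) by apply: L2_sum => j; exact: (le3 j).1.
  have [_ _ LW0 _ LW2] := WM; have [lQ _] := L2_potential_mul P LW0.
  have -> : nrm (fun x => \sum_j f2 j x - Q x * (\sum_j f j x) - w x) = nrm (fun x => \sum_j e j x).
    apply: nrm_ae => //; first by do 2 apply: L2B => //.
    have : {ae mu, forall x, forall j, (h j).2 x - Qj j x * (h j).1.1 x = w x}.
      by apply: filter_forall => j; have [] := Hh j.
    apply: filterS => x Hx.
    rewrite -[w x]mul1r -(sum1 x) mulr_suml mulr_sumr -!sumrB; apply: eq_bigr => j _.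
    by rewrite /f2 /f /e -[in p j x * w x](Hx j); ring.
  apply: le_trans (nrm_sum (fun j => (le3 j).1) (fun j => (le3 j).2)) _.
  rewrite sumr_const card_ord -mulr_natl.
  have : 4 * (M%:R * (d * (3 + C) * K')) * nrm w <= nrm w by rewrite ler_piMl.
  have -> : 4 * (M%:R * (d * (3 + C) * K')) * nrm w = 4 * (M%:R * (d * (3 + C) * (K' * nrm w))) by ring.
  lra.
Qed.

End Operators.

(** * Quadratic forms and resolvent sets *)

Section QuadraticForms.
Variable R : realType.
Local Notation mu := (@lebesgue_measure R).
Implicit Types (f g Q : R -> R).

Variables (B : R) (Q : R -> R).
Hypothesis P : potential B Q.

(** The operator is A = d^2/dx^2 - Q. With this sign, A - m has the potential Q + m, as in the
    invertibility hypotheses below. *)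
Definition form_le (m : R) := forall f f1 f2, W2 f f1 f2 ->
  ip (fun x => f2 x - Q x * f x) f <= m * nrm f ^+ 2.

Lemma ip_zerol f : ip (fun=> 0 : R) f = 0.
Proof. by rewrite /ip; under eq_RintegralT do rewrite mul0r; rewrite /Rintegral integral0. Qed.

Lemma L2_operator f f1 f2 : W2 f f1 f2 -> l2 (fun x => f2 x - Q x * f x).
Proof. by move=> [_ _ l0 l1 lf2]; apply: L2B => //; have [] := L2_potential_mul P l0. Qed.

Lemma operator_symmetric f f1 f2 g g1 g2 : W2 f f1 f2 -> W2 g g1 g2 ->
  ip (fun x => f2 x - Q x * f x) g = ip f (fun x => g2 x - Q x * g x).
Proof.
move=> Wf Wg; have [_ _ l0 l1 lf2] := Wf; have [_ _ m0 m1 mg2] := Wg.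
have [lQ _] := L2_potential_mul P l0; have [mQ _] := L2_potential_mul P m0.
rewrite ipBl// (ipC f) ipBl// (ip_symmetric Wf Wg) (ipC f g2); congr (_ - _).
by apply: eq_RintegralT => x; ring.
Qed.

Lemma form_le_bound : form_le B.
Proof.
move=> f f1 f2 W; have [_ _ l0 l1 lf2] := W; have [lQ nQ] := L2_potential_mul P l0.
rewrite ipBl// (ip_second_derivative W).
have := cauchy_schwarz lQ l0; rewrite ler_norml => /andP[h _].
have : nrm (fun x => Q x * f x) * nrm f <= B * nrm f * nrm f by rewrite ler_wpM2r ?nrm_ge0.
by have := sqr_ge0 (nrm f1); rewrite !expr2; lra.
Qed.

(* Cauchy--Schwarz for the positive form [m - A], applied to [f] and [(m - A)^-1 f]. *)
Lemma form_le_gap (m K : R) : right_inverse (fun x => Q x + m) K -> form_le m ->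
  exists2 c, 0 < c & form_le (m - c).
Proof.
move=> inv fm; pose c := (`|K| + 1)^-1.
have k1 : 0 < `|K| + 1 by rewrite ltr_wpDl.
have c0 : 0 < c by rewrite invr_gt0.
exists c => // f f1 f2 W; have [_ _ l0 l1 lf2] := W.
have [g [g1 [g2 [Wg eg ng]]]] := inv _ (L2N l0); rewrite nrmN// in ng.
have [_ _ m0 m1 mg2] := Wg.
have lAf := L2_operator W; have lAg := L2_operator Wg.
have Eg : {ae mu, forall x, g2 x - Q x * g x = m * g x - f x}.
  by apply: filterS eg => x; lra.
have lmg := L2B (L2Z m m0) l0.
have ipA h : l2 h -> ip (fun x => g2 x - Q x * g x) h = m * ip g h - ip f h.
  by move=> lh; rewrite (ip_ae lAg lmg lh Eg) ipBl//; [rewrite ipZl//|exact: L2Z].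
pose q := m * nrm f ^+ 2 - ip (fun x => f2 x - Q x * f x) f.
(* As (m - A) g = f, the form of m - A at f + t g is q + 2 t ||f||^2 + t^2 <f, g>. *)
have key : (nrm f ^+ 2) ^+ 2 <= q * ip f g.
  apply: quadratic_ge0_discr => t.
  have Wt := W2D W (W2Z t Wg); have := fm _ _ _ Wt.
  have -> : (fun x => f2 x + t * g2 x - Q x * (f x + t * g x)) =
     (fun x => (f2 x - Q x * f x) + t * (g2 x - Q x * g x)).
    by apply/funext => x; ring.
  have lt := L2Z t m0; have ltA := L2Z t lAg; have [_ _ lft _ _] := Wt.
  rewrite (nrm_sqr lft) ip_add_scale// ipDl// ipZl//.
  rewrite (ipC _ (fun x => f x + t * g x)) ipDl// ipZl// (ipC _ (fun x => f x + t * g x)) ipDl// ipZl//.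
  rewrite (ipC f (fun x => f2 x - _)) (ipC g (fun x => f2 x - _)) (operator_symmetric W Wg).
  rewrite (ipC f (fun x => g2 x - _)) (ipC g (fun x => g2 x - _)) !ipA// (ipC g f) /q !nrm_sqr//.
  lra.
have q0 : 0 <= q by rewrite subr_ge0; exact: fm W.
have := cauchy_schwarz l0 m0; rewrite ler_norml => /andP[_ cs].
have n0 := nrm_ge0 f; have ng0 := nrm_ge0 g.
have ng' : nrm g <= (`|K| + 1) * nrm f.
  by apply: le_trans ng _; rewrite ler_wpM2r// (le_trans (ler_norm K))// lerDl.
have [f0|f0] := eqVneq (nrm f) 0.
  by have := fm _ _ _ W; rewrite f0 expr0n/= !mulr0.
have fp : 0 < nrm f by rewrite lt0r f0.
have h1 : (nrm f ^+ 2) ^+ 2 <= q * (nrm f * ((`|K| + 1) * nrm f)).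
  apply: le_trans key _; rewrite ler_wpM2l//; apply: le_trans cs _.
  by rewrite ler_wpM2l.
have h2 : nrm f ^+ 2 <= q * (`|K| + 1).
  rewrite -(@ler_pM2r _ (nrm f ^+ 2)) ?exprn_gt0//.
  by rewrite -expr2; apply: le_trans h1 _; rewrite le_eqVlt; apply/orP; left; apply/eqP; ring.
have : c * nrm f ^+ 2 <= q by rewrite mulrC ler_pdivrMr.
by rewrite /q mulrBl; lra.
Qed.

Lemma form_le_mono m m' : m <= m' -> form_le m -> form_le m'.
Proof.
move=> mm H f f1 f2 W; apply: le_trans (H _ _ _ W) _.
by rewrite ler_wpM2r ?sqr_ge0.
Qed.

(** If m1 were not an upper bound of the form, the infimum of all upper bounds would lie in [m1, M].
    It is attained, and [form_le_gap] would lower it. *)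
Lemma form_le_of_inverses (M m1 : R) : form_le M ->
  (forall m, m1 <= m <= M -> exists K, right_inverse (fun x => Q x + m) K) -> form_le m1.
Proof.
move=> HM inv; have [Mm|mM] := leP M m1; first exact: form_le_mono HM.
apply: contrapT => nm1.
pose S := [set m | form_le m].
have lb : lbound S m1.
  by move=> m Sm; rewrite leNgt; apply/negP => mm1; apply: nm1; exact: form_le_mono (ltW mm1) Sm.
have S0 : S !=set0 by exists M.
have hinf : has_inf S by split => //; exists m1.
have i1 : m1 <= inf S by exact: lb_le_inf.
have iM : inf S <= M by apply: ge_inf => //; exists m1.
have fi : form_le (inf S).
  move=> f f1 f2 W; have n0 := nrm_ge0 f.
  have [f0|f0] := eqVneq (nrm f) 0.
    by have := HM _ _ _ W; rewrite f0 expr0n/= !mulr0.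
  have fp : 0 < nrm f ^+ 2 by rewrite exprn_gt0// lt0r f0.
  rewrite -ler_pdivrMr//; apply: lb_le_inf => // m Sm.
  by rewrite ler_pdivrMr//; exact: Sm W.
have [|K inK] := inv (inf S); first by rewrite i1.
have [c c0 Hc] := form_le_gap inK fi.
have : inf S <= inf S - c by apply: ge_inf => //; exists m1.
lra.
Qed.

(** A surjective symmetric operator is injective: A d = 0 and d = A h give <d, d> = <h, A d> = 0.
    Thus f agrees with the solution furnished by the inverse and inherits its bound. *)
Lemma right_inverse_bound (K : R) f f1 f2 : right_inverse Q K -> W2 f f1 f2 ->
  nrm f <= K * nrm (fun x => f2 x - Q x * f x).
Proof.
move=> inv W; have lA := L2_operator W; have [_ _ l0 _ _] := W.
have [g [g1 [g2 [Wg eg ng]]]] := inv _ lA; have [_ _ m0 _ _] := Wg.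
have Wd := W2B W Wg; have [_ _ d0 _ _] := Wd.
have [h [h1 [h2 [Wh eh _]]]] := inv _ d0; have [_ _ h0 _ _] := Wh.
have dz : nrm (fun x => f x - g x) = 0.
  apply/eqP; rewrite -sqrf_eq0 nrm_sqr//; apply/eqP.
  rewrite -(ip_ae (L2_operator Wh) d0 d0 eh) ipC -(operator_symmetric Wd Wh).
  rewrite (ip_ae (L2_operator Wd) (@L2_zero R) h0) ?ip_zerol//.
  by apply: filterS eg => x; lra.
apply: le_trans ng.
have -> : nrm f = nrm (fun x => (f x - g x) + g x).
  by congr (L2norm _ _); apply/funext => x; rewrite subrK.
by apply: le_trans (nrmD d0 m0) _; rewrite dz add0r.
Qed.

(** Coercivity replaces the unknown constant [K], which may depend on m, by one that depends only on
    the gap. *)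
Lemma form_lt_right_inverse (m c K : R) : 0 < c -> form_le (m - c) ->
  right_inverse (fun x => Q x + m) K -> right_inverse (fun x => Q x + m) c^-1.
Proof.
move=> c0 fm inv w lw; have [g [g1 [g2 [Wg eg _]]]] := inv w lw.
exists g, g1, g2; split => //; have [_ _ m0 _ _] := Wg.
have := fm _ _ _ Wg.
have Eg : {ae mu, forall x, g2 x - Q x * g x = m * g x + w x}.
  by apply: filterS eg => x; lra.
have lmg := L2Z m m0.
rewrite (ip_ae (L2_operator Wg) (L2D lmg lw) m0 Eg) ipDl// ipZl// -nrm_sqr//.
have := cauchy_schwarz lw m0; rewrite ler_norml => /andP[cs _] h.
rewrite mulrC ler_pdivlMr//; have g0 := nrm_ge0 g; have w0 := nrm_ge0 w.
have [g00|g00] := eqVneq (nrm g) 0; first by rewrite g00 mul0r.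
have gp : 0 < nrm g by rewrite lt0r g00.
by rewrite -(ler_pM2r gp); move: h cs; rewrite expr2; lra.
Qed.

End QuadraticForms.

(** * Complex spectral parameters as real two-by-two systems *)

Section ComplexResolvent.
Variable R : realType.
Local Notation mu := (@lebesgue_measure R).
Local Notation C := R[i].
Implicit Types (f g Q : R -> R).

Variables (B : R) (Q : R -> R).
Hypothesis P : potential B Q.

(* Real and imaginary parts of the equation [(A - (a + i b)) h = w + i v]. *)
Definition pair_solvable (a b : R) := forall w v, l2 w -> l2 v ->
  exists s t : trip R, [/\ tW s, tW t,
    {ae mu, forall x, s.2 x - Q x * s.1.1 x - a * s.1.1 x + b * t.1.1 x = w x} &
    {ae mu, forall x, t.2 x - Q x * t.1.1 x - a * t.1.1 x - b * s.1.1 x = v x}].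

Let op1 (a b : R) (s t : trip R) : R -> R :=
  fun x => s.2 x - Q x * s.1.1 x - a * s.1.1 x + b * t.1.1 x.
Let op2 (a b : R) (s t : trip R) : R -> R :=
  fun x => t.2 x - Q x * t.1.1 x - a * t.1.1 x - b * s.1.1 x.

Let L2_op1 a b s t : tW s -> tW t -> l2 (op1 a b s t).
Proof.
move=> Ws Wt; have [_ _ s0 _ _] := Ws; have [_ _ t0 _ _] := Wt.
by apply: L2D; [apply: L2B; [exact: (L2_operator P Ws)|exact: L2Z]|exact: L2Z].
Qed.

Let L2_op2 a b s t : tW s -> tW t -> l2 (op2 a b s t).
Proof.
move=> Ws Wt; have [_ _ s0 _ _] := Ws; have [_ _ t0 _ _] := Wt.
by apply: L2B; [apply: L2B; [exact: (L2_operator P Wt)|exact: L2Z]|exact: L2Z].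
Qed.

(** Test the first equation with s and the second with t: the two coupling terms in b cancel in the
    sum, and what remains is coercive with constant a - m. *)
Lemma pair_bound (m a b : R) (s t : trip R) : m < a -> form_le Q m -> tW s -> tW t ->
  nrm s.1.1 + nrm t.1.1 <= 2 / (a - m) * (nrm (op1 a b s t) + nrm (op2 a b s t)).
Proof.
move=> ma fm Ws Wt; have [_ _ s0 _ _] := Ws; have [_ _ t0 _ _] := Wt.
have l1 := L2_op1 a b Ws Wt; have l2' := L2_op2 a b Ws Wt.
have lAs := L2_operator P Ws; have lAt := L2_operator P Wt.
have fs := fm _ _ _ Ws; have ft := fm _ _ _ Wt.
have e1 : ip (op1 a b s t) s.1.1 = ip (fun x => s.2 x - Q x * s.1.1 x) s.1.1
    - a * nrm s.1.1 ^+ 2 + b * ip t.1.1 s.1.1.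
  have las := L2Z a s0; have lbt := L2Z b t0.
  by rewrite /op1 (ipDl (L2B lAs las) lbt s0) (ipBl lAs las s0) !ipZl// nrm_sqr.
have e2 : ip (op2 a b s t) t.1.1 = ip (fun x => t.2 x - Q x * t.1.1 x) t.1.1
    - a * nrm t.1.1 ^+ 2 - b * ip t.1.1 s.1.1.
  have las := L2Z a t0; have lbt := L2Z b s0.
  by rewrite /op2 (ipBl (L2B lAt las) lbt t0) (ipBl lAt las t0) !ipZl// nrm_sqr// (ipC s.1.1).
have := cauchy_schwarz l1 s0; rewrite ler_norml => /andP[c1 _].
have := cauchy_schwarz l2' t0; rewrite ler_norml => /andP[c2 _].
rewrite e1 in c1; rewrite e2 in c2.
have n1 := nrm_ge0 s.1.1; have n2 := nrm_ge0 t.1.1.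
have n3 := nrm_ge0 (op1 a b s t); have n4 := nrm_ge0 (op2 a b s t).
move: (nrm s.1.1) (nrm t.1.1) (nrm (op1 a b s t)) (nrm (op2 a b s t)) n1 n2 n3 n4 fs ft c1 c2.
move=> x y u v x0 y0 u0 v0 fs ft c1 c2.
have am : 0 < a - m by rewrite subr_gt0.
rewrite mulrAC ler_pdivlMr//.
have k1 : (a - m) * (x ^+ 2 + y ^+ 2) <= u * x + v * y by lra.
have k2 : (a - m) * (x + y) ^+ 2 <= 2 * (u + v) * (x + y).
  have p1 : 0 <= u * y by exact: mulr_ge0.
  have p2 : 0 <= v * x by exact: mulr_ge0.
  have p3 : 0 <= (a - m) * (x - y) ^+ 2 by rewrite mulr_ge0 ?sqr_ge0// ltW.
  have p4 : (a - m) * (x - y) ^+ 2 = 2 * ((a - m) * (x ^+ 2 + y ^+ 2)) - (a - m) * (x + y) ^+ 2 by ring.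
  have p5 : 2 * (u + v) * (x + y) = 2 * (u * x + v * y) + 2 * (u * y) + 2 * (v * x) by ring.
  rewrite p5; lra.
have [xy0|xy0] := eqVneq (x + y) 0; first by rewrite xy0 mul0r mulr_ge0// addr_ge0.
have xyp : 0 < x + y by rewrite lt0r xy0 addr_ge0.
rewrite -(ler_pM2r xyp) (mulrC (x + y)); apply: le_trans k2.
by rewrite expr2 mulrA.
Qed.

(** The solution operator at (a, b) serves as approximate inverse at (a', b'). Its defect is at most
    2 d times the norm of the correction, hence 4 d / (a - m) times the residual, which is at most
    one half of it. *)
Lemma pair_continuation (m a b a' b' d : R) : m < a -> form_le Q m -> pair_solvable a b ->
  `|a' - a| <= d -> `|b' - b| <= d -> 8 * d <= a - m -> pair_solvable a' b'.
Proof.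
move=> ma fm solv da db small w v lw lv.
have am : 0 < a - m by rewrite subr_gt0.
have B0 := potential_ge0 P.
have d0 : 0 <= d by apply: le_trans da.
pose k := 2 / (a - m); have k0 : 0 <= k by rewrite divr_ge0// ltW.
pose X := (trip R * trip R)%type.
pose good (z : X) := tW z.1 /\ tW z.2.
pose dist (y z : X) := tdist y.1 z.1 + tdist y.2 z.2.
pose r1 (z : X) x := op1 a' b' z.1 z.2 x - w x.
pose r2 (z : X) x := op2 a' b' z.1 z.2 x - v x.
pose res (z : X) := nrm (r1 z) + nrm (r2 z).
have lr1 z : good z -> l2 (r1 z) by move=> [? ?]; apply: L2B => //; exact: L2_op1.
have lr2 z : good z -> l2 (r2 z) by move=> [? ?]; apply: L2B => //; exact: L2_op2.
pose z0 : trip R := ((fun=> 0), (fun=> 0), (fun=> 0)).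
have Wz : tW z0 by exact: W2_zero.
(* [D] dominates the coefficients at both parameters: those at (a', b') for the Lipschitz bound of
   the residual, those at (a, b) for recovering second derivatives from the equations. *)
pose D := B + (`|a| + `|b| + `|a'| + `|b'|).
have D0 : 0 <= D by rewrite !addr_ge0.
have nW (s : trip R) : tW s -> Wnorm s.1.1 s.1.2 s.2 <= 2 * (nrm s.1.1 + nrm s.2).
  move=> Ws; have := nrm_derivative Ws; rewrite /Wnorm.
  have n1 := nrm_ge0 s.1.1; have n2 := nrm_ge0 s.2 => h.
  have : nrm s.1.2 <= nrm s.1.1 + nrm s.2 by apply: le_sqrt_of_sqr; nra.
  lra.
pose sub (s t : trip R) : trip R := ((fun x => s.1.1 x - t.1.1 x), (fun x => s.1.2 x - t.1.2 x), (fun x => s.2 x - t.2 x)).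
pose add (s t : trip R) : trip R := ((fun x => s.1.1 x + t.1.1 x), (fun x => s.1.2 x + t.1.2 x), (fun x => s.2 x + t.2 x)).
have Wsub s t : tW s -> tW t -> tW (sub s t) by exact: W2B.
have Wadd s t : tW s -> tW t -> tW (add s t) by exact: W2D.
have nop (e c : R) (s t : trip R) : tW s -> tW t ->
    nrm (op1 e c s t) <= nrm s.2 + (B + `|e|) * nrm s.1.1 + `|c| * nrm t.1.1 /\
    nrm (op2 e c s t) <= nrm t.2 + (B + `|e|) * nrm t.1.1 + `|c| * nrm s.1.1.
  move=> Ws Wt; have [_ _ s0 _ s2] := Ws; have [_ _ t0 _ t2] := Wt.
  have [qs nqs] := L2_potential_mul P s0; have [qt nqt] := L2_potential_mul P t0.
  have := nrmZ e s0; have := nrmZ e t0; have := nrmZ c s0; have := nrmZ c t0.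
  have les := L2Z e s0; have let_ := L2Z e t0; have lcs := L2Z c s0; have lct := L2Z c t0.
  move=> z1 z2 z3 z4; split.
    have := nrmD (L2B (L2B s2 qs) les) lct; have := nrmB (L2B s2 qs) les; have := nrmB s2 qs.
    by rewrite /op1; clear -z1 z2 z3 z4 nqs nqt; lra.
  have := nrmB (L2B (L2B t2 qt) let_) lcs; have := nrmB (L2B t2 qt) let_; have := nrmB t2 qt.
  by rewrite /op2; clear -z1 z2 z3 z4 nqs nqt; lra.
have comp (s : trip R) : [/\ nrm s.1.1 <= Wnorm s.1.1 s.1.2 s.2, nrm s.2 <= Wnorm s.1.1 s.1.2 s.2 & 0 <= Wnorm s.1.1 s.1.2 s.2].
  rewrite /Wnorm; have := nrm_ge0 s.1.1; have := nrm_ge0 s.1.2; have := nrm_ge0 s.2.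
  by split; lra.
have a0 := normr_ge0 a; have b0 := normr_ge0 b; have a0' := normr_ge0 a'; have b0' := normr_ge0 b'.
(* The correction has norm at most k res, its second derivatives at most (1 + D k) res, and [nW]
   covers the first derivatives. The factor 12 is 6 from [tdist_complete] for each of the two
   components. *)
have [z [[g1 g2] rz _]] : exists z : X, [/\ good z, res z = 0 & dist (z0, z0) z <= 12 * (4 * (1 + k + D * k)) * res (z0, z0)].
  apply: (@newton_iteration R X (z0, z0) good dist res (4 * (1 + k + D * k)) (1 + D) 12) => //.
  - by rewrite mulr_ge0// !addr_ge0// mulr_ge0.
  - by rewrite addr_ge0.
  - by move=> y; rewrite /dist !tdist_refl addr0.
  - move=> x y y' [x1 x2] [y1 y2] [u1 u2]; rewrite /dist.
    by have := tdist_triangle x1 y1 u1; have := tdist_triangle x2 y2 u2; lra.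
  - by move=> x; rewrite addr_ge0 ?nrm_ge0.
  - move=> s c c0 gs hs.
    have [|x1 [W1 H1]] := @tdist_complete R (fun k => (s k).1) c c0 (fun k => (gs k).1).
      by move=> j; apply: le_trans (hs j); rewrite lerDl; exact: Wnorm_ge0.
    have [|x2 [W2' H2]] := @tdist_complete R (fun k => (s k).2) c c0 (fun k => (gs k).2).
      by move=> j; apply: le_trans (hs j); rewrite lerDr; exact: Wnorm_ge0.
    exists (x1, x2); split => // j; have := H1 j; have := H2 j; rewrite /dist /=; clear -c; lra.
  - move=> x y gx gy; have [x1 x2] := gx; have [y1 y2] := gy.
    have w1 := Wsub _ _ y1 x1; have w2 := Wsub _ _ y2 x2.
    have [v1 v2] := nop a' b' _ _ w1 w2.
    have [c1 c2 c3] := comp (sub y.1 x.1); have [e1 e2 e3] := comp (sub y.2 x.2).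
    have E1 : nrm (r1 y) <= nrm (r1 x) + nrm (op1 a' b' (sub y.1 x.1) (sub y.2 x.2)).
      have -> : r1 y = (fun s => r1 x s + op1 a' b' (sub y.1 x.1) (sub y.2 x.2) s).
        by apply/funext => s; rewrite /r1 /op1 /sub /=; ring.
      by apply: nrmD; [exact: lr1|exact: L2_op1].
    have E2 : nrm (r2 y) <= nrm (r2 x) + nrm (op2 a' b' (sub y.1 x.1) (sub y.2 x.2)).
      have -> : r2 y = (fun s => r2 x s + op2 a' b' (sub y.1 x.1) (sub y.2 x.2) s).
        by apply/funext => s; rewrite /r2 /op2 /sub /=; ring.
      by apply: nrmD; [exact: lr2|exact: L2_op2].
    have -> : dist x y = Wnorm (sub y.1 x.1).1.1 (sub y.1 x.1).1.2 (sub y.1 x.1).2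
       + Wnorm (sub y.2 x.2).1.1 (sub y.2 x.2).1.2 (sub y.2 x.2).2 by [].
    move: v1 v2 c1 c2 c3 e1 e2 e3 E1 E2.
    move: (sub y.1 x.1) (sub y.2 x.2) => s1 s2.
    rewrite /res; move: (Wnorm s1.1.1 s1.1.2 s1.2) (Wnorm s2.1.1 s2.1.2 s2.2) (nrm s1.1.1) (nrm s2.1.1) (nrm s1.2) (nrm s2.2).
    move=> W V u0 v0 u2 v2 h1 h2 c1 c2 c3 e1 e2 e3 E1 E2.
    have q1 : (B + `|a'|) * u0 <= (B + `|a'|) * W by rewrite ler_wpM2l// addr_ge0.
    have q2 : (B + `|a'|) * v0 <= (B + `|a'|) * V by rewrite ler_wpM2l// addr_ge0.
    have q3 : `|b'| * u0 <= `|b'| * W by rewrite ler_wpM2l.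
    have q4 : `|b'| * v0 <= `|b'| * V by rewrite ler_wpM2l.
    have q5 : 0 <= (`|a| + `|b|) * (W + V) by rewrite mulr_ge0 ?addr_ge0.
    by rewrite /D; clear -q1 q2 q3 q4 q5 h1 h2 c1 c2 c3 e1 e2 e3 E1 E2; lra.
  - move=> x gx _ _; have [x1 x2] := gx.
    have L1 := lr1 _ gx; have L2' := lr2 _ gx.
    have [p [q [Wp Wq ep eq]]] := solv _ _ (L2N L1) (L2N L2').
    have lo1 := L2_op1 a b Wp Wq; have lo2 := L2_op2 a b Wp Wq.
    have pb := pair_bound b ma fm Wp Wq.
    have n1 : nrm (op1 a b p q) = nrm (r1 x) by rewrite -(nrmN L1); apply: nrm_ae => //; exact: L2N.
    have n2 : nrm (op2 a b p q) = nrm (r2 x) by rewrite -(nrmN L2'); apply: nrm_ae => //; exact: L2N.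
    rewrite n1 n2 -/k -/(res x) in pb.
    have [_ _ p0 p1 p2] := Wp; have [_ _ q0 q1 q2] := Wq.
    have P0 := nrm_ge0 p.1.1; have Q0 := nrm_ge0 q.1.1.
    have R1 := nrm_ge0 (r1 x); have R2 := nrm_ge0 (r2 x).
    exists (add x.1 p, add x.2 q); split; first by split; exact: Wadd.
    + have nWp := nW _ Wp; have nWq := nW _ Wq.
      have -> : dist x (add x.1 p, add x.2 q) = Wnorm p.1.1 p.1.2 p.2 + Wnorm q.1.1 q.1.2 q.2.
        have E (f g : R -> R) : (fun s => f s + g s - f s) = g by apply/funext => s; ring.
        by rewrite /dist /tdist /add /= !E.
      have np2 : nrm p.2 <= nrm (r1 x) + (B + `|a|) * nrm p.1.1 + `|b| * nrm q.1.1.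
        rewrite -n1; have [qp nqp] := L2_potential_mul P p0.
        have lap := L2Z a p0; have lbq := L2Z b q0.
        have -> : nrm p.2 = nrm (fun s => (op1 a b p q s + Q s * p.1.1 s + a * p.1.1 s) - b * q.1.1 s).
          by congr (L2norm _ _); apply/funext => s; rewrite /op1; ring.
        have := nrmB (L2D (L2D lo1 qp) lap) lbq; have := nrmD (L2D lo1 qp) lap; have := nrmD lo1 qp.
        by rewrite (nrmZ a p0) (nrmZ b q0); clear -nqp; lra.
      have nq2 : nrm q.2 <= nrm (r2 x) + (B + `|a|) * nrm q.1.1 + `|b| * nrm p.1.1.
        rewrite -n2; have [qp nqp] := L2_potential_mul P q0.
        have lap := L2Z a q0; have lbq := L2Z b p0.
        have -> : nrm q.2 = nrm (fun s => (op2 a b p q s + Q s * q.1.1 s + a * q.1.1 s) + b * p.1.1 s).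
          by congr (L2norm _ _); apply/funext => s; rewrite /op2; ring.
        have := nrmD (L2D (L2D lo2 qp) lap) lbq; have := nrmD (L2D lo2 qp) lap; have := nrmD lo2 qp.
        by rewrite (nrmZ a q0) (nrmZ b p0); clear -nqp; lra.
      have h1 : (B + `|a| + `|b|) * (nrm p.1.1 + nrm q.1.1) <= D * (k * res x).
        apply: le_trans (_ : D * (nrm p.1.1 + nrm q.1.1) <= _); last by rewrite ler_wpM2l.
        by rewrite ler_wpM2r ?addr_ge0// /D; clear -a0' b0'; lra.
      have z1 : 0 <= res x by rewrite addr_ge0.
      have z2 : 0 <= k * res x by rewrite mulr_ge0.
      have z3 : 0 <= D * (k * res x) by rewrite mulr_ge0.
      have z4 : nrm (r1 x) + nrm (r2 x) = res x by [].
      clearbody D k res; clear nop comp small da db R1 R2.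
      move: (Wnorm p.1.1 p.1.2 p.2) (Wnorm q.1.1 q.1.2 q.2) (nrm p.1.1) (nrm p.2) (nrm q.1.1) (nrm q.2) nWp nWq np2 nq2 h1 pb.
      by move=> *; lra.
    + have y1 : nrm (r1 (add x.1 p, add x.2 q)) <= d * (nrm p.1.1 + nrm q.1.1).
        have lp := L2Z (- (a' - a)) p0; have lq := L2Z (b' - b) q0.
        have -> : nrm (r1 (add x.1 p, add x.2 q)) = nrm (fun s => - (a' - a) * p.1.1 s + (b' - b) * q.1.1 s).
          apply: nrm_ae; [by apply: lr1; split; exact: Wadd|exact: L2D|].
          by apply: filterS ep => s; rewrite /r1 /op1 /add /=; clear -w; lra.
        apply: le_trans (nrmD lp lq) _; rewrite (nrmZ _ p0) (nrmZ _ q0) normrN mulrDr.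
        by apply: lerD; rewrite ler_wpM2r.
      have y2 : nrm (r2 (add x.1 p, add x.2 q)) <= d * (nrm p.1.1 + nrm q.1.1).
        have lp := L2Z (- (a' - a)) q0; have lq := L2Z (- (b' - b)) p0.
        have -> : nrm (r2 (add x.1 p, add x.2 q)) = nrm (fun s => - (a' - a) * q.1.1 s + - (b' - b) * p.1.1 s).
          apply: nrm_ae; [by apply: lr2; split; exact: Wadd|exact: L2D|].
          by apply: filterS eq => s; rewrite /r2 /op2 /add /=; clear -v; lra.
        apply: le_trans (nrmD lp lq) _; rewrite (nrmZ _ q0) (nrmZ _ p0) !normrN addrC mulrDr.
        by apply: lerD; rewrite ler_wpM2r.
      have h2 : d * (nrm p.1.1 + nrm q.1.1) <= d * (k * res x) by rewrite ler_wpM2l.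
      have h3 : 4 * (d * (k * res x)) <= res x.
        have -> : 4 * (d * (k * res x)) = 8 * d / (a - m) * res x by rewrite /k; field; rewrite gt_eqF.
        by rewrite ler_piMl ?addr_ge0// ler_pdivrMr// mul1r.
      by rewrite /res in h2 h3 *; clear -y1 y2 h2 h3; lra.
have R1 := nrm_ge0 (r1 z); have R2 := nrm_ge0 (r2 z); rewrite /res in rz.
exists z.1, z.2; split => //.
- have /(nrm_eq0_ae (lr1 z (conj g1 g2))) : nrm (r1 z) = 0 by lra.
  by apply: filterS => s /eqP; rewrite /r1 subr_eq0 => /eqP.
- have /(nrm_eq0_ae (lr2 z (conj g1 g2))) : nrm (r2 z) = 0 by lra.
  by apply: filterS => s /eqP; rewrite /r2 subr_eq0 => /eqP.
Qed.

(** Method of continuity along the segment from 0 to a + i b. Its real parts stay at distance at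
    least min(-m, a - m) above m, so finitely many equal steps suffice. *)
Lemma pair_solvable_all (m a b : R) : m < 0 -> m < a -> form_le Q m -> pair_solvable 0 0 ->
  pair_solvable a b.
Proof.
move=> m0 ma fm s0.
pose k := Num.min (- m) (a - m).
have k0 : 0 < k by rewrite lt_min; apply/andP; split; lra.
pose D := `|a| + `|b| + 1.
have D0 : 0 < D by rewrite ltr_wpDl// addr_ge0.
have [n hn] : exists n : nat, 8 * D / k < n.+1%:R.
  exists (Num.bound (8 * D / k)); apply: (@lt_trans _ _ (Num.bound (8 * D / k))%:R).
    by apply: archi_boundP; rewrite divr_ge0 ?ltW// mulr_gt0.
  by rewrite ltr_nat.
pose N : R := n.+1%:R.
have N0 : 0 < N by rewrite ltr0n.
suff H i : (i <= n.+1)%N -> pair_solvable (i%:R / N * a) (i%:R / N * b).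
  by have := H n.+1 (leqnn _); rewrite divff ?gt_eqF// !mul1r.
elim: i => [_|i IH iN]; first by rewrite !mul0r.
have iN0 : 0 <= i%:R / N by rewrite divr_ge0// ltW.
have iN1 : i%:R / N <= 1 by rewrite ler_pdivrMr// mul1r ler_nat ltnW.
have km : k <= - m by rewrite ge_min lexx.
have ka : k <= a - m by rewrite ge_min lexx orbT.
have ki : k <= i%:R / N * a - m.
  move: iN0 iN1; move: (i%:R / N) => t t0 t1.
  have p1 : 0 <= t * (a - m - k) by rewrite mulr_ge0// subr_ge0.
  have p2 : 0 <= (1 - t) * (- m - k) by rewrite mulr_ge0// subr_ge0.
  lra.
have step c : `|c| <= D -> `|i.+1%:R / N * c - i%:R / N * c| <= D / N.
  move=> cD; rewrite -mulrBl -mulrBl -natrB// subSnn mul1r mulrC normrM.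
  by rewrite (gtr0_norm (_ : 0 < N^-1)) ?invr_gt0// ler_wpM2r// invr_ge0 ltW.
apply: (@pair_continuation m (i%:R / N * a) (i%:R / N * b) _ _ (D / N)) => //.
- by rewrite -subr_gt0; exact: lt_le_trans ki.
- by apply: IH; exact: ltnW.
- by apply: step; rewrite /D; have := normr_ge0 b; lra.
- by apply: step; rewrite /D; have := normr_ge0 a; lra.
- apply: le_trans ki; rewrite mulrA ler_pdivrMr// [k * _]mulrC -ler_pdivrMr//; exact: ltW.
Qed.

End ComplexResolvent.

Section Interface.
Variable R : realType.
Local Notation mu := (@lebesgue_measure R).
Local Notation C := R[i].
Implicit Types (f g V u w : R -> R) (h : R -> C).

Definition linearized V eps u : R -> R := fun x => cos (u x) - eps * V x.

Lemma L_op_sub V eps u h (lam : C) x :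
  let Q := linearized V eps u in let a := complex.Re lam in let b := complex.Im lam in
  let f := re h in let g := im h in
  let f2 := weak_derivative (weak_derivative f) in
  let g2 := weak_derivative (weak_derivative g) in
  L_op V eps u h x - lam * h x =
  Complex (f2 x - Q x * f x - a * f x + b * g x) (g2 x - Q x * g x - a * g x - b * f x).
Proof.
move=> Q a b f g f2 g2; rewrite /L_op /weak_second_derivative -/f -/g -/f2 -/g2 {}/a {}/b.
have -> : h x = Complex (f x) (g x) by rewrite /f /g /re /im; case: (h x).
rewrite {}/Q /linearized; case: lam => a b /=; simpc.
by congr Complex; ring.
Qed.

Lemma re_L_op_sub V eps u h (lam : C) :
  re (fun x => L_op V eps u h x - lam * h x) =
  (fun x => weak_derivative (weak_derivative (re h)) x - linearized V eps u x * re h x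
    - complex.Re lam * re h x + complex.Im lam * im h x).
Proof. by apply/funext => x; exact: (congr1 (@complex.Re R) (L_op_sub V eps u h lam x)). Qed.

Lemma im_L_op_sub V eps u h (lam : C) :
  im (fun x => L_op V eps u h x - lam * h x) =
  (fun x => weak_derivative (weak_derivative (im h)) x - linearized V eps u x * im h x
    - complex.Re lam * im h x - complex.Im lam * re h x).
Proof. by apply/funext => x; exact: (congr1 (@complex.Im R) (L_op_sub V eps u h lam x)). Qed.

Lemma sqrt_sqr_le (x y : R) : 0 <= x -> 0 <= y -> Num.sqrt (x ^+ 2 + y ^+ 2) <= x + y.
Proof.
move=> x0 y0; rewrite -(@ger0_norm _ (x + y)) ?addr_ge0// -sqrtr_sqr ler_wsqrtr//.
by have := mulr_ge0 x0 y0; rewrite !expr2; lra.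
Qed.

Lemma sqrt_sqr_ge (x y : R) : 0 <= x -> 0 <= y -> x + y <= 2 * Num.sqrt (x ^+ 2 + y ^+ 2).
Proof.
move=> x0 y0.
have hx : x <= Num.sqrt (x ^+ 2 + y ^+ 2).
  by rewrite -{1}(ger0_norm x0) -sqrtr_sqr ler_wsqrtr// lerDl sqr_ge0.
have hy : y <= Num.sqrt (x ^+ 2 + y ^+ 2).
  by rewrite -{1}(ger0_norm y0) -sqrtr_sqr ler_wsqrtr// lerDr sqr_ge0.
lra.
Qed.

Lemma ae_complex0 h : {ae mu, forall x, h x = 0} <->
  {ae mu, forall x, re h x = 0} /\ {ae mu, forall x, im h x = 0}.
Proof.
split => [H|[H1 H2]].
  by split; apply: filterS H => x; rewrite /re /im => ->.
by apply: filterS2 H1 H2 => x; rewrite /re /im; case: (h x) => a b /= -> ->.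
Qed.

Lemma L2_L_op_sub B V eps u h (lam : C) : potential B (linearized V eps u) -> cH2 h ->
  l2 (re (fun x => L_op V eps u h x - lam * h x)) /\
  l2 (im (fun x => L_op V eps u h x - lam * h x)).
Proof.
move=> P [/H2_W2 Wf /H2_W2 Wg]; rewrite re_L_op_sub im_L_op_sub.
have [_ _ lf _ _] := Wf; have [_ _ lg _ _] := Wg; split.
  by apply: L2D; [apply: L2B; [exact: (L2_operator P Wf)|exact: L2Z]|exact: L2Z].
by apply: L2B; [apply: L2B; [exact: (L2_operator P Wg)|exact: L2Z]|exact: L2Z].
Qed.

Lemma nrm_ae0 f : l2 f -> {ae mu, forall x, f x = 0} -> nrm f = 0.
Proof. by move=> lf e; rewrite (nrm_ae lf (@L2_zero R) e) nrm_zero. Qed.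

Lemma resolvent_of_pair B V eps u (lam : C) (c : R) :
  let Q := linearized V eps u in let a := complex.Re lam in let b := complex.Im lam in
  potential B Q -> 0 <= c -> pair_solvable Q a b ->
  (forall s t : trip R, tW s -> tW t -> nrm s.1.1 + nrm t.1.1 <=
    c * (nrm (fun x => s.2 x - Q x * s.1.1 x - a * s.1.1 x + b * t.1.1 x) +
         nrm (fun x => t.2 x - Q x * t.1.1 x - a * t.1.1 x - b * s.1.1 x))) ->
  resolvent_set (L_op V eps u) lam.
Proof.
move=> Q a b P c0 solv bd.
have bdc h : cH2 h -> nrm (re h) + nrm (im h) <=
    c * (nrm (re (fun x => L_op V eps u h x - lam * h x)) +
         nrm (im (fun x => L_op V eps u h x - lam * h x))).
  move=> [/H2_W2 hf /H2_W2 hg]; rewrite re_L_op_sub im_L_op_sub.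
  exact: (bd (_, _, _) (_, _, _) hf hg).
split.
- move=> w [lf lg]; have [s [t [Ws Wt es et]]] := solv _ _ lf lg.
  have [Hs s1 s2] := W2_weak_derivative Ws; have [Ht t1 t2] := W2_weak_derivative Wt.
  exists (fun x => Complex (s.1.1 x) (t.1.1 x)); split; first exact: (conj Hs Ht).
  have H : {ae mu, forall x, weak_derivative (weak_derivative s.1.1) x = s.2 x /\
      weak_derivative (weak_derivative t.1.1) x = t.2 x} by apply: filterS2 s2 t2.
  have {}es : {ae mu, forall x, s.2 x - Q x * s.1.1 x - a * s.1.1 x + b * t.1.1 x = re w x /\
      t.2 x - Q x * t.1.1 x - a * t.1.1 x - b * s.1.1 x = im w x} by apply: filterS2 es et.
  apply: filterS2 H es => x [h1 h2] [h3 h4]; rewrite L_op_sub.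
  rewrite /re /im /= -/(re w x) -/(im w x) in h3 h4 *.
  have -> : w x = Complex (re w x) (im w x) by rewrite /re /im; case: (w x).
  by rewrite -h3 -h4 -h1 -h2.
- move=> h Hh e; have n0 : nrm (re h) + nrm (im h) <= 0.
    apply: le_trans (bdc _ Hh) _.
    have /ae_complex0[e1 e2] := e.
    have [l1 l2'] := L2_L_op_sub lam P Hh.
    by rewrite (nrm_ae0 l1 e1) (nrm_ae0 l2' e2) addr0 mulr0.
  have := nrm_ge0 (re h); have := nrm_ge0 (im h) => n1 n2.
  have [[_ _ l1 _ _] [_ _ m1 _ _]] := Hh.
  by apply/ae_complex0; split; apply: nrm_eq0_ae => //; lra.
- exists (2 * c) => h Hh; rewrite /cL2norm.
  apply: le_trans (sqrt_sqr_le (nrm_ge0 _) (nrm_ge0 _)) _.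
  apply: le_trans (bdc _ Hh) _; rewrite [2 * c]mulrC -mulrA ler_wpM2l//.
  by apply: sqrt_sqr_ge; exact: nrm_ge0.
Qed.

(** For a real spectral parameter and a real right-hand side, the real part of the complex solution
    solves the real equation. *)
Lemma resolvent_right_inverse B V eps u (m : R) : potential B (linearized V eps u) ->
  resolvent_set (L_op V eps u) m%:C%C ->
  exists K, right_inverse (fun x => linearized V eps u x + m) K.
Proof.
move=> P [surj _ [K bd]]; exists `|K| => w lw.
have [|h [Hh e]] := surj (fun x => (w x)%:C%C).
  by split => //; exact: L2_zero.
have [/H2_W2 Wf Wg] := Hh.
exists (re h), (weak_derivative (re h)), (weak_derivative (weak_derivative (re h))).
split => //.
  apply: filterS e => x; rewrite L_op_sub => /(congr1 (@complex.Re R)) /= <-.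
  by rewrite mul0r addr0; ring.
have n0 := nrm_ge0 (re h).
apply: le_trans (_ : cL2norm h <= _).
  by rewrite -{1}(ger0_norm n0) -sqrtr_sqr ler_wsqrtr// lerDl sqr_ge0.
apply: le_trans (bd _ Hh) _.
have [l1 l2'] := L2_L_op_sub m%:C%C P Hh.
rewrite /cL2norm (nrm_ae0 l2'); last by apply: filterS e => x; rewrite /im => ->.
rewrite expr0n/= addr0 sqrtr_sqr ger0_norm ?nrm_ge0//.
rewrite (nrm_ae l1 lw); last by apply: filterS e => x; rewrite /re => ->.
by rewrite ler_wpM2r ?nrm_ge0// ler_norm.
Qed.

Lemma pair_solvable0 Q (K : R) : right_inverse Q K -> pair_solvable Q 0 0.
Proof.
move=> inv w v lw lv; have [f [f1 [f2 [Wf ef _]]]] := inv w lw.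
have [g [g1 [g2 [Wg eg _]]]] := inv v lv.
exists (f, f1, f2), (g, g1, g2); split => //.
  by apply: filterS ef => x <- /=; ring.
by apply: filterS eg => x <- /=; ring.
Qed.

Lemma nondegenerate_of_right_inverse B V eps u (K : R) :
  potential B (linearized V eps u) -> right_inverse (linearized V eps u) K ->
  nondegenerate_state V eps u.
Proof.
move=> P inv; apply: (@resolvent_of_pair B _ _ _ _ `|K|) => //=.
  exact: pair_solvable0 inv.
move=> s t Ws Wt; have b1 := right_inverse_bound P inv Ws; have b2 := right_inverse_bound P inv Wt.
have -> : (fun x => s.2 x - linearized V eps u x * s.1.1 x - 0 * s.1.1 x + 0 * t.1.1 x) =
    (fun x => s.2 x - linearized V eps u x * s.1.1 x) by apply/funext => x; ring.
have -> : (fun x => t.2 x - linearized V eps u x * t.1.1 x - 0 * t.1.1 x - 0 * s.1.1 x) =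
    (fun x => t.2 x - linearized V eps u x * t.1.1 x) by apply/funext => x; ring.
rewrite mulrDr; apply: lerD.
  by apply: le_trans b1 _; rewrite ler_wpM2r ?nrm_ge0// ler_norm.
by apply: le_trans b2 _; rewrite ler_wpM2r ?nrm_ge0// ler_norm.
Qed.

Lemma resolvent_of_form B V eps u (K m : R) (lam : C) :
  potential B (linearized V eps u) -> right_inverse (linearized V eps u) K ->
  m < 0 -> form_le (linearized V eps u) m -> m < complex.Re lam ->
  resolvent_set (L_op V eps u) lam.
Proof.
move=> P inv m0 fm ml.
apply: (@resolvent_of_pair B _ _ _ _ (2 / (complex.Re lam - m))) => //.
- by rewrite divr_ge0// subr_ge0 ltW.
- by apply: (pair_solvable_all P _ m0 ml fm); exact: pair_solvable0 inv.
- by move=> s t Ws Wt; exact: (pair_bound P _ ml fm Ws Wt).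
Qed.

End Interface.

(** * Transfer of invertibility, stability and instability to glued potentials *)

Section Perturbation.
Variable R : realType.
Local Notation mu := (@lebesgue_measure R).
Local Notation C := R[i].
Implicit Types (f g V u w Q : R -> R) (h : R -> C).

Lemma right_inverse_shift Q (K c : R) : right_inverse Q K -> right_inverse (fun x => Q (x - c)) K.
Proof.
move=> inv w lw; have [f [f1 [f2 [W e n]]]] := inv _ (L2_shift c lw).
exists (fun x => f (x - c)), (fun x => f1 (x - c)), (fun x => f2 (x - c)); split.
- exact: W2_shift.
- by have := ae_shift (- c) e; apply: filterS => x ->; rewrite subrK.
- have [_ _ lf _ _] := W; rewrite nrm_shift//; move: n; rewrite nrm_shift//.
Qed.

Lemma potential_shift (B : R) Q (c : R) : potential B Q -> potential B (fun x => Q (x - c)).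
Proof.
move=> [mQ bQ]; split => //; apply: measurableT_comp => //.
by apply: measurable_funB => //; exact: measurable_cst.
Qed.

Lemma potentialD (B m b : R) Q : potential B Q -> `|m| <= b -> potential (B + b) (fun x => Q x + m).
Proof.
move=> [mQ bQ] mb; split.
  by apply: measurable_funD => //; exact: measurable_cst.
by move=> x; apply: le_trans (ler_normD _ _) _; apply: lerD.
Qed.

(** The single parameter [d] measures all that must be small in [parametrix]: the variation of the
    partition and the distance of the potentials where [p j] does not vanish. *)
Definition locally_close (M : nat) (C d : R) Q (Qj : 'I_M -> R -> R) :=
  exists p p1 p2 : 'I_M -> R -> R,
  [/\ forall j (x : R), is_derive x 1 (p j) (p1 j x),
      forall j (x : R), is_derive x 1 (p1 j) (p2 j x),
      forall j, continuous (p2 j),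
      forall j x, [/\ `|p j x| <= C, `|p1 j x| <= d & `|p2 j x| <= d] &
      (forall x, \sum_j p j x = 1) /\ forall j x, p j x != 0 -> `|Q x - Qj j x| <= d].

Lemma locally_close_le (M : nat) (C d d' : R) Q (Qj : 'I_M -> R -> R) : d <= d' ->
  locally_close C d Q Qj -> locally_close C d' Q Qj.
Proof.
move=> dd [p [p1 [p2 [h1 h2 h3 h4 [h5 h6]]]]]; exists p, p1, p2; split => //.
  by move=> j x; have [b0 b1 b2] := h4 j x; split => //; exact: le_trans dd.
by split => // j x /h6 /le_trans; apply.
Qed.

Lemma locally_closeD (M : nat) (C d m : R) Q (Qj : 'I_M -> R -> R) :
  locally_close C d Q Qj -> locally_close C d (fun x => Q x + m) (fun j x => Qj j x + m).
Proof.
move=> [p [p1 [p2 [h1 h2 h3 h4 [h5 h6]]]]]; exists p, p1, p2; split => //.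
split => // j x /h6; congr (`|_| <= _); ring.
Qed.

(** The quantifiers express uniformity: [d] and [K'] are chosen before the potentials, hence
    independently of n and of the state at which one linearizes. *)
Lemma locally_close_approx_inverse (M : nat) (B C K : R) : 0 <= B -> 0 <= K -> 1 <= C ->
  exists2 d : R, 0 < d & exists2 K' : R, 0 <= K' & forall Q (Qj : 'I_M -> R -> R),
    potential B Q -> (forall j, potential B (Qj j)) -> (forall j, right_inverse (Qj j) K) ->
    locally_close C d Q Qj -> approx_inverse Q K'.
Proof.
move=> B0 K0 C1; pose k := 2 * (K + B * K + 1).
have BK := mulr_ge0 B0 K0.
have k0 : 0 <= k by rewrite /k; lra.
have M0 : 0 <= M%:R :> R by [].
have C0 : 0 <= 3 + C by lra.
pose A := M%:R * ((3 + C) * k); have A0 : 0 <= A := mulr_ge0 M0 (mulr_ge0 C0 k0).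
have A1 : 0 < 4 * A + 1 by lra.
exists (4 * A + 1)^-1; first by rewrite invr_gt0.
exists (M%:R * (7 * C * k)); first by rewrite !mulr_ge0//; lra.
move=> Q Qj P Pj inv [p [p1 [p2 [h1 h2 h3 h4 [h5 h6]]]]].
apply: (parametrix (d := (4 * A + 1)^-1) (p := p) (p1 := p1) (p2 := p2) K0 _ _ C1 P Pj inv) => //.
- by rewrite invr_ge0 ltW.
- by rewrite invf_le1//; lra.
rewrite -/k.
have -> : 4 * (M%:R * ((4 * A + 1)^-1 * (3 + C) * k)) = 4 * A / (4 * A + 1) by rewrite /A; field; rewrite gt_eqF.
by rewrite ler_pdivrMr//; lra.
Qed.

(** For m >= -rho / 2 the gap gives inverses of norm at most 2 / rho, whatever m is, so one
    threshold [d] serves them all. Only m in [-rho / 2, B] matter for [form_le_of_inverses], which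
    keeps the potentials Q + m uniformly bounded. *)
Lemma form_le_glued (M : nat) (B C rho : R) (q : 'I_M -> R -> R) : 0 < rho -> 1 <= C ->
  0 <= B -> (forall j, potential B (q j)) -> (forall j, form_le (q j) (- rho)) ->
  (forall j m, - rho < m -> exists K, right_inverse (fun x => q j x + m) K) ->
  exists2 d : R, 0 < d & forall Q (c : 'I_M -> R), potential B Q ->
    locally_close C d Q (fun j x => q j (x - c j)) -> form_le Q (- (rho / 2)).
Proof.
move=> r0 C1 B0 P fm inv.
pose K := (rho / 2)^-1; have K0 : 0 <= K by rewrite invr_ge0; lra.
have invK j (m : R) : - (rho / 2) <= m -> right_inverse (fun x => q j x + m) K.
  move=> hm; have [|K1 I1] := inv j m; first lra.
  have r2 : 0 < rho / 2 by lra.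
  by apply: (form_lt_right_inverse (P j) r2 _ I1); apply: form_le_mono (fm j); lra.
have B'0 : 0 <= B + (B + rho) by lra.
have [d d0 [K' K'0 H]] := locally_close_approx_inverse M B'0 K0 C1.
exists d => // Q c PQ lc; apply: (form_le_of_inverses PQ (form_le_bound PQ)) => m /andP[m1 m2].
have mB : `|m| <= B + rho by rewrite ler_norml; apply/andP; split; lra.
have PQm := potentialD PQ mB.
exists (6 * K'); apply: (right_inverse_of_approx K'0 PQm).
apply: (H _ (fun j x => q j (x - c j) + m)) => //.
- by move=> j; exact: potentialD (potential_shift (c j) (P j)) mB.
- by move=> j; exact: (right_inverse_shift (c j) (invK j m m1)).
- exact: locally_closeD.
Qed.

(* The translated eigenfunction makes the form of [Q] larger than [lam / 4]; its tail
   outside of [-X, X] is what allows [Q] to be arbitrary away from [c]. *)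
Lemma form_gt_glued (B lam : R) q f f1 f2 : 0 < lam -> potential B q -> W2 f f1 f2 ->
  0 < nrm f -> {ae mu, forall x, f2 x - q x * f x = lam * f x} ->
  exists2 d : R, 0 < d & exists X : R, forall Q (c : R), potential B Q ->
    (forall x, `|x - c| <= X -> `|Q x - q (x - c)| <= d) -> ~ form_le Q (lam / 4).
Proof.
move=> l0 P W f0 e; have [_ _ lf lf1 lf2] := W.
have B0 := potential_ge0 P.
have B1 : 0 < 8 * B + 1 by lra.
(* Outside the window the potentials differ by at most 2 B, so such a tail contributes at most lam
   ||f|| / 4, the same as the error d = lam / 4 inside. The form keeps at least lam / 2 times
   ||f||^2. *)
have t0 : 0 < lam * nrm f / (8 * B + 1) by rewrite divr_gt0// mulr_gt0.
have [X HX] := L2_tail lf t0.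
exists (lam / 4); first lra.
exists X => Q c PQ close fle.
have Wc := W2_shift (- c) W; have := fle _ _ _ Wc; apply/negP; rewrite -ltNge.
have lc := L2_shift (- c) lf; rewrite nrm_shift//.
pose r x := Q (x + c) - q x.
have lAc := L2_operator PQ Wc; have lAf := L2_operator P W.
have mr : potential (2 * B) r.
  split.
    apply: measurable_funB; last by case: P.
    apply: measurableT_comp; first by case: PQ.
    by apply: measurable_funD => //; exact: measurable_cst.
  move=> x; apply: le_trans (ler_normB _ _) _; have := PQ.2 (x + c); have := P.2 x; lra.
have [lr nr] := L2_potential_mul mr lf.
have nrf : nrm (fun x => r x * f x) <= lam / 4 * nrm f + lam / 4 * nrm f.
  pose t := f \_ [set x : R | X <= `|x|].
  have mA : measurable [set x : R | X <= `|x|].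
    have -> : [set x : R | X <= `|x|] = (fun x : R => `|x|) @^-1` `[X, +oo[%classic.
      by apply/seteqP; split => x /=; rewrite in_itv/= andbT.
    by rewrite -[X in measurable X]setTI; apply: measurableT_comp.
  have lt := L2_patch mA lf.
  have lF : l2 (fun x => `|f x|) by apply: (L2_le _ lf) => [|x]; [apply: measurableT_comp => //; exact: L2_meas lf|rewrite normr_id].
  have lT : l2 (fun x => `|t x|) by apply: (L2_le _ lt) => [|x]; [apply: measurableT_comp => //; exact: L2_meas lt|rewrite normr_id].
  have nF : nrm (fun x => `|f x|) <= nrm f.
    by rewrite -[leRHS]mul1r; apply: nrm_le_ae => //; apply: nearW => x; rewrite normr_id mul1r.
  have nT : nrm (fun x => `|t x|) <= nrm t.
    by rewrite -[leRHS]mul1r; apply: nrm_le_ae => //; apply: nearW => x; rewrite normr_id mul1r.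
  have h : nrm (fun x => r x * f x) <= nrm (fun x => lam / 4 * `|f x| + 2 * B * `|t x|).
    rewrite -[leRHS]mul1r; apply: nrm_le_ae => //; first by apply: L2D; exact: L2Z.
    apply: nearW => x; move: (x : R) => {}x; rewrite mul1r [leRHS]ger0_norm; last first.
      by apply: addr_ge0; apply: mulr_ge0 => //; lra.
    rewrite normrM /t patchE; case: ifPn => xX.
      have := mr.2 x => rx; apply: le_trans (_ : 2 * B * `|f x| <= _); first by rewrite ler_wpM2r.
      by rewrite lerDr mulr_ge0//; lra.
    rewrite normr0 mulr0 addr0 ler_wpM2r// /r.
    have := close (x + c); rewrite addrK; apply; rewrite leNgt; apply: contra xX => xX.
    by rewrite inE /= ltW.
  apply: le_trans h _; apply: le_trans (nrmD (L2Z _ lF) (L2Z _ lT)) _.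
  rewrite !nrmZ// !ger0_norm; [|lra|lra].
  apply: lerD; first by rewrite ler_wpM2l//; lra.
  have B2 : 0 <= 2 * B by lra.
  apply: le_trans (_ : 2 * B * (lam * nrm f / (8 * B + 1)) <= _).
    by rewrite ler_wpM2l//; exact: le_trans nT HX.
  rewrite mulrA ler_pdivrMr//; have := mulr_gt0 l0 f0.
  have -> : lam / 4 * nrm f = (lam * nrm f) / 4 by ring.
  by move: (lam * nrm f) => y y0; have := mulr_ge0 B0 (ltW y0); lra.
have lQ : l2 (fun x => f2 x - Q (x + c) * f x).
  by have := L2_shift c lAc; congr (L2 _ _); apply/funext => x; rewrite addrK.
have -> : ip (fun x => f2 (x - c) - Q x * f (x - c)) (fun x => f (x - c)) =
    ip (fun x => f2 x - Q (x + c) * f x) f.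
  rewrite /ip -[RHS](Rintegral_shift (- c)); last by apply: L2_mul => //; exact: lQ.
  by apply: eq_RintegralT => x; rewrite subrK.
have llf := L2Z lam lf.
rewrite (ip_ae (f' := fun x => lam * f x - r x * f x)) //; first last.
- by apply: filterS e => x; rewrite /r; lra.
- exact: L2B.
rewrite ipBl// ipZl// -nrm_sqr//.
have := cauchy_schwarz lr lf; rewrite ler_norml => /andP[_ cs].
have : nrm (fun x => r x * f x) * nrm f <= (lam / 4 * nrm f + lam / 4 * nrm f) * nrm f by rewrite ler_wpM2r// ltW.
have := mulr_gt0 l0 (mulr_gt0 f0 f0); rewrite expr2; lra.
Qed.

Lemma ler_sum_ord (M : nat) (F : 'I_M -> R) j : (forall i, 0 <= F i) -> F j <= \sum_i F i.
Proof. by move=> F0; rewrite (bigD1 j)//= lerDl sumr_ge0. Qed.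

Lemma ord_lower_bound (M : nat) (r : 'I_M -> R) : (forall j, 0 < r j) ->
  exists2 s : R, 0 < s & forall j, s <= r j.
Proof.
move=> r0; have ri j : 0 <= (r j)^-1 by rewrite invr_ge0 ltW.
have s0 : 0 < 1 + \sum_j (r j)^-1 by rewrite ltr_wpDr// sumr_ge0.
exists (1 + \sum_j (r j)^-1)^-1; first by rewrite invr_gt0.
move=> j; rewrite -[leRHS]invrK lef_pV2 ?posrE ?invr_gt0//.
by apply: le_trans (ler_sum_ord j ri) _; rewrite lerDr.
Qed.

(** The bound on the form excludes real spectrum only; nondegeneracy of the glued state starts the
    continuation that handles the complex half-plane Re lam > -rho / 4. *)
Lemma spectrally_stable_glued (M : nat) (V : R -> R) (eps B C : R) (u : 'I_M -> R -> R) :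
  0 <= B -> 1 <= C -> (forall w, measurable_fun setT w -> potential B (linearized V eps w)) ->
  (forall j, measurable_fun setT (u j)) ->
  (forall j, strongly_spectrally_stable V eps (u j)) ->
  exists2 d : R, 0 < d & forall w (c : 'I_M -> R), measurable_fun setT w ->
    nondegenerate_state V eps w ->
    locally_close C d (linearized V eps w) (fun j x => linearized V eps (u j) (x - c j)) ->
    strongly_spectrally_stable V eps w.
Proof.
move=> B0 C1 P mu_ st.
have [rho r0 Hr] : exists2 rho : R, 0 < rho & forall j,
    spectrum (L_op V eps (u j)) `<=` [set lam | complex.Re lam <= - rho].
  have /choice[r Hr] : forall j, exists r : R, 0 < r /\
      spectrum (L_op V eps (u j)) `<=` [set lam | complex.Re lam <= - r].
    by move=> j; have [r ? ?] := st j; exists r.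
  have [|s s0 hs] := @ord_lower_bound M r; first by move=> j; case: (Hr j).
  exists s => // j lam /(proj2 (Hr j)) /= h; apply: le_trans h _.
  by rewrite lerN2.
have inv j m : - rho < m -> exists K, right_inverse (fun x => linearized V eps (u j) x + m) K.
  move=> rm; apply: (resolvent_right_inverse (P _ (mu_ j))).
  apply: contrapT => ns; have := Hr j _ ns; rewrite /= leNgt => /negP; exact.
(* Invertibility is known for m > -rho, whereas [form_le_of_inverses] asks for it on a closed
   interval; hence the loss of a factor 2. *)
have fm j : form_le (linearized V eps (u j)) (- (rho / 2)).
  apply: (form_le_of_inverses (P _ (mu_ j)) (form_le_bound (P _ (mu_ j)))) => m /andP[m1 _].
  by apply: inv; lra.
have r2 : 0 < rho / 2 by lra.
have [|d d0 H] := form_le_glued r2 C1 B0 (fun j => P _ (mu_ j)) fm.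
  by move=> j m hm; apply: inv; lra.
exists d => // w c mw nd lc; have fw := H _ _ (P _ mw) lc.
have [K iK] : exists K, right_inverse (fun x => linearized V eps w x + 0) K.
  by apply: (resolvent_right_inverse (P _ mw)).
have {}iK : right_inverse (linearized V eps w) K.
  by move: iK; congr (right_inverse _ _); apply/funext => x; rewrite addr0.
exists (rho / 2 / 2); first lra.
move=> lam sl /=; rewrite leNgt; apply/negP => hl; apply: sl.
by apply: (resolvent_of_form (P _ mw) iK _ fw hl); lra.
Qed.

(** The eigenvalue is real, so the real and imaginary parts of an eigenfunction satisfy the same
    equation, and one of them is nonzero. *)
Lemma eigenfunction_of_simple (V u : R -> R) (eps r : R) :
  simple_eigenvalue (L_op V eps u) r%:C%C -> exists f f1 f2, [/\ W2 f f1 f2, 0 < nrm f &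
    {ae mu, forall x, f2 x - linearized V eps u x * f x = r * f x}].
Proof.
move=> [h [[/H2_W2 Wf /H2_W2 Wg] nz e _ _]].
have e' : {ae mu, forall x, L_op V eps u h x - r%:C%C * h x = 0}.
  by apply: filterS e => x ->; rewrite subrr.
have pos f f1 f2 : W2 f f1 f2 -> ~ {ae mu, forall x, f x = 0} -> 0 < nrm f.
  move=> [_ _ lf _ _] nf; rewrite lt0r nrm_ge0 andbT; apply/negP => /eqP n0; apply: nf.
  exact: nrm_eq0_ae.
have [zf|nzf] := pselect {ae mu, forall x, re h x = 0}; last first.
  exists (re h), (weak_derivative (re h)), (weak_derivative (weak_derivative (re h))).
  split => //; first exact: pos Wf nzf.
  apply: filterS e' => x; rewrite L_op_sub => /(congr1 (@complex.Re R)) /=; lra.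
exists (im h), (weak_derivative (im h)), (weak_derivative (weak_derivative (im h))).
split => //.
  by apply: pos Wg _ => zg; apply: nz; apply/ae_complex0.
apply: filterS e' => x; rewrite L_op_sub => /(congr1 (@complex.Im R)) /=; lra.
Qed.

(** Without spectrum in the right half-plane all m >= r / 4 would be in the resolvent set and the
    form would be at most r / 4, against [form_gt_glued]. *)
Lemma spectrally_unstable_glued (V u : R -> R) (eps B r : R) :
  (forall w, measurable_fun setT w -> potential B (linearized V eps w)) ->
  measurable_fun setT u -> 0 < r -> simple_eigenvalue (L_op V eps u) r%:C%C ->
  exists2 d : R, 0 < d & exists X : R, forall w (c : R), measurable_fun setT w ->
    (forall x, `|x - c| <= X -> `|linearized V eps w x - linearized V eps u (x - c)| <= d) ->
    spectrally_unstable V eps w.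
Proof.
move=> P mu_ r0 /eigenfunction_of_simple[f [f1 [f2 [W f0 e]]]].
have [d d0 [X H]] := form_gt_glued r0 (P _ mu_) W f0 e.
exists d => //; exists X => w c mw close; apply: contrapT => ns.
apply: (H _ c (P _ mw) close).
apply: (form_le_of_inverses (P _ mw) (form_le_bound (P _ mw))) => m /andP[m1 _].
apply: (resolvent_right_inverse (P _ mw)); apply: contrapT => nr; apply: ns.
by exists m%:C%C => //=; lra.
Qed.

End Perturbation.

(** * Fronts and cutoffs *)

Section Calculus.
Variable R : realType.
Local Notation mu := (@lebesgue_measure R).
Implicit Types (f g V u : R -> R).

Lemma mean_value f (f' : R -> R) (a b : R) : (forall x : R, is_derive x 1 f (f' x)) ->
  exists2 c : R, `|c - a| <= `|b - a| & f b - f a = f' c * (b - a).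
Proof.
move=> df; have cf := is_derive_continuous df.
have H x y : x <= y -> exists2 c, x <= c <= y & f y - f x = f' c * (y - x).
  move=> xy; have [//|c cxy e] := @MVT_segment R f f' x y xy (fun z _ => df z).
    by apply: continuous_subspaceT => z; exact: cf.
  by exists c => //; move: cxy; rewrite in_itv.
have [ab|/ltW ba] := leP a b.
  have [c /andP[ac cb] e] := H a b ab; exists c => //.
  by rewrite !ger0_norm ?subr_ge0//; lra.
have [c /andP[ac cb] e] := H b a ba; exists c; last by lra.
by rewrite !ler0_norm ?subr_le0//; lra.
Qed.

Lemma sin_dist (a b : R) : `|sin b - sin a| <= `|b - a|.
Proof.
have [c _ ->] := @mean_value sin cos a b (fun x => is_derive_sin x).
by rewrite normrM ler_piMl// cos_max.
Qed.

Lemma cos_dist (a b : R) : `|cos b - cos a| <= `|b - a|.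
Proof.
have [c _ ->] := @mean_value cos (fun x => - sin x) a b (fun x => is_derive_cos x).
by rewrite normrM normrN ler_piMl// sin_max.
Qed.

(** The derivative is frozen at w instead of w + a, since every step of the iteration uses the
    linearization at the glued profile; this is what brings in |a|. *)
Lemma sin_taylor (w a p : R) :
  `|sin (w + (a + p)) - sin (w + a) - cos w * p| <= (`|a| + `|p|) * `|p|.
Proof.
have [c hc ->] := @mean_value sin cos (w + a) (w + (a + p)) (fun x => is_derive_sin x).
have E : w + (a + p) - (w + a) = p by ring.
rewrite E in hc *; rewrite -mulrBl normrM ler_wpM2r//.
apply: le_trans (cos_dist w c) _.
have -> : c - w = a + (c - (w + a)) by ring.
by apply: le_trans (ler_normD _ _) _; rewrite lerD2l.
Qed.

(** A point of difference would bring an open interval of such points, which has positive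
    measure. *)
Lemma continuous_ae_eq f g : continuous f -> continuous g ->
  {ae mu, forall x, f x = g x} -> f = g.
Proof.
move=> cf cg fg; apply/funext => x; apply: contrapT => nx.
have d0 : 0 < `|f x - g x| by rewrite normr_gt0 subr_eq0; apply/eqP.
have /(_ x)/cvgrPdist_lt/(_ _ d0) := cfB cf cg.
move=> /nbhs_ballP[e /= e0 He].
have [A [mA A0 PA]] := fg.
have sub : `]x - e, x + e[%classic `<=` A.
  move=> y /=; rewrite in_itv/= => /andP[y1 y2]; apply: PA => /= efg.
  have : ball x e y by rewrite /ball /= ltr_norml; apply/andP; split; lra.
  by move=> /He /=; rewrite efg subrr subr0 ltxx.
have : (mu (`]x - e, x + e[%classic : set R)%R <= mu A)%E by apply: le_measure => //; rewrite inE.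
rewrite A0 lebesgue_measure_itv/= lte_fin ifT; last by lra.
by rewrite -EFinB lee_fin; lra.
Qed.

Lemma cf_norm f : continuous f -> continuous (fun x => `|f x|).
Proof. by move=> cf x; apply: cvg_norm; exact: cf. Qed.

Lemma continuous_ae_le f (K : R) : continuous f -> {ae mu, forall x, `|f x| <= K} ->
  forall x, `|f x| <= K.
Proof.
(* [g] is twice the positive part of |f| - K, so an inequality becomes an equality of continuous
   functions. *)
move=> cf H x; pose g x := (`|f x| - K) + `| `|f x| - K |.
have c1 : continuous (fun x => `|f x| - K) by apply: cfB; [exact: cf_norm|exact: cfc].
have cg : continuous g by apply: cfD => //; exact: cf_norm.
have : g = (fun=> 0).
  apply: (continuous_ae_eq cg (@cfc R 0)); apply: filterS H => y h.
  by rewrite /g [`|_ - K|]ler0_norm ?subr_le0// subrr.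
move=> /(congr1 (@^~ x)) /=; rewrite /g; have := normr_ge0 (`|f x| - K); lra.
Qed.

Lemma periodic_shift f (T : R) (k : nat) x : periodic f T -> f (x - k%:R * T) = f x.
Proof.
move=> /periodicn H; rewrite -(H k (x - k%:R * T)); congr f.
by rewrite -[T *+ k]mulr_natl subrK.
Qed.

Lemma periodic_bounded f (T : R) : 0 < T -> periodic f T -> continuous f ->
  exists2 B : R, 0 < B & forall x, `|f x| <= B.
Proof.
move=> T0 per cf; have [B B0 HB] := continuous_bounded_on (2 * T) cf.
exists B => // x.
have pos y : 0 <= y -> `|f y| <= B.
  move=> y0; pose k := Num.truncn (y / T).
  have yT : 0 <= y / T by rewrite divr_ge0// ltW.
  have /andP[k1 k2] := truncn_itv yT; rewrite -/k in k1 k2.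
  rewrite ler_pdivlMr// in k1; rewrite ltr_pdivrMr// -natr1 mulrDl mul1r in k2.
  rewrite -(periodic_shift k y per); apply: HB.
  by rewrite ger0_norm ?subr_ge0//; lra.
have [/pos//|x0] := leP 0 x.
pose k := (Num.trunc (- x / T)).+1.
rewrite -(addrK (k%:R * T) x) (periodic_shift k _ per); apply: pos.
have xT : 0 <= - x / T by rewrite divr_ge0 ?ltW// oppr_gt0.
have /andP[_] := truncn_itv xT; rewrite -/k ltr_pdivrMr//; lra.
Qed.

Lemma derive1_periodic f (f' : R -> R) (T : R) : (forall x : R, is_derive x 1 f (f' x)) ->
  periodic f T -> periodic f' T.
Proof.
move=> df per x; have H := is_derive_shift (df (x + T)).
have E : (fun y => f (y + T)) = f by apply/funext => y; exact: per.
rewrite E in H; rewrite -(@derive_val _ _ _ _ _ _ _ H).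
exact: (@derive_val _ _ _ _ _ _ _ (df x)).
Qed.

Lemma Linfty_ae_le f (K : R) : (Linfty_norm f <= K%:E)%E -> {ae mu, forall x, `|f x| <= K}.
Proof.
rewrite /Linfty_norm unlock /Lnorm; case: ifPn => [_ /ess_supP|].
  by apply: filterS => x /=; rewrite lee_fin.
move=> /negP []; apply: (@lt_le_trans _ _ (mu (`[0, 1]%classic : set R)%R)).
  by rewrite lebesgue_measure_itv/= lte_fin ltr01 -EFinB lte_fin subr0.
by apply: le_measure => //; rewrite inE.
Qed.

Lemma smooth_is_derive f : smooth f -> [/\ forall x : R, is_derive x 1 f (derive1 f x),
  forall x : R, is_derive x 1 (derive1 f) (derive1n 2 f x) & continuous (derive1n 2 f)].
Proof.
move=> sf; split.
- by move=> x; rewrite derive1E; apply: derivableP; exact: (sf 0%N x).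
- by move=> x; rewrite derive1nS derive1E; apply: derivableP; exact: (sf 1%N x).
- by move=> x; apply: differentiable_continuous; apply/derivable1_diffP; exact: (sf 2%N x).
Qed.

Lemma derive1_near0 f x : (\forall y \near x, f y = 0) -> derive1 f x = 0.
Proof.
move=> H; rewrite derive1E; suff D : is_derive x 1 f 0 by exact: derive_val.
apply: near_eq_is_derive (is_derive_cst 0 x 1).
by apply: filterS H => y ->.
Qed.

Lemma out_supp_near0 f x : ~ supp f x -> \forall y \near x, f y = 0.
Proof.
move=> nx; have : \forall y \near x, (~` supp f) y.
  by apply: open_nbhs_nbhs; split => //; apply: closed_openC; exact: closed_closure.
apply: filterS => y ny; apply/eqP/negPn/negP => fy; apply: ny.
exact: subset_closure.
Qed.

End Calculus.

Section Fronts.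
Variable R : realType.
Local Notation mu := (@lebesgue_measure R).
Implicit Types (f g V u v : R -> R).

Lemma stationary_is_derive V eps u : stationary_solution V eps u ->
  (forall x : R, is_derive x 1 u (derive1 u x)) /\
  (forall x : R, is_derive x 1 (derive1 u) (sin (u x) - eps * V x * u x)).
Proof.
move=> H; split => x; have [d1 d2 e] := H x.
  by rewrite derive1E; exact: derivableP d1.
have -> : sin (u x) - eps * V x * u x = derive1n 2 u x by lra.
by rewrite derive1nS derive1E; exact: derivableP d2.
Qed.

(** The product chi f is continuous, hence equals its decaying C^1 representative. The cutoff has to
    be 1 near x, and not only at x, for the derivatives to agree there. *)
Lemma H2_decay (chi f f1 : R -> R) (e : R) : continuous chi ->
  (forall x : R, is_derive x 1 f (f1 x)) -> H2 (fun x => chi x * f x) -> 0 < e ->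
  exists X : R, forall x, X <= `|x| -> (\forall y \near x, chi y = 1) ->
    `|f x| <= e /\ `|f1 x| <= e.
Proof.
move=> cc df /H2_W2/W2_rep[F [F1 [dF [_ _ l0 l1 l2'] p0 p1 [e0 _]]]] e_gt0.
have FE : F = (fun x => chi x * f x).
  apply: continuous_ae_eq e0; first exact: is_derive_continuous dF.
  exact: cfM (is_derive_continuous df).
have [X0 H0] := primitive_decay l0 l1 p0 e_gt0; have [X1 H1] := primitive_decay l1 l2' p1 e_gt0.
exists (`|X0| + `|X1|) => x hx near1.
have h0 : X0 <= `|x| by have := ler_norm X0; have := normr_ge0 X1; lra.
have h1 : X1 <= `|x| by have := ler_norm X1; have := normr_ge0 X0; lra.
have {}dF : is_derive x 1 f (F1 x).
  apply: near_eq_is_derive (dF x); rewrite FE.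
  by apply: filterS near1 => y ->; rewrite mul1r.
have c1 : chi x = 1 by apply: nbhs_singleton near1.
split; first by have := H0 x h0; rewrite FE c1 mul1r.
rewrite -(@derive_val _ _ _ _ _ _ _ (df x)) (@derive_val _ _ _ _ _ _ _ dF); exact: H1.
Qed.

Lemma smooth_continuous f : smooth f -> continuous f.
Proof. by move=> /smooth_is_derive[d _ _]; exact: is_derive_continuous d. Qed.

(** Derivatives have to converge too, because the residual contains products of derivatives of the
    cutoffs and of the fronts. The support conditions make [chip] equal to 1 beyond 1 and [chim]
    equal to 1 before -1. *)
Lemma front_limits (chip chim u u1 vp vp1 vm vm1 : R -> R) (e : R) : end_cutoffs chip chim ->
  (forall x : R, is_derive x 1 u (u1 x)) -> (forall x : R, is_derive x 1 vp (vp1 x)) ->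
  (forall x : R, is_derive x 1 vm (vm1 x)) ->
  H2 (fun x => chip x * (u x - vp x)) -> H2 (fun x => chim x * (u x - vm x)) -> 0 < e ->
  exists X : R, (forall x, X <= x -> `|u x - vp x| <= e /\ `|u1 x - vp1 x| <= e) /\
    (forall x, x <= - X -> `|u x - vm x| <= e /\ `|u1 x - vm1 x| <= e).
Proof.
move=> [[sp sm] _ sum1 suppp suppm] du dp dm Hp Hm e0.
have [Xp HXp] := H2_decay (smooth_continuous sp) (fun x => is_derive_sub (du x) (dp x)) Hp e0.
have [Xm HXm] := H2_decay (smooth_continuous sm) (fun x => is_derive_sub (du x) (dm x)) Hm e0.
exists (`|Xp| + `|Xm| + 1); split => x hx.
  have x1 : 1 <= x by have := normr_ge0 Xp; have := normr_ge0 Xm; lra.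
  apply: HXp; first by rewrite ger0_norm; have := ler_norm Xp; have := normr_ge0 Xm; lra.
  have : \forall y \near x, chim y = 0.
    by apply: out_supp_near0 => /suppm /=; rewrite in_itv/=; lra.
  by apply: filterS => y hy; have := sum1 y; rewrite hy addr0.
have x1 : x <= -1 by have := normr_ge0 Xp; have := normr_ge0 Xm; lra.
apply: HXm; first by rewrite ler0_norm; have := ler_norm Xm; have := normr_ge0 Xp; lra.
have : \forall y \near x, chip y = 0.
  by apply: out_supp_near0 => /suppp /=; rewrite in_itv/= andbT; lra.
by apply: filterS => y hy; have := sum1 y; rewrite hy add0r.
Qed.

(* With indices starting at 0, front [j] is centred at [(j + 1) n T] and its cutoff lives
   between [(j + 1/2) n T - 1] and [(j + 3/2) n T + 1], the extreme ones being unbounded. *)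
Definition cutoff_zone (T : R) (M n j : nat) (x : R) : Prop :=
  ((0 < j)%N -> (j%:R + 1 / 2) * (n%:R * T) - 1 <= x) /\
  ((j.+1 < M)%N -> x <= (j%:R + 3 / 2) * (n%:R * T) + 1).

Lemma smooth_cst (c : R) : smooth (fun _ : R => c).
Proof.
move=> m; have H : exists c', derive1n m (fun _ : R => c) = (fun=> c').
  elim: m => [|m [c' IH]]; first by exists c.
  by exists 0; rewrite derive1nS IH; apply: derive1_is_derive => x; exact: is_derive_cst.
have [c' ->] := H => x; exact: derivable_cst.
Qed.

(** For M = 1 the cutoff is the constant 1 and its zone is the whole line. For M > 1 the complement
    of a support is open, so derivatives vanish there as well, and essential bounds hold everywhere
    by continuity. *)
Lemma gluing_cutoffs_props (T K : R) (M n : nat) (chi : 'I_M -> R -> R) : (0 < M)%N ->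
  gluing_cutoffs T K n chi ->
  [/\ forall j, smooth (chi j), forall j x, 0 <= chi j x <= 1, forall x, \sum_j chi j x = 1,
    forall (j : 'I_M) x, ~ cutoff_zone T M n j x ->
      [/\ chi j x = 0, derive1 (chi j) x = 0 & derive1n 2 (chi j) x = 0] &
    forall j x, `|derive1 (chi j) x| <= `|K| /\ `|derive1n 2 (chi j) x| <= `|K|].
Proof.
move=> M0 [H1 H2]; have [M1|M1] := leqP M 1.
  have ME : M = 1%N by apply/eqP; rewrite eqn_leq M1.
  have E j : chi j = (fun=> 1) by apply/funext => x; exact: H1.
  have D0 : derive1 (fun _ : R => 1 : R) = (fun=> 0).
    by apply: derive1_is_derive => x; exact: is_derive_cst.
  have D1 : derive1n 2 (fun _ : R => 1 : R) = (fun=> 0).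
    by rewrite derive1nS /= D0; apply: derive1_is_derive => x; exact: is_derive_cst.
  split.
  - by move=> j; rewrite E; exact: smooth_cst.
  - by move=> j x; rewrite E lexx ler01.
  - by move=> x; under eq_bigr do rewrite E; rewrite sumr_const card_ord ME.
  - move=> j x nz; exfalso; apply: nz; rewrite leqNgt in M1; split => [j0|jM].
      by have := leq_ltn_trans j0 (ltn_ord j); rewrite (negPf M1).
    by have := leq_ltn_trans (ltn0Sn j) jM; rewrite (negPf M1).
  - by move=> j x; rewrite E D0 D1 normr0.
have [sm b01 sum1 bd supp_] := H2 M1; split => //.
- move=> j x nz.
  have out : ~ supp (chi j) x.
    move=> sx; apply: nz; have [s0 sM sj] := supp_ j.
    have [j0|j0] := posnP j.
      have := s0 j0 x sx; rewrite /= in_itv/= => h; rewrite /cutoff_zone j0; split => // _.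
      by move: h; rewrite mulrA; lra.
    have [jM|jM] := ltnP j.+1 M.
      have := sj j0 jM x sx; rewrite /= in_itv/= -natr1 => /andP[h1 h2]; split=> _; lra.
    have jM' : j.+1 = M by apply/eqP; rewrite eqn_leq jM ltn_ord.
    have MR : M%:R = j%:R + 1 :> R by rewrite natr1 jM'.
    have := sM jM' x sx; rewrite /= in_itv/= andbT MR => h; split; last by rewrite jM' ltnn.
    by move=> _; lra.
  have n0 := out_supp_near0 out.
  have n1 : \forall y \near x, derive1 (chi j) y = 0.
    have : \forall y \near x, (~` supp (chi j)) y.
      by apply: open_nbhs_nbhs; split => //; apply: closed_openC; exact: closed_closure.
    by apply: filterS => y ny; exact: derive1_near0 (out_supp_near0 ny).
  split; [exact: nbhs_singleton n0|exact: derive1_near0|].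
  by rewrite derive1nS; exact: derive1_near0.
- move=> j x; have [d1 d2 c2] := smooth_is_derive (sm j).
  have h1 := continuous_ae_le (is_derive_continuous d2) (Linfty_ae_le (bd j 1%N isT)).
  have h2 := continuous_ae_le c2 (Linfty_ae_le (bd j 2%N isT)).
  split; first exact: le_trans (h1 x) (ler_norm K).
  exact: le_trans (h2 x) (ler_norm K).
Qed.

End Fronts.

(** * The slowly varying partition of unity *)

Section Partition.
Variable R : realType.
Implicit Types (f g V u v : R -> R).

Lemma eventually_ge (T b : R) : 0 < T -> exists N : nat, forall n, (N <= n)%N -> b <= n%:R * T.
Proof.
move=> T0; exists (Num.bound (`|b| / T)) => n Nn.
apply: le_trans (ler_norm b) _; rewrite -ler_pdivrMr//.
apply: le_trans (_ : (Num.bound (`|b| / T))%:R <= _); last by rewrite ler_nat.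
by apply/ltW/archi_boundP; rewrite divr_ge0// ltW.
Qed.

(** Consecutive wide zones overlap on a length n T / 2, which leaves room for slow transitions, and
    points of the overlap remain at distance at least n T / 4 from both centres. *)
Definition wide_zone (T : R) (M n j : nat) (x : R) : Prop :=
  ((0 < j)%N -> (j%:R + 1 / 4) * (n%:R * T) <= x) /\
  ((j.+1 < M)%N -> x <= (j%:R + 7 / 4) * (n%:R * T)).

Lemma cutoff_zone_wide (T : R) (M n j : nat) x : 4 <= n%:R * T ->
  cutoff_zone T M n j x -> wide_zone T M n j x.
Proof. by move=> nT [h1 h2]; split => [/h1|/h2]; nra. Qed.

Lemma zones_adjacent (T : R) (M n : nat) (i j : 'I_M) x : 0 < n%:R * T -> (i < j)%N ->
  wide_zone T M n i x -> wide_zone T M n j x -> j = i.+1 :> nat.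
Proof.
move=> nT ij [_ hi] [hj _]; have {}hi := hi (leq_ltn_trans ij (ltn_ord j)).
have {}hj := hj (leq_ltn_trans (leq0n i) ij).
have : j%:R < (i.+2)%:R :> R.
  have E : i.+2%:R = i%:R + 2 :> R by rewrite -natrD addn2.
  by have := le_trans hj hi; rewrite E ler_pM2r//; lra.
by rewrite ltr_nat ltnS => ji; apply/eqP; rewrite eqn_leq ji.
Qed.

(** The functions are differences S_j - S_(j+1), where S_k rises over a length n T / 2 from the left
    end of zone k. Setting S_0 = 1 and S_M = 0 makes the sum telescope to 1 and leaves the extreme
    zones unbounded. *)
Lemma partition_of_unity : exists2 C : R, 1 <= C &
  forall (T : R) (M n : nat), (0 < M)%N -> 0 < n%:R * T ->
  exists p p1 p2 : 'I_M -> R -> R, let m := 2 / (n%:R * T) in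
  [/\ forall j (x : R), is_derive x 1 (p j) (p1 j x),
      forall j (x : R), is_derive x 1 (p1 j) (p2 j x),
      forall j, continuous (p2 j),
      forall j x, [/\ `|p j x| <= C, `|p1 j x| <= C * m & `|p2 j x| <= C * m ^+ 2] &
      (forall x, \sum_j p j x = 1) /\ forall j x, p j x != 0 -> wide_zone T M n j x].
Proof.
have [C C1 HC] := ramp_bound R.
exists (C + C); first lra.
move=> T M n M0 nT; pose m := 2 / (n%:R * T).
have m0 : 0 < m by rewrite divr_gt0.
pose a (k : nat) := (k%:R + 1 / 4) * (n%:R * T).
pose S (k : nat) : R -> R := if (k == 0)%N then fun=> 1 else if (M <= k)%N then fun=> 0 else ramp m (a k).
pose S1 (k : nat) : R -> R := if (k == 0)%N then fun=> 0 else if (M <= k)%N then fun=> 0 else dramp m (a k).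
pose S2 (k : nat) : R -> R := if (k == 0)%N then fun=> 0 else if (M <= k)%N then fun=> 0 else ddramp m (a k).
have dS k (x : R) : is_derive x 1 (S k) (S1 k x).
  rewrite /S /S1; case: ifP => _; first exact: is_derive_cst.
  by case: ifP => _; [exact: is_derive_cst|exact: is_derive_ramp].
have dS1 k (x : R) : is_derive x 1 (S1 k) (S2 k x).
  rewrite /S1 /S2; case: ifP => _; first exact: is_derive_cst.
  by case: ifP => _; [exact: is_derive_cst|exact: is_derive_dramp].
have cS2 k : continuous (S2 k).
  rewrite /S2; case: ifP => _; first exact: cfc.
  by case: ifP => _; [exact: cfc|exact: ddramp_continuous].
have bS k x : [/\ `|S k x| <= C, `|S1 k x| <= C * m & `|S2 k x| <= C * m ^+ 2].
  have p1 : 0 <= C * m by rewrite mulr_ge0 ?ltW//; lra.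
  have p2 : 0 <= C * m ^+ 2 by rewrite mulr_ge0 ?sqr_ge0//; lra.
  rewrite /S /S1 /S2; case: ifP => _; first by rewrite normr0 normr1; split.
  case: ifP => _; last exact: HC.
  by rewrite normr0; split => //; lra.
exists (fun j x => S j x - S j.+1 x), (fun j x => S1 j x - S1 j.+1 x), (fun j x => S2 j x - S2 j.+1 x).
split.
- by move=> j x; exact: is_derive_sub.
- by move=> j x; exact: is_derive_sub.
- by move=> j; exact: cfB.
- move=> j x; have [b0 b1 b2] := bS j x; have [c0 c1 c2] := bS j.+1 x.
  have E (y z e : R) : `|y| <= C * e -> `|z| <= C * e -> `|y - z| <= (C + C) * e.
    move=> hy hz; apply: le_trans (ler_normB _ _) _; lra.
  split; [|exact: E|exact: E].
  by rewrite -[C + C]mulr1; apply: E; rewrite mulr1.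
split.
  move=> x; transitivity (S 0%N x - S M x); last by rewrite /S (gtn_eqF M0) leqnn /= subr0.
  rewrite -[LHS]opprK -sumrN; under eq_bigr do rewrite opprB.
  by rewrite -(big_mkord xpredT (fun j => S j.+1 x - S j x)) telescope_sumr// opprB.
move=> j x nz; split.
  move=> j0; rewrite leNgt; apply: contra nz => xa.
  have jn : (j == 0 :> nat)%N = false by apply/negbTE; rewrite -lt0n.
  rewrite /S jn /= leqNgt ltn_ord /=.
  have [-> _ _] := ramp_le m0 (ltW xa).
  case: ifP => _; first by rewrite subrr.
  have [|-> _ _] := @ramp_le R m (a j.+1) x m0; last by rewrite subrr.
  apply: le_trans (ltW xa) _; by rewrite ler_pM2r// lerD2r ler_nat.
move=> jM; rewrite leNgt; apply: contra nz => xa.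
have E k : (k <= j.+1)%N -> S k x = 1.
  move=> kj; rewrite /S; case: eqP => // _; rewrite leqNgt (leq_ltn_trans kj jM) /=.
  have [|-> //] := @ramp_ge R m (a k) x m0.
  apply: le_trans (ltW xa); rewrite /m invf_div /a -[n%:R * T / 2]mulrC.
  have : k%:R <= j%:R + 1 :> R by rewrite natr1 ler_nat.
  move: nT; move: (n%:R * T) => y y0 h; nra.
by rewrite !E// subrr.
Qed.

(** The centres are multiples of the period, so V cancels in the difference of the potentials, and
    the cosine is 1-Lipschitz. *)
Lemma partition_close : exists2 C : R, 1 <= C &
  forall (T : R) (M : nat) (V : R -> R) (eps d : R) (u : 'I_M -> R -> R),
  (0 < M)%N -> 0 < T -> periodic V T -> 0 < d ->
  exists N : nat, forall n, (N <= n)%N -> forall w : R -> R,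
    (forall (j : 'I_M) x, wide_zone T M n j x -> `|w x - u j (x - (j.+1 * n)%:R * T)| <= d) ->
    locally_close C d (linearized V eps w)
      (fun j x => linearized V eps (u j) (x - (j.+1 * n)%:R * T)).
Proof.
have [C C1 HC] := partition_of_unity; exists C => // T M V eps d u M0 T0 per d0.
have [N HN] := eventually_ge (2 * C / d + 2) T0.
exists N => n Nn w close.
have nd := HN n Nn.
have dC : 0 < 2 * C / d by rewrite divr_gt0//; lra.
have nT : 0 < n%:R * T by lra.
have [p [p1 [p2 [h1 h2 h3 h4 [h5 h6]]]]] := HC T M n M0 nT.
set m := 2 / _ in h4.
have m0 : 0 < m by rewrite divr_gt0.
have md : C * m <= d.
  rewrite /m mulrA ler_pdivrMr// -ler_pdivrMl// mulrC; apply: le_trans nd.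
  by rewrite [C * 2]mulrC; lra.
have m1 : m <= 1 by rewrite /m ler_pdivrMr//; lra.
have md2 : C * m ^+ 2 <= d.
  apply: le_trans md; rewrite ler_wpM2l//; first lra.
  by rewrite expr2 ler_piMl// ltW.
exists p, p1, p2; split => //.
  by move=> j x; have [b0 b1 b2] := h4 j x; split => //; [exact: le_trans md|exact: le_trans md2].
split => // j x /h6 wz; have := close j x wz; rewrite /linearized.
move=> hd; rewrite (periodic_shift _ x per).
have -> : cos (w x) - eps * V x - (cos (u j (x - (j.+1 * n)%:R * T)) - eps * V x) =
  cos (w x) - cos (u j (x - (j.+1 * n)%:R * T)) by ring.
exact: le_trans (cos_dist _ _) hd.
Qed.

End Partition.

(** * Gluing *)

Section Gluing.
Variable R : realType.
Local Notation mu := (@lebesgue_measure R).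

Variables (T : R) (M : nat) (u u1 vp vp1 vm vm1 : 'I_M -> R -> R).
Hypotheses (T0 : 0 < T) (M0 : (0 < M)%N).

Definition front_at (u : 'I_M -> R -> R) (n : nat) (j : 'I_M) : R -> R :=
  fun x => u j (x - (j.+1 * n)%:R * T).

(** Where zones i and i + 1 meet, x lies at least n T / 4 to the right of the centre of front i and
    to the left of the centre of front i + 1. Both are close to the common end state, whose
    periodicity absorbs the different translations. *)
Lemma zones_close (d : R) : 0 < d ->
  (forall j, periodic (vp j) T /\ periodic (vp1 j) T) ->
  (forall j, periodic (vm j) T /\ periodic (vm1 j) T) ->
  (forall i j : 'I_M, j = i.+1 :> nat -> vp i = vm j /\ vp1 i = vm1 j) ->
  (forall j (e : R), 0 < e -> exists X : R,
    (forall x, X <= x -> `|u j x - vp j x| <= e /\ `|u1 j x - vp1 j x| <= e) /\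
    (forall x, x <= - X -> `|u j x - vm j x| <= e /\ `|u1 j x - vm1 j x| <= e)) ->
  exists N : nat, forall n, (N <= n)%N -> 4 <= n%:R * T /\
    forall (i j : 'I_M) x, wide_zone T M n i x -> wide_zone T M n j x ->
      `|front_at u n i x - front_at u n j x| <= d /\
      `|front_at u1 n i x - front_at u1 n j x| <= d.
Proof.
move=> d0 pp pm match_ lim.
have d2 : 0 < d / 2 by lra.
have [X HX] := choice (fun j => lim j (d / 2) d2).
pose Y := \sum_j `|X j|.
have XY j : X j <= Y by apply: le_trans (ler_norm _) _; apply: (ler_sum_ord j).
have [N HN] := eventually_ge (4 * Y + 4) T0.
have Y0 : 0 <= Y by apply: sumr_ge0.
exists N => n Nn; have nT := HN n Nn; split; first lra.
have H (i j : 'I_M) x : (i < j)%N -> wide_zone T M n i x -> wide_zone T M n j x ->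
    `|front_at u n i x - front_at u n j x| <= d /\ `|front_at u1 n i x - front_at u1 n j x| <= d.
  move=> ij wi wj; have nT0 : 0 < n%:R * T by lra.
  have ji := zones_adjacent nT0 ij wi wj.
  have [_ hi] := wi; have [hj _] := wj; have {}hi := hi (leq_ltn_trans ij (ltn_ord j)).
  have {}hj := hj (leq_ltn_trans (leq0n i) ij).
  have jR : j%:R = i%:R + 1 :> R by rewrite ji natr1.
  have ci : (i.+1 * n)%:R * T = (i%:R + 1) * (n%:R * T) by rewrite natrM -natr1 mulrA.
  have cj : (j.+1 * n)%:R * T = (i%:R + 2) * (n%:R * T).
    by rewrite natrM -natr1 jR -mulrA -addrA.
  have Xi := XY i; have Xj := XY j.
  have [hp _] := HX i; have [_ hm] := HX j.
  have [|a1 a2] := hp (x - (i.+1 * n)%:R * T).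
    by rewrite ci; rewrite jR in hj; lra.
  have [|b1 b2] := hm (x - (j.+1 * n)%:R * T).
    by rewrite cj; lra.
  have [p0 p1] := pp i; have [q0 q1] := pm j; have [e0 e1] := match_ i j ji.
  rewrite (periodic_shift _ x p0) in a1; rewrite (periodic_shift _ x p1) in a2.
  rewrite (periodic_shift _ x q0) -e0 in b1; rewrite (periodic_shift _ x q1) -e1 in b2.
  have tri (y z w : R) : `|y - w| <= d / 2 -> `|z - w| <= d / 2 -> `|y - z| <= d.
    move=> hy hz; have -> : y - z = (y - w) - (z - w) by ring.
    by apply: le_trans (ler_normB _ _) _; lra.
  by split; [exact: tri a1 b1|exact: tri a2 b2].
move=> i j x wi wj; have [ij|ji|ij] := ltngtP i j.
- exact: H.
- by have [h0 h1] := H j i x ji wj wi; rewrite distrC [`|_ - front_at u1 n j x|]distrC.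
- by rewrite (val_inj ij) !subrr normr0; split; exact: ltW.
Qed.

Variables (n : nat) (chi : 'I_M -> R -> R) (K : R).
Hypotheses (sm : forall j, smooth (chi j)) (b01 : forall j x, 0 <= chi j x <= 1)
  (sum1 : forall x, \sum_j chi j x = 1)
  (out : forall (j : 'I_M) x, ~ cutoff_zone T M n j x ->
      [/\ chi j x = 0, derive1 (chi j) x = 0 & derive1n 2 (chi j) x = 0])
  (bK : forall j x, `|derive1 (chi j) x| <= K /\ `|derive1n 2 (chi j) x| <= K)
  (nT : 4 <= n%:R * T).

Local Notation us := (front_at u n).
Local Notation us1 := (front_at u1 n).
Let W := glued T n chi u.

Definition glued1 : R -> R := fun x =>
  \sum_j (derive1 (chi j) x * us j x + chi j x * us1 j x).

(* [W'' + eps V W - sin W], simplified by means of the equations of the fronts. *)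
Definition residual : R -> R := fun x =>
  \sum_j (derive1n 2 (chi j) x * us j x + 2 * (derive1 (chi j) x * us1 j x)
          + chi j x * sin (us j x)) - sin (W x).

(** The difference is a convex combination of differences of fronts, and only fronts whose zone
    contains x contribute. *)
Lemma glued_close (d : R) (j : 'I_M) x : wide_zone T M n j x ->
  (forall i : 'I_M, wide_zone T M n i x -> `|us i x - us j x| <= d) -> `|W x - us j x| <= d.
Proof.
move=> wj close.
have -> : W x - us j x = \sum_i chi i x * (us i x - us j x).
  by under [RHS]eq_bigr do rewrite mulrBr; rewrite sumrB -mulr_suml sum1 mul1r.
apply: le_trans (ler_norm_sum _ _ _) _.
rewrite -[leRHS]mul1r -(sum1 x) mulr_suml; apply: ler_sum => i _.
have /andP[c0 c1] := b01 i x.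
rewrite normrM ger0_norm//; have [cz|/out[-> _ _]] := pselect (cutoff_zone T M n i x).
  by rewrite ler_wpM2l//; exact: close (cutoff_zone_wide nT cz).
by rewrite !mul0r.
Qed.

Lemma sum_derivatives x : \sum_j derive1 (chi j) x = 0 /\ \sum_j derive1n 2 (chi j) x = 0.
Proof.
have d1 j (y : R) : is_derive y 1 (chi j) (derive1 (chi j) y) by have [] := smooth_is_derive (@sm j).
have d2 j (y : R) : is_derive y 1 (derive1 (chi j)) (derive1n 2 (chi j) y).
  by have [] := smooth_is_derive (@sm j).
have E0 : (fun y => \sum_j chi j y) = (fun=> 1) by apply/funext => y; exact: sum1.
have D1 y := is_derive_sum (fun j => d1 j y); rewrite E0 in D1.
have E1 y : \sum_j derive1 (chi j) y = 0.
  by rewrite -(@derive_val _ _ _ _ _ _ _ (D1 y)) derive_cst.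
split=> //; have := is_derive_sum (fun j => d2 j x).
have -> : (fun y => \sum_j derive1 (chi j) y) = (fun=> 0) by apply/funext => y; exact: E1.
by move=> D2; rewrite -(@derive_val _ _ _ _ _ _ _ D2) derive_cst.
Qed.

(** Neighbouring cutoff zones meet in the closed interval of radius 1 around (k + 3/2) n T. As [osc]
    is open on the left, the left end is moved to -2, which gives the length 3. *)
Definition overlap (x : R) : R := \sum_(k < M)
  osc ((k%:R + 3 / 2) * (n%:R * T) - 2) ((k%:R + 3 / 2) * (n%:R * T) + 1) x.

Lemma osc_ge0 (a b x : R) : a <= b -> 0 <= osc a b x.
Proof. by move=> ab; rewrite osc_indic//; exact: indic_ge0. Qed.

(* Any front can be subtracted, since the derivatives of the cutoffs sum to zero. *)
Lemma residual_expand j x : residual x =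
  \sum_i (derive1n 2 (chi i) x * (us i x - us j x)
    + 2 * (derive1 (chi i) x * (us1 i x - us1 j x))
    + chi i x * (sin (us i x) - sin (us j x))) - (sin (W x) - sin (us j x)).
Proof.
have [s1 s2] := sum_derivatives x.
have -> : \sum_i (derive1n 2 (chi i) x * (us i x - us j x)
    + 2 * (derive1 (chi i) x * (us1 i x - us1 j x))
    + chi i x * (sin (us i x) - sin (us j x))) =
  \sum_i ((derive1n 2 (chi i) x * us i x + 2 * (derive1 (chi i) x * us1 i x)
          + chi i x * sin (us i x)) -
    (derive1n 2 (chi i) x * us j x + derive1 (chi i) x * (2 * us1 j x) + chi i x * sin (us j x))).
  by apply: eq_bigr => i _; ring.
rewrite sumrB [X in _ - X - _]big_split/= [X in _ - (X + _) - _]big_split/= -!mulr_suml s1 s2 sum1.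
rewrite /residual; ring.
Qed.

Lemma overlap_ge1 (i j : 'I_M) x : i != j -> cutoff_zone T M n i x -> cutoff_zone T M n j x ->
  1 <= overlap x.
Proof.
have nT0 : 0 < n%:R * T by apply: lt_le_trans nT.
have H (k l : 'I_M) : (k < l)%N -> cutoff_zone T M n k x -> cutoff_zone T M n l x -> 1 <= overlap x.
  move=> ij zi zj.
  have ji := zones_adjacent nT0 ij (cutoff_zone_wide nT zi) (cutoff_zone_wide nT zj).
  have [_ /(_ (leq_ltn_trans ij (ltn_ord l))) hi] := zi.
  have [/(_ (leq_ltn_trans (leq0n k) ij)) hj _] := zj.
  have jR : l%:R = k%:R + 1 :> R by rewrite ji natr1.
  rewrite jR in hj.
  apply: le_trans (ler_sum_ord k _); last by move=> m; apply: osc_ge0; lra.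
  rewrite /osc hi; have -> : (x <= (k%:R + 3 / 2) * (n%:R * T) - 2) = false.
    by apply/negbTE; rewrite -ltNge; lra.
  by rewrite subr0.
move=> ij zi zj; have [ji|ji|/val_inj E] := ltngtP i j; [exact: H ji zi zj|exact: H ji zj zi|].
by rewrite E eqxx in ij.
Qed.

(** If x lies in a single cutoff zone, W equals that front there and the residual vanishes.
    Otherwise expand around one active front: each index contributes K d + 2 K d + d, and the
    difference of the sines one more d. *)
Lemma residual_le (d : R) x : 0 <= K -> 0 <= d ->
  (forall i j : 'I_M, wide_zone T M n i x -> wide_zone T M n j x ->
    `|us i x - us j x| <= d /\ `|us1 i x - us1 j x| <= d) ->
  `|residual x| <= (M%:R * (3 * K + 1) + 1) * d * overlap x.
Proof.
move=> K0 d0 close.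
have [j cj] : exists j, chi j x != 0.
  apply: contrapT => nz; have := sum1 x; rewrite big1; first by move/eqP; rewrite eq_sym oner_eq0.
  by move=> j _; apply/eqP/negPn/negP => h; apply: nz; exists j.
have zj : cutoff_zone T M n j x.
  by apply: contrapT => /out[c0 _ _]; rewrite c0 eqxx in cj.
have wj := cutoff_zone_wide nT zj.
have k0 (k : 'I_M) : 0 <= osc ((k%:R + 3 / 2) * (n%:R * T) - 2) ((k%:R + 3 / 2) * (n%:R * T) + 1) x.
  by apply: osc_ge0; lra.
have C0 : 0 <= (M%:R * (3 * K + 1) + 1) * d.
  by rewrite mulr_ge0// addr_ge0// mulr_ge0//; lra.
rewrite (residual_expand j).
have [[i ij zi]|alone] := pselect (exists2 i, i != j & cutoff_zone T M n i x); last first.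
  have z i : i != j -> [/\ chi i x = 0, derive1 (chi i) x = 0 & derive1n 2 (chi i) x = 0].
    by move=> ij; apply: out => zi; apply: alone; exists i.
  rewrite big1; last first.
    move=> i _; have [->|/z[-> -> ->]] := eqVneq i j; first by rewrite !subrr !mulr0 !addr0.
    by rewrite !mul0r mulr0 !addr0.
  have -> : W x = us j x.
    rewrite /W /glued (bigD1 j)//= big1; last by move=> i /z[-> _ _]; rewrite mul0r.
    have := sum1 x; rewrite (bigD1 j)//= big1; last by move=> i /z[-> _ _].
    by rewrite !addr0 => ->; rewrite mul1r.
  by rewrite !subrr normr0 mulr_ge0// sumr_ge0.
have o1 := overlap_ge1 ij zi zj.
apply: le_trans (_ : (M%:R * (3 * K + 1) + 1) * d <= _); last by rewrite ler_peMr.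
apply: le_trans (ler_normB _ _) _; rewrite mulrDl mul1r; apply: lerD; last first.
  apply: le_trans (sin_dist _ _) _; apply: glued_close => // k wk; exact: (close k j wk wj).1.
apply: le_trans (ler_norm_sum _ _ _) _.
have -> : M%:R * (3 * K + 1) * d = \sum_(k < M) (3 * K + 1) * d.
  by rewrite sumr_const card_ord -mulrA mulr_natl.
apply: ler_sum => k _.
have [zk|/out[-> -> ->]] := pselect (cutoff_zone T M n k x); last first.
  by rewrite !mul0r mulr0 !addr0 normr0 mulr_ge0//; lra.
have [h0 h1] := close k j (cutoff_zone_wide nT zk) wj.
have [k1 k2] := bK k x; have /andP[c0 c1] := b01 k x.
have hs := le_trans (sin_dist (us j x) (us k x)) h0.
have m1 : `|derive1n 2 (chi k) x * (us k x - us j x)| <= K * d by rewrite normrM ler_pM.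
have m2 : `|derive1 (chi k) x * (us1 k x - us1 j x)| <= K * d by rewrite normrM ler_pM.
have m3 : `|chi k x * (sin (us k x) - sin (us j x))| <= 1 * d by rewrite normrM ler_pM// ger0_norm.
apply: le_trans (ler_normD _ _) _.
have := ler_normD (derive1n 2 (chi k) x * (us k x - us j x)) (2 * (derive1 (chi k) x * (us1 k x - us1 j x))).
rewrite [`|2 * _|]normrM (ger0_norm (ler0n _ 2)); lra.
Qed.

Variables (V : R -> R) (eps : R).
Hypotheses (du : forall j (x : R), is_derive x 1 (u j) (u1 j x))
  (du1 : forall j (x : R), is_derive x 1 (u1 j) (sin (u j x) - eps * V x * u j x))
  (V_per : periodic V T).

(** The equation is invariant under translation by multiples of the period of V. *)
Lemma front_at_is_derive j (x : R) : is_derive x 1 (us j) (us1 j x) /\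
  is_derive x 1 (us1 j) (sin (us j x) - eps * V x * us j x).
Proof.
split; first exact: is_derive_shift.
rewrite -(periodic_shift (j.+1 * n) x V_per).
exact: (@is_derive_shift R (u1 j) (- ((j.+1 * n)%:R * T))).
Qed.

Lemma glued_is_derive (x : R) : is_derive x 1 W (glued1 x).
Proof.
apply: is_derive_sum => j; have [d1 _ _] := smooth_is_derive (@sm j).
by apply: is_derive_mul; have [] := front_at_is_derive j x.
Qed.

Lemma glued1_is_derive (x : R) :
  is_derive x 1 glued1 (residual x + sin (W x) - eps * V x * W x).
Proof.
have -> : residual x + sin (W x) - eps * V x * W x =
    \sum_j ((derive1n 2 (chi j) x * us j x + derive1 (chi j) x * us1 j x) +
      (derive1 (chi j) x * us1 j x + chi j x * (sin (us j x) - eps * V x * us j x))).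
  rewrite /residual subrK /W /glued mulr_sumr -sumrB; apply: eq_bigr => j _.
  by rewrite -/(us j x); ring.
apply: is_derive_sum => j; have [d1 d2 _] := smooth_is_derive (@sm j).
have [h0 h1] := front_at_is_derive j x.
by apply: is_derive_add; exact: is_derive_mul.
Qed.

Lemma residual_continuous : continuous residual.
Proof.
have cW := is_derive_continuous glued_is_derive.
apply: cfB; last by apply: (cf_comp (@continuous_sin R)).
apply: cf_sum => j; have [d1 d2 c2] := smooth_is_derive (@sm j).
have c0 := is_derive_continuous d1; have c1 := is_derive_continuous d2.
have cu : continuous (us j) by apply: is_derive_continuous => x; have [] := front_at_is_derive j x.
have cu1 : continuous (us1 j) by apply: is_derive_continuous => x; have [] := front_at_is_derive j x.
apply: cfD; last by apply: cfM => //; exact: (cf_comp (@continuous_sin R)).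
apply: cfD; first exact: cfM.
by apply: cfM; [exact: cfc|exact: cfM].
Qed.

(** The norm of [overlap] is at most M sqrt 3 for every n, so uniform closeness of the fronts
    already gives smallness in L2. *)
Lemma residual_small (d : R) : 0 <= K -> 0 <= d ->
  (forall (i j : 'I_M) x, wide_zone T M n i x -> wide_zone T M n j x ->
    `|us i x - us j x| <= d /\ `|us1 i x - us1 j x| <= d) ->
  l2 residual /\ nrm residual <= (M%:R * (3 * K + 1) + 1) * d * (M%:R * Num.sqrt 3).
Proof.
move=> K0 d0 close.
have le x := residual_le K0 d0 (fun i j => close i j x).
pose C := (M%:R * (3 * K + 1) + 1) * d.
have C0 : 0 <= C by rewrite mulr_ge0// addr_ge0// mulr_ge0//; lra.
have ov : l2 overlap by apply: L2_sum => k; exact: L2_osc.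
have ov0 x : 0 <= overlap x by apply: sumr_ge0 => k _; apply: osc_ge0; lra.
have le' x : `|residual x| <= C * `|overlap x| by rewrite [`|overlap x|]ger0_norm//; exact: le.
have lr : l2 residual.
  apply: (L2_le _ (L2Z C ov)); first exact: continuous_measurable_fun residual_continuous.
  by move=> x; rewrite normrM (ger0_norm C0).
split=> //; apply: le_trans (nrm_le_ae C0 lr ov (nearW _ le')) _.
rewrite ler_wpM2l//; apply: le_trans (nrm_sum (c := fun=> Num.sqrt 3) _ _) _.
- by move=> k; exact: L2_osc.
- move=> k; rewrite nrm_osc ler_wsqrtr// ger0_norm; lra.
- by rewrite sumr_const card_ord mulr_natl.
Qed.

End Gluing.

(** * Exact solutions near an approximate one *)

Section Solution.
Variable R : realType.
Local Notation mu := (@lebesgue_measure R).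
Variables (V : R -> R) (eps BV : R).
Hypotheses (V_cont : continuous V) (V_bd : forall x, `|V x| <= BV).

Local Notation B := (1 + `|eps| * BV).

Lemma linearized_potential (w : R -> R) : measurable_fun setT w ->
  potential B (linearized V eps w).
Proof.
move=> mw; split.
  apply: measurable_funB.
    by apply: measurableT_comp mw; apply: continuous_measurable_fun; exact: continuous_cos.
  by apply: measurable_funM; [exact: measurable_cst|exact: continuous_measurable_fun].
move=> x; apply: le_trans (ler_normB _ _) _; apply: lerD; first exact: cos_max.
by rewrite normrM ler_wpM2l.
Qed.

(** Subtracting the equation of W, the function a + W is a solution exactly when a'' = N(x, a) - r
    with N(x, s) = sin (W + s) - sin W - eps V s. The linearization of N at s = 0 is the potential
    inverted by [app]. *)
Lemma correction (W W1 r : R -> R) (K : R) :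
  (forall x : R, is_derive x 1 W (W1 x)) ->
  (forall x : R, is_derive x 1 W1 (r x + sin (W x) - eps * V x * W x)) ->
  continuous r -> l2 r -> 0 <= K -> approx_inverse (linearized V eps W) K ->
  12 * K ^+ 2 * nrm r <= 1 ->
  exists a : R -> R, [/\ H2 a, stationary_solution V eps (fun x => a x + W x),
    H2norm setT a <= 6 * K * nrm r & forall x, `|a x| <= 6 * K * nrm r].
Proof.
move=> dW dW1 cr lr K0 app small.
have cW := is_derive_continuous dW.
have mW := continuous_measurable_fun cW.
have P := linearized_potential mW.
have BV0 : 0 <= BV by apply: le_trans (V_bd 0).
pose N (x s : R) := sin (W x + s) - sin (W x) - eps * V x * s.
have msin := continuous_measurable_fun (@continuous_sin R).
have mN (a : R -> R) : measurable_fun setT a -> measurable_fun setT (fun x => N x (a x)).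
  move=> ma; apply: measurable_funB.
    apply: measurable_funB; apply: measurableT_comp msin _ => //.
    exact: measurable_funD.
  apply: measurable_funM => //; apply: measurable_funM; first exact: measurable_cst.
  exact: continuous_measurable_fun.
have N0 x : N x 0 = 0 by rewrite /N addr0 subrr mulr0 subr0.
have lipN x a b : `|N x b - N x a| <= B * `|b - a|.
  have -> : N x b - N x a = (sin (W x + b) - sin (W x + a)) - eps * V x * (b - a) by rewrite /N; ring.
  apply: le_trans (ler_normB _ _) _; rewrite mulrDl mul1r; apply: lerD.
    by apply: le_trans (sin_dist _ _) _; rewrite (_ : W x + b - (W x + a) = b - a)//; ring.
  by rewrite !normrM ler_wpM2r// ler_wpM2l.
have quadN x a p : `|N x (a + p) - N x a - linearized V eps W x * p| <= 1 * ((`|a| + `|p|) * `|p|).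
  rewrite mul1r; have -> : N x (a + p) - N x a - linearized V eps W x * p =
    sin (W x + (a + p)) - sin (W x + a) - cos (W x) * p by rewrite /N /linearized; ring.
  exact: sin_taylor.
have sm : 1 * (12 * K ^+ 2 * nrm (fun x => - r x)) <= 1 by rewrite mul1r nrmN.
have [a0 [a1 [a2 [Wa ea na]]]] := semilinear_solve K0 ler01 P (L2N lr) mN N0 lipN quadN app sm.
rewrite nrmN// in na.
have [F [F1 [dF WF p0 p1 [e0 e1]]]] := W2_rep Wa.
have [_ _ lF lF1 la2] := WF; have [_ _ la0 la1 _] := Wa.
have cF := is_derive_continuous dF.
(* Regularity: the second weak derivative agrees almost everywhere with the continuous [G], so the
   representative [F1] is differentiable and [F] gives a classical solution. *)
pose G x := N x (F x) - r x.
have cG : continuous G.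
  apply: cfB => //; apply: cfB; last by apply: cfM => //; apply: cfM => //; exact: cfc.
  apply: cfB; last exact: (cf_comp (@continuous_sin R)).
  by apply: (cf_comp (@continuous_sin R)); exact: cfD.
have eG : {ae mu, forall x, a2 x = G x}.
  by apply: filterS2 ea e0 => x h1 h2; rewrite /G h2; lra.
have lG : l2 G by apply: L2_ae la2 _ eG; exact: continuous_measurable_fun.
have dF1 := primitive_derive lG cG (primitive_ae la2 lG eG p1).
have nF := nrm_ae lF la0 e0; have nF1 := nrm_ae lF1 la1 e1.
have [HF _ _] := W2_weak_derivative WF.
have n0 := nrm_ge0 a0; have n1 := nrm_ge0 a1; have n2 := nrm_ge0 a2.
exists F; split => //.
- have du x := is_derive_add (dF x) (dW x).
  have dE := derive1_is_derive du.
  have du1 x := is_derive_add (dF1 x) (dW1 x).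
  have dE1 := derive1_is_derive du1.
  move=> x; rewrite derive1nS /= dE; split.
  + exact: (@ex_derive _ _ _ _ _ _ _ (du x)).
  + exact: (@ex_derive _ _ _ _ _ _ _ (du1 x)).
  + by rewrite dE1 /G /N [F x + W x]addrC; ring.
- rewrite (H2norm_W2 WF) nF nF1; apply: le_trans na; rewrite /Wnorm.
  have s0 : 0 <= nrm a0 + nrm a1 + nrm a2 by rewrite !addr_ge0.
  rewrite -[leRHS](ger0_norm s0) -sqrtr_sqr ler_wsqrtr//.
  have := mulr_ge0 n0 n1; have := mulr_ge0 n0 n2; have := mulr_ge0 n1 n2; lra.
- move=> x; apply: le_trans (sup_bound x lF lF1 p0) _; rewrite nF nF1.
  by apply: le_trans na; rewrite /Wnorm lerDl.
Qed.

End Solution.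

Section PrimaryFronts.
Variable R : realType.

(** The spectrum of a front is contained in the union of a negative half-line and lam0, so an
    unstable spectral point can only be the simple real eigenvalue lam0. *)
Lemma primary_front_props (T : R) (V chip chim : R -> R) (eps : R) (u vm vp : R -> R) :
  eps != 0 -> primary_front T V chip chim eps u vm vp ->
  [/\ stationary_solution V eps u, nondegenerate_state V eps u,
    stationary_solution V eps vm /\ periodic vm T,
    stationary_solution V eps vp /\ periodic vp T &
    [/\ H2 (fun x => chip x * (u x - vp x)), H2 (fun x => chim x * (u x - vm x)) &
      spectrally_unstable V eps u ->
        exists2 r : R, 0 < r & simple_eigenvalue (L_op V eps u) r%:C%C]].
Proof.
move=> eps0 [k [l [s0 [_ _ [K [e0 [rho [U [Um [Up [lam0 [[K0 e00 r0] H _ [eb -> -> ->]]]]]]]]]]]]].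
have [[st nd] _ [Hp Hm] [[pm _] sm [pp _] sp _] [sub simple]] := H eps eb.
split => //; split => // -[lam /sub[r -> rl]] /= rpos; exists r => //.
by case: rl => [rl|->//]; lra.
Qed.

Lemma right_inverse_le (Q : R -> R) (K K' : R) : K <= K' -> right_inverse Q K -> right_inverse Q K'.
Proof.
move=> KK inv w lw; have [f [f1 [f2 [W e n]]]] := inv w lw.
by exists f, f1, f2; split => //; apply: le_trans n _; rewrite ler_wpM2r ?nrm_ge0.
Qed.

End PrimaryFronts.

Theorem corollary8p3 (R : realType) (T : R) (V : R -> R) (eps : R) (M : nat)
    (chip chim : R -> R) (u vm vp : 'I_M -> R -> R)
    (chi : nat -> 'I_M -> R -> R) (n0 : nat) (K : R)
    (T_gt0 : 0 < T) (V_C1 : C1 V) (V_per : periodic V T)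
    (eps_neq0 : eps != 0) (M_gt0 : (0 < M)%N)
    (chipm : end_cutoffs chip chim)
    (u_front : forall j, primary_front T V chip chim eps (u j) (vm j) (vp j))
    (v_match : forall i j : 'I_M, j = i.+1 :> nat -> vp i = vm j)
    (chi_cut : forall n, (n0 <= n)%N -> gluing_cutoffs T K n (chi n)) :
  exists (N : nat) (a ut : nat -> R -> R),
  [/\ forall n, (N <= n)%N ->
        [/\ stationary_solution V eps (ut n), nondegenerate_state V eps (ut n),
            H2 (a n) & forall x, ut n x = a n x + glued T n (chi n) u x],
      (fun n => H2norm setT (a n)) @ \oo --> (0 : R),
      (forall j, strongly_spectrally_stable V eps (u j)) ->
        forall n, (N <= n)%N -> strongly_spectrally_stable V eps (ut n) &
      (exists j0, spectrally_unstable V eps (u j0)) ->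
        forall n, (N <= n)%N -> spectrally_unstable V eps (ut n)].
Proof.
have cV := C1_continuous V_C1.
have [BV BV0 bV] := periodic_bounded T_gt0 V_per cV.
pose B := 1 + `|eps| * BV.
have B0 : 0 <= B by rewrite addr_ge0// mulr_ge0// ltW.
have P (w : R -> R) : measurable_fun setT w -> potential B (linearized V eps w).
  exact: linearized_potential.
have props j := primary_front_props eps_neq0 (u_front j).
have stat j : stationary_solution V eps (u j) by case: (props j).
have du j : forall x : R, is_derive x 1 (u j) (derive1 (u j) x).
  exact: (stationary_is_derive (stat j)).1.
have du1 j : forall x : R, is_derive x 1 (derive1 (u j)) (sin (u j x) - eps * V x * u j x).
  exact: (stationary_is_derive (stat j)).2.
have mu_ j : measurable_fun setT (u j).
  by apply: continuous_measurable_fun; exact: is_derive_continuous (du j).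
have [C C1 HC] := partition_close R.
(* The sum of the absolute values dominates all the constants at once. *)
have [K0 K00 invK0] : exists2 K0 : R, 0 <= K0 & forall j, right_inverse (linearized V eps (u j)) K0.
  have /choice[k Hk] : forall j, exists k, right_inverse (linearized V eps (u j)) k.
    move=> j; have [_ nd _ _ _] := props j.
    have [k Hk] := resolvent_right_inverse (P _ (mu_ j)) nd; exists k.
    by move: Hk; congr (right_inverse _ _); apply/funext => x; rewrite addr0.
  exists (\sum_j `|k j|); first exact: sumr_ge0.
  move=> j; apply: right_inverse_le (Hk j); apply: le_trans (ler_norm _) _.
  exact: (@ler_sum_ord _ _ (fun j => `|k j|)).
have [d1 d10 [K' K'0 app]] := locally_close_approx_inverse M B0 K00 C1.
(* A single [N] serves all conclusions, so the threshold is fixed before stability is assumed; it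
   defaults to 1 if the assumption fails. The same holds for [d3] and instability. *)
have [d2 d20 stab] : exists2 d : R, 0 < d & (forall j, strongly_spectrally_stable V eps (u j)) ->
    forall w (c : 'I_M -> R), measurable_fun setT w -> nondegenerate_state V eps w ->
    locally_close C d (linearized V eps w) (fun j x => linearized V eps (u j) (x - c j)) ->
    strongly_spectrally_stable V eps w.
  have [st|nst] := pselect (forall j, strongly_spectrally_stable V eps (u j)); last by exists 1.
  by have [d d0 H] := spectrally_stable_glued B0 C1 P mu_ st; exists d.
have [d3 d30 [X unst]] : exists2 d : R, 0 < d & exists X : R,
    (exists j0, spectrally_unstable V eps (u j0)) -> exists j0 : 'I_M, forall w (c : R),
    measurable_fun setT w ->
    (forall x, `|x - c| <= X ->
      `|linearized V eps w x - linearized V eps (u j0) (x - c)| <= d) ->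
    spectrally_unstable V eps w.
  have [[j0 un]|nun] := pselect (exists j0, spectrally_unstable V eps (u j0)); last first.
    by exists 1 => //; exists 0.
  have [_ _ _ _ [_ _ /(_ un)[r r0 sr]]] := props j0.
  have [d d0 [X H]] := spectrally_unstable_glued P (mu_ j0) r0 sr.
  by exists d => //; exists X => _; exists j0.
pose d := Num.min d1 (Num.min d2 d3).
have d0 : 0 < d by rewrite !lt_min d10 d20 d30.
have dd1 : d <= d1 by rewrite ge_min lexx.
have dd2 : d <= d2 by rewrite !ge_min lexx orbT.
have dd3 : d <= d3 by rewrite !ge_min lexx !orbT.
pose c := (M%:R * (3 * `|K| + 1) + 1) * (M%:R * Num.sqrt 3) : R.
have c0 : 0 <= c.
  by rewrite mulr_ge0 ?addr_ge0 ?mulr_ge0 ?addr_ge0 ?mulr_ge0 ?sqrtr_ge0.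
have zones (e : R) : 0 < e -> exists N : nat, forall n, (N <= n)%N -> 4 <= n%:R * T /\
    forall (i j : 'I_M) x, wide_zone T M n i x -> wide_zone T M n j x ->
      `|front_at T u n i x - front_at T u n j x| <= e /\
      `|front_at T (fun j => derive1 (u j)) n i x - front_at T (fun j => derive1 (u j)) n j x| <= e.
  move=> e0; apply: (@zones_close R T M u _ vp (fun j => derive1 (vp j)) vm (fun j => derive1 (vm j))) => //.
  - move=> j; have [_ _ _ [sp pp] _] := props j.
    by split => //; exact: derive1_periodic (stationary_is_derive sp).1 pp.
  - move=> j; have [_ _ [sp pp] _ _] := props j.
    by split => //; exact: derive1_periodic (stationary_is_derive sp).1 pp.
  - by move=> i j /v_match ->.
  - move=> j e' e'0; have [_ _ [sm _] [sp _] [Hp Hm _]] := props j.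
    exact: (front_limits chipm (du j) (stationary_is_derive sp).1 (stationary_is_derive sm).1 Hp Hm e'0).
pose W n := glued T n (chi n) u.
pose r n := residual T u (fun j => derive1 (u j)) n (chi n).
have small (e : R) : 0 < e -> exists N : nat, forall n, (N <= n)%N -> (n0 <= n)%N ->
    L2 setT (r n) /\ L2norm setT (r n) <= c * e.
  move=> e0; have [N HN] := zones e e0; exists N => n Nn nn; have [nT close] := HN n Nn.
  have [sm b01 sum1 out bK] := gluing_cutoffs_props M_gt0 (chi_cut n nn).
  have [] := @residual_small R T M u (fun j => derive1 (u j)) n (chi n) `|K| sm b01 sum1 out bK nT
    V eps du du1 V_per e (normr_ge0 K) (ltW e0) close.
  by move=> lr nr; split => //; apply: le_trans nr _; rewrite /c mulrAC.
(* The single inequality s ||r|| <= min(d / 2, 1) yields 12 K'^2 ||r|| <= 1, which starts the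
   iteration, and 6 K' ||r|| <= d / 2, which bounds the correction. *)
pose s := 6 * K' + 12 * K' ^+ 2; have s0 : 0 <= s by rewrite addr_ge0 ?mulr_ge0 ?sqr_ge0.
pose e := Num.min (d / 2) 1; have e0 : 0 < e by rewrite lt_min divr_gt0/=.
have cs0 : 0 <= c * s := mulr_ge0 c0 s0; have cs1 : 0 < 1 + c * s by rewrite ltr_wpDr.
pose e1 := e / (1 + c * s); have e10 : 0 < e1 by rewrite divr_gt0.
have ce1 : c * e1 * s <= e.
  rewrite /e1 -mulrA [_ * s]mulrAC mulrA -[c * (e * s)]mulrCA ler_pdivrMr// ler_pM2l//.
  by rewrite lerDr.
have [N1 small1] := small e1 e10.
have d20' : 0 < d / 2 by rewrite divr_gt0.
(* Half of [d] is spent on the distance from the glued profile to the fronts, the other half on the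
   correction. *)
have [N2 zones2] := zones (d / 2) d20'.
have [N3 HC3] := HC T M V eps d u M_gt0 T_gt0 V_per d0.
(* The window of radius X around a centre must fit into its wide zone, whose ends are at distance
   3/4 n T from the centre. *)
have [N4 HN4] := eventually_ge (2 * `|X|) T_gt0.
pose N := maxn n0 (maxn N1 (maxn N2 (maxn N3 N4))).
have Nle n : (N <= n)%N -> [/\ n0 <= n, N1 <= n, N2 <= n, N3 <= n & N4 <= n]%N.
  by rewrite !geq_max => /and5P.
have closeW n (j : 'I_M) x : (N <= n)%N -> wide_zone T M n j x ->
    `|W n x - front_at T u n j x| <= d / 2.
  move=> /Nle[nn _ nN2 _ _] wj; have [nT close] := zones2 n nN2.
  have [sm b01 sum1 out bK] := gluing_cutoffs_props M_gt0 (chi_cut n nn).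
  by apply: glued_close => // i wi; exact: (close i j x wi wj).1.
have apW n (w : R -> R) : (N <= n)%N -> measurable_fun setT w ->
    (forall (j : 'I_M) x, wide_zone T M n j x -> `|w x - front_at T u n j x| <= d) ->
    approx_inverse (linearized V eps w) K'.
  move=> /Nle[_ _ _ nN3 _] mw close; have lc := HC3 n nN3 w close.
  apply: app (P _ mw) _ _ (locally_close_le dd1 lc).
    by move=> j; exact: potential_shift (P _ (mu_ j)).
  by move=> j; exact: right_inverse_shift (invK0 j).
(* The implication is inside the existential so that [choice] applies to all n; below [N] the
   witness is 0. *)
have sol n : exists a, (N <= n)%N -> [/\ H2 a, stationary_solution V eps (fun x => a x + W n x),
    H2norm setT a <= 6 * K' * L2norm setT (r n) & forall x, `|a x| <= d / 2].
  have [Nn|] := boolP (N <= n)%N; last by exists (fun=> 0).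
  have [nn nN1 nN2 _ _] := Nle n Nn; have [nT _] := zones2 n nN2.
  have [lr nr] := small1 n nN1 nn; have r0 := nrm_ge0 (r n).
  have [sm b01 sum1 out bK] := gluing_cutoffs_props M_gt0 (chi_cut n nn).
  have dW (x : R) : is_derive x 1 (W n) (glued1 T u (fun j => derive1 (u j)) n (chi n) x).
    exact: (glued_is_derive n sm du du1 V_per).
  have dW1 (x : R) : is_derive x 1 (glued1 T u (fun j => derive1 (u j)) n (chi n))
      (r n x + sin (W n x) - eps * V x * W n x).
    exact: (glued1_is_derive n sm du du1 V_per).
  have cr : continuous (r n) := residual_continuous sm du du1 V_per.
  have mW : measurable_fun setT (W n).
    by apply: continuous_measurable_fun; exact: is_derive_continuous dW.
  have aW : approx_inverse (linearized V eps (W n)) K'.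
    apply: (apW n) => // j x wj; apply: le_trans (closeW n j x Nn wj) _.
    by rewrite ler_pdivrMr// ler_peMr// ?ler1n// ltW.
  have rs : s * L2norm setT (r n) <= e.
    by apply: le_trans ce1; rewrite mulrC ler_wpM2r.
  have k1 : 0 <= K' * L2norm setT (r n) by exact: mulr_ge0.
  have k2 : 0 <= K' ^+ 2 * L2norm setT (r n) by rewrite mulr_ge0// sqr_ge0.
  have e_d : e <= d / 2 by rewrite ge_min lexx.
  have e_1 : e <= 1 by rewrite ge_min lexx orbT.
  have [|a [Ha sa na ba]] := correction cV bV dW dW1 cr lr K'0 aW.
    by move: rs; rewrite /s mulrDl; clear -k1 k2 e_1; lra.
  exists a => _; split => // x; apply: le_trans (ba x) _.
  by move: rs; rewrite /s mulrDl; clear -k1 k2 e_d; lra.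
have [a Ha] := choice sol.
exists N, a, (fun n x => a n x + W n x).
have mut n : (N <= n)%N -> measurable_fun setT (fun x => a n x + W n x).
  move=> /Ha[_ st _ _]; apply: continuous_measurable_fun.
  exact: is_derive_continuous (stationary_is_derive st).1.
have closeU n (j : 'I_M) x : (N <= n)%N -> wide_zone T M n j x ->
    `|a n x + W n x - front_at T u n j x| <= d.
  move=> Nn wj; have [_ _ _ ba] := Ha n Nn; have := closeW n j x Nn wj.
  rewrite -addrA => h; apply: le_trans (ler_normD _ _) _; have := ba x; clear -h; lra.
have nd n : (N <= n)%N -> nondegenerate_state V eps (fun x => a n x + W n x).
  move=> Nn; have mu' := mut n Nn.
  apply: (nondegenerate_of_right_inverse (P _ mu') (K := 6 * K')).
  apply: (right_inverse_of_approx K'0 (P _ mu')).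
  by apply: (apW n) => // j x; exact: closeU.
split.
- by move=> n Nn; have [h1 h2 _ _] := Ha n Nn; split => //; exact: nd.
- apply/cvgrPdist_le => t t0.
  have k0 : 0 < 6 * K' * c + 1 by rewrite ltr_wpDl// !mulr_ge0.
  (* The bound on [a n] is linear in the residual, so the solutions already chosen have corrections
     tending to 0; the summand 1 keeps the denominator positive. *)
  have [N5 small5] := small (t / (6 * K' * c + 1)) (divr_gt0 t0 k0).
  exists (maxn N N5) => // n /=; rewrite geq_max => /andP[Nn nN5].
  have [h1 _ h3 _] := Ha n Nn; have [nn _ _ _ _] := Nle n Nn.
  have [_ nr] := small5 n nN5 nn.
  rewrite sub0r normrN ger0_norm ?sqrtr_ge0//; apply: le_trans h3 _.
  apply: le_trans (_ : 6 * K' * (c * (t / (6 * K' * c + 1))) <= _).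
    by rewrite ler_wpM2l// mulr_ge0.
  rewrite [leLHS](_ : _ = 6 * K' * c * t / (6 * K' * c + 1)); last by rewrite !mulrA.
  by move: k0; move: (6 * K' * c) => y y0; rewrite ler_pdivrMr//; clear -y0 t0; lra.
- move=> st n Nn; apply: (stab st _ (fun j => (j.+1 * n)%:R * T)) (mut n Nn) (nd n Nn) _.
  have [_ _ _ nN3 _] := Nle n Nn.
  by apply: locally_close_le dd2 _; apply: HC3 => // j x; exact: closeU.
- move=> /unst[j0 H] n Nn; apply: (H _ ((j0.+1 * n)%:R * T)) (mut n Nn) _ => x xX.
  apply: le_trans dd3.
  have [_ _ _ _ nN4] := Nle n Nn; have nX := HN4 n nN4.
  have cj : (j0.+1 * n)%:R * T = (j0%:R + 1) * (n%:R * T) by rewrite natrM -natr1 mulrA.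
  have wz : wide_zone T M n j0 x.
    have := ler_norm X; have := normr_ge0 X => X0 X1.
    by move: xX; rewrite cj ler_norml => /andP[x1 x2]; clear -x1 x2 nX X0 X1; split=> _; lra.
  have cl := closeU n j0 x Nn wz.
  rewrite /linearized (periodic_shift _ x V_per).
  have -> : cos (a n x + W n x) - eps * V x - (cos (u j0 (x - (j0.+1 * n)%:R * T)) - eps * V x) =
    cos (a n x + W n x) - cos (u j0 (x - (j0.+1 * n)%:R * T)) by ring.
  exact: le_trans (cos_dist _ _) cl.
Qed.
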